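(* Let $k\in\mathbb{N}$ be fixed. Let $(g_{i,j})_{1\le i\le k,\ j\ge 1}$ be a jointly Gaussian family of $N(0,1)$ random variables on a probability space such that ${\rm E}[g_{i,j}g_{i,j'}]=0$ whenever $j\neq j'$ (so for each fixed $i$, the $g_{i,1},g_{i,2},\ldots$ are independent). For $i=1,\ldots,k$ let $$F_i=\sum_{j=1}^\infty \lambda_{i,j}(g_{i,j}^2-1),\qquad \lambda_{i,j}\in\mathbb{R},\ \sum_{j=1}^\infty\lambda_{i,j}^2<\infty,$$ and $F=(F_1,\ldots,F_k)$. Suppose the law of $F$ is not absolutely continuous with respect to Lebesgue measure on $\mathbb{R}^k$. Then there exist $k-1$ independent $N(0,1)$ random variables $\eta_1,\ldots,\eta_{k-1}$ (on the same probability space) and real numbers $a_1,\ldots,a_k,b_1,\ldots,b_{k-1}$ with $(a_1,\ldots,a_k)\neq(0,\ldots,0)$ such that almost surely $$a_1F_1+\cdots+a_kF_k=b_1(\eta_1^2-1)+\cdots+b_{k-1}(\eta_{k-1}^2-1).$$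
   Context: The series defining $F_i$ converge in $L^2$ and almost surely. For $k=1$ the right-hand side is the empty sum $0$. *)

(* Defs.v *)
From HB Require Import structures.
From mathcomp Require Import all_boot all_order all_algebra.
From mathcomp Require Import all_classical all_reals all_analysis.

Set Implicit Arguments.
Unset Strict Implicit.
Unset Printing Implicit Defensive.

Import Order.TTheory GRing.Theory Num.Theory.
Import numFieldNormedType.Exports.

Local Open Scope classical_set_scope.
Local Open Scope ring_scope.

Definition std_normal {d} {T : measurableType d} {R : realType}
  (P : probability T R) (X : T -> R) : Prop :=
  measurable_fun [set: T] X /\
  forall A : set R, measurable A -> P (X @^-1` A) = normal_prob 0 1 A.

Definition gaussian_rv {d} {T : measurableType d} {R : realType}
  (P : probability T R) (X : T -> R) : Prop :=
  measurable_fun [set: T] X /\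
  exists m : R,
    (exists s : R, 0 < s /\
       forall A : set R, measurable A -> P (X @^-1` A) = normal_prob m s A)
    \/ {ae P, forall w, X w = m}.

Definition jointly_gaussian {d} {T : measurableType d} {R : realType}
  (P : probability T R) (I : Type) (X : I -> T -> R) : Prop :=
  forall (n : nat) (idx : 'I_n -> I) (c : 'I_n -> R),
    gaussian_rv P (fun w => \sum_(l < n) c l * X (idx l) w).

Definition mutually_independent {d} {T : measurableType d} {R : realType}
  (P : probability T R) (n : nat) (X : 'I_n -> T -> R) : Prop :=
  (forall l, measurable_fun [set: T] (X l)) /\
  forall A : 'I_n -> set R, (forall l, measurable (A l)) ->
    P (\bigcap_(l in [set: 'I_n]) (X l @^-1` A l)) =
    (\prod_(l < n) P (X l @^-1` A l))%E.

Definition box {R : realType} (k : nat) (lo hi : k.-tuple R) : set (k.-tuple R) :=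
  [set x | forall i : 'I_k, tnth lo i <= tnth x i <= tnth hi i].

Definition box_vol {R : realType} (k : nat) (lo hi : k.-tuple R) : R :=
  \prod_(i < k) Num.max 0 (tnth hi i - tnth lo i).

Definition lebesgue_null {R : realType} (k : nat) (A : set (k.-tuple R)) : Prop :=
  forall e : R, 0 < e ->
    exists lo hi : nat -> k.-tuple R,
      A `<=` \bigcup_n box (lo n) (hi n) /\
      (\sum_(n <oo) (box_vol (lo n) (hi n))%:E <= e%:E)%E.

Definition law_abs_continuous {d} {T : measurableType d} {R : realType}
  (P : probability T R) (k : nat) (X : 'I_k -> T -> R) : Prop :=
  forall A : set (k.-tuple R), measurable A -> lebesgue_null A ->
    P ((fun w => [tuple X i w | i < k]) @^-1` A) = 0%E.

(* Main.v *)
(* Let [H] be the closed Gaussian space spanned by the [g i j].  Each [F i] is the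
   element of the second chaos attached to the symmetric bilinear form
   [B i x y = <A i x, y>] on [H], where [A i h = sum_j lam i j <g i j, h> g i j].

   If [det (B i h (e p)) <> 0] for some [h] and [e 0, ..., e k-1] in [H], we may
   take [e] orthonormal.  In the independent coordinates [x = (e p)], with the
   orthogonal complement frozen, [F] is a quadratic map whose Jacobian is
   [2 D] with [D i p = A i (e p)].  The Gaussian polynomial [det D] is almost
   surely nonzero because its leading coefficient along [h] is
   [det (B i h (e p))].  Since [F x - F y = (D x + D y) (x - y)], [F] has a
   Lipschitz inverse on each set where a fixed rational matrix is close to
   [D^-1], so small cubes have preimages of comparable probability there, and the
   law of [F] is absolutely continuous.

   Otherwise the vectors [A i h] are linearly dependent for every [h].  Choosing
   [h0] so that their rank is maximal, with a relation [sum_i a i A i h0 = 0], a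
   perturbation argument shows that [sum_i a i B i] vanishes on the orthogonal
   complement of the span of the [A i h0], of dimension at most [k - 1].
   Diagonalising this form gives the [eta l]; the two sides of the conclusion
   agree because an element of the second chaos is determined by its form. *)

Require Import Defs.
From HB Require Import structures.
From mathcomp Require Import all_boot all_order all_algebra.
From mathcomp Require Import all_classical all_reals all_analysis.
From mathcomp Require Import measurable_realfun.
From mathcomp Require complex.
From mathcomp Require Import ring lra.

Set Implicit Arguments.
Unset Strict Implicit.
Unset Printing Implicit Defensive.

Import Order.TTheory GRing.Theory Num.Theory.
Import numFieldNormedType.Exports.

Local Open Scope classical_set_scope.
Local Open Scope ring_scope.

(** * Integration against normal laws *)

(** Gaussian laws enter only through the integrals of [cos (X + th)]. The phase lets a real function
    carry the whole characteristic function, dominated convergence passes the identities to limits,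
    and products of cosines are sums of cosines, so that they span an algebra. Closing this algebra
    under bounded pointwise limits produces the indicators of all events generated by a linear space
    of variables. This gives both uniqueness of laws and independence of the sigma-algebras attached
    to a subspace and to its orthogonal complement. Freezing the complement is then taken literally:
    the sample space carries two sigma-algebras, and [w |-> (w, w)] has a product law on the pair of
    them. For this, random variables have to be functions defined everywhere and measurable for the
    right sigma-algebra, not classes modulo null sets. Hence limits are pointwise upper limits, and
    convergence is tracked both almost surely and in mean square. *)

Section normal_integral.
Context {R : realType}.
Variables (m s : R).
Hypothesis s0 : 0 < s.
Local Notation mu := (@lebesgue_measure R).
Local Notation N := (normal_prob m s).
Local Notation pdf := (normal_pdf m s).

Lemma ge0_integral_normal_prob (f : measurableTypeR R -> \bar R) : (forall x, 0 <= f x)%E ->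
  measurable_fun [set: R] f ->
  (\int[N]_x f x = \int[mu]_x (f x * (pdf x)%:E))%E.
Proof.
move=> f0 mf.
have dom : N `<< mu := normal_prob_dominates m s.
rewrite -(Radon_Nikodym_SigmaFinite.change_of_variables dom)//.
have mg := measurable_int _ (Radon_Nikodym_SigmaFinite.f_integrable dom).
have mpdf : measurable_fun [set: R] (fun x => (pdf x)%:E).
  by apply/measurable_EFinP; exact: measurable_normal_pdf.
apply: ae_eq_integral => //.
- exact: emeasurable_funM.
- exact: emeasurable_funM.
- apply: ae_eqe_mul2l; apply: integral_ae_eq => //.
  + exact: Radon_Nikodym_SigmaFinite.f_integrable.
  + by move=> E _ mE; rewrite -Radon_Nikodym_SigmaFinite.f_integral.
Qed.


(** A normal density of twice the standard deviation absorbs polynomial growth: the quotient of the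
    two densities is [2 * expR (- u)] with [u = 3 (x - m)^2 / (8 s^2)], the sixth power is a
    multiple of [u ^+ 3], and [u ^+ 3 <= 6 * expR u]. *)
Lemma normal_pdf_dom : exists2 C, 0 <= C &
  forall x, (1 + (x - m) ^+ 6) * pdf x <= C * normal_pdf m (s *+ 2) x.
Proof.
have s2 : s *+ 2 != 0 by rewrite mulrn_eq0/= gt_eqF.
exists (2 * (1 + (8 * s ^+ 2 / 3) ^+ 3 * 6)).
  by rewrite mulr_ge0// addr_ge0// mulr_ge0// exprn_ge0// divr_ge0// mulr_ge0// sqr_ge0.
move=> x; rewrite normal_pdfE ?gt_eqF// normal_pdfE//.
set u := (x - m) ^+ 2 * 3 / (8 * s ^+ 2).
have u0 : 0 <= u by rewrite divr_ge0// mulr_ge0// sqr_ge0.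
have sE : normal_peak s = 2 * normal_peak (s *+ 2).
  rewrite /normal_peak (_ : (s *+ 2) ^+ 2 * pi *+ 2 = 4 * (s ^+ 2 * pi *+ 2)); last by ring.
  rewrite sqrtrM// (_ : 4 = 2 ^+ 2 :> R); last by ring.
  by rewrite sqrtr_sqr ger0_norm// invfM mulrA divff ?mul1r.
rewrite sE.
have -> : normal_fun m s x = normal_fun m (s *+ 2) x * expR (- u).
  rewrite /normal_fun -expRD; congr expR; rewrite /u; field.
  by rewrite gt_eqF.
set p := normal_peak _; set q := normal_fun _ _ _.
rewrite (_ : (_ * (_ * _)) = (1 + (x - m) ^+ 6) * expR (- u) * (2 * (p * q))); last by ring.
rewrite (_ : 2 * _ * _ = (1 + (8 * s ^+ 2 / 3) ^+ 3 * 6) * (2 * (p * q))); last by ring.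
apply: ler_wpM2r.
  by rewrite !mulr_ge0 ?normal_peak_ge0 ?normal_fun_ge0.
rewrite expRN ler_pdivrMr ?expR_gt0//.
have -> : (x - m) ^+ 6 = (8 * s ^+ 2 / 3) ^+ 3 * u ^+ 3.
  rewrite /u; field; by rewrite gt_eqF.
set a := (8 * s ^+ 2 / 3) ^+ 3.
have a0 : 0 <= a by rewrite exprn_ge0// divr_ge0// mulr_ge0// sqr_ge0.
have h1 : u ^+ 3 <= 6 * expR u.
  have := expR_ge1Dxn 2 u0; rewrite (_ : 3`!%:R = 6 :> R)// => h.
  by lra.
have h2 : 1 <= expR u by rewrite -[leLHS]expR0 ler_expR.
nra.
Qed.

Lemma integrable_growth_pdf (f : R -> R) (K : R) : measurable_fun [set: R] f ->
  (forall x, `|f x| <= K * (1 + (x - m) ^+ 6)) ->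
  mu.-integrable setT (fun x => (f x * pdf x)%:E).
Proof.
move=> mf fK; have [C C0 hC] := normal_pdf_dom.
have K0 : 0 <= K.
  have := le_trans (normr_ge0 _) (fK m).
  by rewrite subrr expr0n/= addr0 mulr1.
apply: (@le_integrable _ _ _ mu _ _ _ (fun x => ((K * C) * normal_pdf m (s *+ 2) x)%:E)) => //.
- by apply/measurable_EFinP/measurable_funM => //; exact: measurable_normal_pdf.
- move=> x _; rewrite lee_fin normrM (ger0_norm (normal_pdf_ge0 _ _ _)).
  apply: (le_trans _ (ler_norm _)); rewrite -mulrA.
  apply: (@le_trans _ _ (K * (1 + (x - m) ^+ 6) * pdf x)).
    by apply: ler_wpM2r => //; exact: normal_pdf_ge0.
  by rewrite -mulrA; apply: ler_wpM2l.
- under eq_fun do rewrite EFinM.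
  by apply: integrableZl => //; exact: integrable_normal_pdf.
Qed.

Lemma integrable_growth_normal (f : R -> R) (K : R) : measurable_fun [set: R] f ->
  (forall x, `|f x| <= K * (1 + (x - m) ^+ 6)) ->
  N.-integrable setT (EFin \o f).
Proof.
move=> mf fK; apply/integrableP; split; first exact/measurable_EFinP.
rewrite ge0_integral_normal_prob//; last first.
  by apply: measurableT_comp => //; exact/measurable_EFinP.
have /integrableP[_] := integrable_growth_pdf mf fK.
apply: le_lt_trans.
rewrite le_eqVlt; apply/orP; left; apply/eqP; apply: eq_integral => x _ /=.
by rewrite normrM EFinM (ger0_norm (normal_pdf_ge0 _ _ _)).
Qed.

Lemma Rintegral_normal_prob (f : R -> R) (K : R) : measurable_fun [set: R] f ->
  (forall x, `|f x| <= K * (1 + (x - m) ^+ 6)) ->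
  \int[N]_x f x = \int[mu]_x (f x * pdf x).
Proof.
move=> mf fK.
have fN := integrable_growth_normal mf fK.
have fmu := integrable_growth_pdf mf fK.
have mpdf := measurable_normal_pdf m s.
have key (g : R -> R) : measurable_fun [set: R] g -> (forall x, 0 <= g x) ->
    (\int[N]_x (g x)%:E = \int[mu]_x ((g x * pdf x)%:E))%E.
  move=> mg g0; rewrite ge0_integral_normal_prob.
  - by apply: eq_integral => x _; rewrite EFinM.
  - by move=> x; rewrite lee_fin.
  - exact/measurable_EFinP.
rewrite /Rintegral; congr fine.
rewrite integralE [RHS]integralE.
congr (_ - _)%E.
- transitivity (\int[N]_x (Num.max (f x) 0)%:E)%E.
    by apply: eq_integral => x _; rewrite funeposE EFin_max.
  rewrite key; last 2 first.
  + exact: measurable_funrpos.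
  + by move=> x; rewrite le_max lexx orbT.
  apply: eq_integral => x _; rewrite funeposE -EFin_max; congr EFin.
  by rewrite maxr_pMl ?mul0r// normal_pdf_ge0.
- transitivity (\int[N]_x (Num.max (- f x) 0)%:E)%E.
    by apply: eq_integral => x _; rewrite funenegE EFin_max EFinN.
  rewrite key; last 2 first.
  + exact: measurable_funrneg.
  + by move=> x; rewrite le_max lexx orbT.
  apply: eq_integral => x _; rewrite funenegE -EFinN -EFin_max; congr EFin.
  by rewrite maxr_pMl ?mul0r ?mulNr// normal_pdf_ge0.
Qed.

End normal_integral.

Lemma is_derive_cast {R : numFieldType} {V W : normedModType R} (f : V -> W)
  (x v : V) (d d' : W) : is_derive x v f d -> d = d' -> is_derive x v f d'.
Proof. by move=> h <-. Qed.

Lemma is_derive_comp_fun {R : realType} (f g : R -> R) (x a b : R) :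
  is_derive (g x) (1 : R) f a -> is_derive x (1 : R) g b ->
  is_derive x (1 : R) (fun y => f (g y)) (a * b).
Proof. by move=> df dg; have := is_derive1_comp df dg. Qed.

Section normal_stein.
Context {R : realType}.
Variables (m s : R).
Hypothesis s0 : 0 < s.
Local Notation mu := (@lebesgue_measure R).
Local Notation N := (normal_prob m s).
Local Notation pdf := (normal_pdf m s).

Lemma is_derive_normal_pdf (x : R) :
  is_derive x (1 : R) pdf (- ((x - m) / s ^+ 2) * pdf x).
Proof.
rewrite normal_pdfE ?gt_eqF//.
pose u (y : R) : R := - (y - m) ^+ 2 / (s ^+ 2 *+ 2).
have du : is_derive x (1 : R) u (- ((x - m) / s ^+ 2)).
  apply: is_derive_eq; rewrite /GRing.scale /=.
  field; by rewrite gt_eqF.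
have de : is_derive x (1 : R) (expR \o u) (- ((x - m) / s ^+ 2) * expR (u x)).
  by have := @is_derive1_comp R expR u x _ _ (is_derive_expR _) du; rewrite mulrC.
have := @is_deriveZ _ _ _ (expR \o u) (normal_peak s) x 1 _ de.
rewrite /GRing.scale/= mulrCA => h.
exact: h.
Qed.

(** Meant for the boundary terms of an integration by parts over growing intervals. The crude bound
    [expR (- u) <= u^-1] already makes them tend to 0. *)
Lemma normal_pdf2_tail (n : nat) (x : R) : (x - m) ^+ 2 = (n.+1)%:R ^+ 2 ->
  normal_pdf m (s *+ 2) x <= normal_peak (s *+ 2) * (8 * s ^+ 2) * harmonic n.
Proof.
move=> xE; have s2 : s *+ 2 != 0 by rewrite mulrn_eq0/= gt_eqF.
rewrite normal_pdfE// -mulrA ler_wpM2l ?normal_peak_ge0//.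
rewrite /normal_fun mulNr xE expRN (_ : (s *+ 2) ^+ 2 *+ 2 = 8 * s ^+ 2); last by ring.
have s8 : 0 < 8 * s ^+ 2 by rewrite mulr_gt0// exprn_gt0.
set u := _ / _.
have u0 : 0 < u by rewrite divr_gt0// exprn_gt0.
have eu : u <= expR u.
  by rewrite (le_trans _ (expR_ge1Dx _))// lerDr.
rewrite (le_trans (y := u^-1))//.
  by rewrite lef_pV2 ?posrE ?expR_gt0.
rewrite /u invf_div ler_wpM2l ?(ltW s8)// /harmonic /= lef_pV2 ?posrE ?exprn_gt0//.
by rewrite expr2 ler_peMl// ler1n.
Qed.

(** Integration by parts: the derivative of [f * pdf] is [f' * pdf] minus
    [s ^- 2 * (x - m) * f * pdf]. Its integral over the intervals of radius [n.+1] around [m] is a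
    difference of boundary values, which vanishes in the limit. *)
Lemma normal_stein (f f' : R -> R) (K : R) :
  (forall x, is_derive x (1 : R) f (f' x)) -> continuous f' ->
  (forall x, `|f x| <= K * (1 + (x - m) ^+ 6)) ->
  (forall x, `|(x - m) * f x| <= K * (1 + (x - m) ^+ 6)) ->
  (forall x, `|f' x| <= K * (1 + (x - m) ^+ 6)) ->
  \int[N]_x ((x - m) * f x) = s ^+ 2 * \int[N]_x f' x.
Proof.
move=> df cf' hf hxf hf'.
have cf : continuous f.
  move=> x; apply: differentiable_continuous; apply/derivable1_diffP.
  by have [] := df x.
have mf : measurable_fun [set: R] f by exact: continuous_measurable_fun.
have mf' : measurable_fun [set: R] f' by exact: continuous_measurable_fun.
have mxf : measurable_fun [set: R] (fun x => (x - m) * f x).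
  by apply: measurable_funM => //; exact: measurable_funB.
rewrite (Rintegral_normal_prob s0 mxf hxf) (Rintegral_normal_prob s0 mf' hf').
have cpdf := @continuous_normal_pdf R m s (lt0r_neq0 s0).
have mpdf := measurable_normal_pdf m s.
pose G x := f x * pdf x.
pose G' x := f' x * pdf x - s ^- 2 * ((x - m) * f x * pdf x).
have dG x : is_derive x (1 : R) G (G' x).
  have h := is_deriveM (df x) (is_derive_normal_pdf x).
  apply: (is_derive_cast h).
  by rewrite /G' /GRing.scale /=; ring.
have cG x : {for x, continuous G}.
  apply: differentiable_continuous; apply/derivable1_diffP.
  by have [] := dG x.
have cG' : continuous G'.
  move=> x; apply: cvgB; first by apply: cvgM; [exact: cf'|exact: cpdf].
  apply: cvgM; first exact: cvg_cst.
  apply: cvgM; last exact: cpdf.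
  apply: cvgM; last exact: cf.
  by apply: cvgB; [exact: cvg_id|exact: cvg_cst].
have i1 := integrable_growth_pdf s0 mf' hf'.
have i2 := integrable_growth_pdf s0 mxf hxf.
have i2' : mu.-integrable setT (fun x => (s ^- 2 * ((x - m) * f x * pdf x))%:E).
  by under eq_fun do rewrite EFinM; exact: integrableZl.
have iG' : mu.-integrable setT (EFin \o G').
  rewrite (_ : EFin \o G' = ((fun x => (f' x * pdf x)%:E) \-
     (fun x => (s ^- 2 * ((x - m) * f x * pdf x))%:E))%E); last first.
    by apply/funext => x /=; rewrite -EFinB.
  exact: integrableB.
suff IG' : \int[mu]_x G' x = 0.
  move: IG'; rewrite /G' RintegralB// RintegralZl// => /eqP.
  rewrite subr_eq0 => /eqP ->; rewrite mulrA divff ?mul1r//.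
  by rewrite expf_neq0// gt_eqF.
pose I n : set R := `[m - n.+1%:R, m + n.+1%:R]%classic.
have FTC n : \int[mu]_x (G' \_ (I n)) x = G (m + n.+1%:R) - G (m - n.+1%:R).
  rewrite -Rintegral_mkcond /Rintegral /I (@continuous_FTC2 _ G' G)//=.
  - by rewrite ltrBlDr -addrA ltrDl addr_gt0.
  - exact: continuous_subspaceT.
  - split; first by move=> x _; have [] := dG x.
    + apply: cvg_at_right_filter; exact: cG.
    + apply: cvg_at_left_filter; exact: cG.
  - by move=> x _; rewrite derive1E; have [_ ->] := dG x.
have cv1 : (\int[mu]_x (G' \_ (I n)) x) @[n --> \oo] --> \int[mu]_x G' x.
  apply: fine_cvg; rewrite fineK; last exact: integrable_fin_num.
  have [] // := @dominated_convergence _ _ _ mu setT measurableT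
    (fun n x => ((G' \_ (I n)) x)%:E) (EFin \o G') (fun x => `|G' x|%:E).
  - move=> n; apply/measurable_EFinP.
    apply/(measurable_restrictT _ _).1; first exact: measurable_itv.
    by apply: measurable_funTS; apply: continuous_measurable_fun.
  - by case/integrableP : iG'.
  - apply: aeW => x _; apply: cvg_near_cst.
    near=> n; rewrite /= patchE mem_set//= /I/= in_itv/=.
    have : `|x - m| <= n.+1%:R.
      rewrite (@le_trans _ _ n%:R)// ?ler_nat//.
      by near: n; exact: nbhs_infty_ger.
    by rewrite ler_norml => /andP[]; rewrite lerNl; lra.
  - exact: integrable_norm iG'.
  - apply: aeW => x n _ /=; rewrite lee_fin patchE.
    by case: ifPn => // _; rewrite normr0.
have cv2 : (G (m + n.+1%:R) - G (m - n.+1%:R)) @[n --> \oo] --> (0 : R).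
  have [C C0 hC] := normal_pdf_dom m s0.
  have K0 : 0 <= K.
    have := le_trans (normr_ge0 _) (hf m).
    by rewrite subrr expr0n/= addr0 mulr1.
  pose c := K * (C * (normal_peak (s *+ 2) * (8 * s ^+ 2))).
  have bG n x : (x - m) ^+ 2 = (n.+1)%:R ^+ 2 -> `|G x| <= c * harmonic n.
    move=> xE; rewrite /G normrM (ger0_norm (normal_pdf_ge0 _ _ _)).
    apply: (@le_trans _ _ (K * ((1 + (x - m) ^+ 6) * pdf x))).
      by rewrite mulrA ler_wpM2r// normal_pdf_ge0.
    rewrite (_ : c * _ = K * (C * (normal_peak (s *+ 2) * (8 * s ^+ 2) * harmonic n)));
      last by rewrite /c; ring.
    rewrite ler_wpM2l//; apply: (le_trans (hC x)).
    by rewrite ler_wpM2l//; exact: normal_pdf2_tail.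
  have hh : (c *+ 2) * harmonic n @[n --> \oo] --> (0 : R).
    rewrite -(mulr0 (c *+ 2)); apply: cvgM; first exact: cvg_cst.
    exact: cvg_harmonic.
  apply: norm_cvg0; apply: (squeeze_cvgr _ (cvg_cst 0) hh).
  near=> n; rewrite normr_ge0/= (le_trans (ler_normB _ _))//.
  rewrite mulrnAl mulr2n lerD// bG//; last by ring.
  by rewrite addrAC subrr add0r.
rewrite (_ : (fun n => \int[mu]_x (G' \_ (I n)) x) =
  (fun n => G (m + n.+1%:R) - G (m - n.+1%:R))) in cv1; last exact/funext.
exact: (cvg_unique _ cv1 cv2).
Unshelve. all: end_near. Qed.

End normal_stein.

Section normal_moments.
Context {R : realType}.
Variables (m s : R).
Hypothesis s0 : 0 < s.
Local Notation N := (normal_prob m s).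

Let xn6 n (x : R) : (n <= 6)%N -> `|(x - m) ^+ n| <= 1 + (x - m) ^+ 6.
Proof.
move=> n6; set y := x - m; rewrite -(@ger0_norm _ (y ^+ 6)) ?exprn_even_ge0//.
have [h|/ltW h] := lerP `|y| 1.
  by rewrite normrX (@le_trans _ _ 1) ?exprn_ile1// lerDl normr_ge0.
rewrite !normrX (@le_trans _ _ (`|y| ^+ 6))//; last by rewrite lerDr.
by rewrite ler_weXn2l.
Qed.

Let x6 (x : R) : `|x - m| <= 1 + (x - m) ^+ 6.
Proof. by have := xn6 x (isT : (1 <= 6)%N); rewrite expr1. Qed.

Lemma integrable_normalX n : (n <= 6)%N ->
  N.-integrable setT (fun x => ((x - m) ^+ n)%:E).
Proof.
move=> n6; apply: (@integrable_growth_normal _ m s s0 _ 1).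
  by apply: measurable_funX; exact: measurable_funB.
by move=> x; rewrite mul1r xn6.
Qed.

(** Stein's identity for the power [n.+1]; with [n <= 4] all the powers that occur stay within the
    sixth-degree growth bound. *)
Lemma normal_moment n : (n <= 4)%N ->
  \int[N]_x ((x - m) ^+ n.+2) = s ^+ 2 * (n.+1)%:R * \int[N]_x ((x - m) ^+ n).
Proof.
move=> n4; pose f (x : R) := (x - m) ^+ n.+1; pose f' (x : R) := n.+1%:R * (x - m) ^+ n.
have n1 : 1 <= n.+1%:R :> R by rewrite ler1n.
have bnd k x : (k <= 6)%N -> `|(x - m) ^+ k| <= n.+1%:R * (1 + (x - m) ^+ 6).
  move=> k6; rewrite (le_trans (xn6 x k6))// ler_peMl//.
  by rewrite addr_ge0// exprn_even_ge0.
have df (x : R) : is_derive x (1 : R) f (f' x).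
  have dl : is_derive x (1 : R) (fun x => x - m) 1.
    by apply: is_derive_eq; rewrite /GRing.scale/=; ring.
  have fE : f = (fun x => x - m) ^+ n.+1 by apply/funext => y; rewrite fctE.
  rewrite fE; apply: (is_derive_cast (is_deriveX n.+1 dl)).
  by rewrite /f' /GRing.scale/= mulr1 mulr_natl.
have cf' : continuous f'.
  move=> x; apply: cvgM; first exact: cvg_cst.
  apply: (@continuous_comp _ _ _ (fun x => x - m) (fun x : R => x ^+ n));
    last exact: exprn_continuous.
  by apply: cvgB; [exact: cvg_id|exact: cvg_cst].
have b1 x : `|f x| <= n.+1%:R * (1 + (x - m) ^+ 6).
  by rewrite bnd// ltnS (leq_trans n4).
have b2 x : `|(x - m) * f x| <= n.+1%:R * (1 + (x - m) ^+ 6).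
  by rewrite -exprS bnd.
have b3 x : `|f' x| <= n.+1%:R * (1 + (x - m) ^+ 6).
  by rewrite normrM ger0_norm// ler_wpM2l// xn6// (leq_trans n4).
transitivity (\int[N]_x ((x - m) * f x)).
  by apply: eq_Rintegral => x _; rewrite /f -exprS.
rewrite (normal_stein s0 df cf' b1 b2 b3).
rewrite /f' RintegralZl//; first by rewrite mulrA.
by apply: integrable_normalX; rewrite (leq_trans n4).
Qed.

Lemma normal_total : \int[N]_x (1 : R) = 1.
Proof. by rewrite Rintegral_cst// mul1r /= probability_setT. Qed.

Lemma normal_mean : \int[N]_x x = m.
Proof.
have g1 (x : R) : 1 <= 1 + (x - m) ^+ 6 by rewrite lerDl exprn_even_ge0.
have i1 : N.-integrable setT (fun x => (x - m)%:E).
  by apply: eq_integrable (@integrable_normalX 1 isT) => // x _; rewrite expr1.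
have : \int[N]_x (x - m) = 0.
  transitivity (\int[N]_x ((x - m) * cst 1 x)).
    by apply: eq_Rintegral => x _; rewrite mulr1.
  rewrite (@normal_stein R m s s0 (cst 1) (cst 0) 1).
  - by rewrite Rintegral_cst// mul0r mulr0.
  - by move=> x; exact: cvg_cst.
  - by move=> x; rewrite mul1r normr1.
  - by move=> x; rewrite mul1r mulr1 x6.
  - by move=> x; rewrite mul1r normr0 (le_trans _ (g1 x)).
have im : N.-integrable setT (EFin \o cst m).
  apply: (@integrable_growth_normal _ m s s0 _ `|m|) => // x.
  by rewrite ler_peMr.
have ix : N.-integrable setT (EFin \o (fun x : R => x)).
  apply: (@integrable_growth_normal _ m s s0 _ (1 + `|m|)) => // x.
  rewrite mulrDl mul1r -[x in leLHS](subrK m) (le_trans (ler_normD _ _))//.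
  by rewrite lerD ?x6// ler_peMr.
rewrite RintegralB// Rintegral_cst// => /eqP; rewrite subr_eq0 => /eqP ->.
by rewrite /= probability_setT mulr1.
Qed.

End normal_moments.

Section normal_cos.
Context {R : realType}.
Variable s : R.
Hypothesis s0 : 0 < s.
Local Notation N := (normal_prob 0 s).

(** As a function of [t], the integral [c] solves [c' = - s^2 t c]: differentiate under the integral
    sign, with dominating function [|x|], and apply Stein's identity to the sine. So
    [c t * expR (s^2 t^2 / 2)] is constant, with value [cos th] at 0. *)
Lemma normal_cos (t0 th : R) :
  \int[N]_x cos (t0 * x + th) = expR (- (s ^+ 2 / 2 * t0 ^+ 2)) * cos th.
Proof.
pose f (t x : R) := cos (t * x + th).
pose c t := \int[N]_x f t x.
have g1 (x : R) : 1 <= 1 + (x - 0) ^+ 6 by rewrite lerDl exprn_even_ge0.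
have g2 (x : R) : `|x| <= 1 + (x - 0) ^+ 6.
  rewrite subr0 -(@ger0_norm _ (x ^+ 6)) ?exprn_even_ge0//.
  have [h|/ltW h] := lerP `|x| 1; first by rewrite (le_trans h)// lerDl normr_ge0.
  rewrite normrX (@le_trans _ _ (`|x| ^+ 6))//; last by rewrite lerDr.
  by rewrite -[leLHS]expr1 ler_weXn2l.
have cl t : continuous (fun x : R => t * x + th).
  move=> x; apply: cvgD; last exact: cvg_cst.
  by apply: cvgM; [exact: cvg_cst|exact: cvg_id].
have ccos t : continuous (f t).
  by move=> x; apply: (continuous_comp (cl t x)); exact: continuous_cos.
have csin (t : R) : continuous (fun x : R => sin (t * x + th)).
  by move=> x; apply: (continuous_comp (cl t x)); exact: continuous_sin.
have mcos t : measurable_fun [set: R] (f t) by exact: continuous_measurable_fun.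
have msin t : measurable_fun [set: R] (fun x => sin (t * x + th)).
  exact: continuous_measurable_fun.
have icos t : N.-integrable setT (EFin \o f t).
  apply: (@integrable_growth_normal _ 0 s s0 _ 1) => // x.
  by rewrite mul1r (le_trans (cos_max _)).
have dcos t x : is_derive t (1 : R) (f ^~ x) (- x * sin (t * x + th)).
  have dl : is_derive t (1 : R) (fun t => t * x + th) x.
    by apply: is_derive_eq; rewrite /GRing.scale/=; ring.
  have := @is_derive_comp_fun R cos (fun t => t * x + th) t _ _ (is_derive_cos _) dl.
  by move=> h; apply: (is_derive_cast h); rewrite mulNr mulrC mulNr.
have stein t : \int[N]_x (x * sin (t * x + th)) = s ^+ 2 * (t * c t).
  have ds (x : R) : is_derive x (1 : R) (fun x => sin (t * x + th)) (t * f t x).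
    have dl : is_derive x (1 : R) (fun x => t * x + th) t.
      by apply: is_derive_eq; rewrite /GRing.scale/=; ring.
    have := @is_derive_comp_fun R sin (fun x => t * x + th) x _ _ (is_derive_sin _) dl.
    by move=> h; apply: (is_derive_cast h); rewrite mulrC.
  transitivity (\int[N]_x ((x - 0) * sin (t * x + th))).
    by apply: eq_Rintegral => x _; rewrite subr0.
  rewrite (@normal_stein R 0 s s0 _ _ (1 + `|t|) ds).
  - by rewrite RintegralZl.
  - by move=> x; apply: cvgM; [exact: cvg_cst|exact: ccos].
  - move=> x; rewrite (le_trans (sin_max _))// (le_trans (g1 x))//.
    by rewrite ler_peMl ?lerDl// (le_trans _ (g1 x)).
  - move=> x; rewrite normrM (@le_trans _ _ `|x|)//.
      by rewrite subr0 ler_piMr// sin_max.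
    rewrite (le_trans (g2 x))//.
    by rewrite ler_peMl ?lerDl// (le_trans _ (g1 x)).
  - move=> x; rewrite normrM ler_pM// ?lerDr//.
    by rewrite (le_trans (cos_max _)).
have dc t : is_derive t (1 : R) c (- (s ^+ 2 * (t * c t))).
  have ta : (`]t - 1, t + 1[%classic : set R) t by rewrite /= in_itv/= ltrDl ltrBlDr ltrDl ltr01.
  have hG x y : `]t - 1, t + 1[%classic x -> setT y ->
      `|partial1of2 f x y| <= `|y|.
    move=> _ _; rewrite partial1of2E; have [_ ->] := dcos x y.
    by rewrite normrM normrN ler_piMr// sin_max.
  have iG : N.-integrable setT (EFin \o (fun y : R => `|y|)).
    apply: (@integrable_growth_normal _ 0 s s0 _ 1) => //.
    by move=> x; rewrite mul1r normr_id.
  have df x y : `]t - 1, t + 1[%classic x -> setT y -> derivable (f ^~ y) x 1.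
    by move=> _ _; have [] := dcos x y.
  have h1 := @derivable_under_integral R _ _ N f setT measurableT t _ _ ta
    (fun x _ => icos x) df _ (fun y => normr_ge0 y) iG hG.
  have h2 := @differentiation_under_integral R _ _ N f setT measurableT t _ _ ta
    (fun x _ => icos x) df _ (fun y => normr_ge0 y) iG hG.
  apply: DeriveDef => //; rewrite -derive1E h2 -stein.
  transitivity (\int[N]_x (-1 * (x * sin (t * x + th)))).
    apply: eq_Rintegral => x _; rewrite partial1of2E; have [_ ->] := dcos t x.
    by rewrite mulN1r mulNr.
  rewrite RintegralZl ?mulN1r//.
  apply: (@integrable_growth_normal _ 0 s s0 _ 1).
    by apply: measurable_funM.
  move=> x; rewrite mul1r normrM (le_trans _ (g2 x))//.
  by rewrite ler_piMr// sin_max.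
pose e (t : R) := expR (s ^+ 2 / 2 * t ^+ 2).
have de t : is_derive t (1 : R) e (s ^+ 2 * t * e t).
  have dl : is_derive t (1 : R) (fun t : R => s ^+ 2 / 2 * t ^+ 2) (s ^+ 2 * t).
    by apply: is_derive_eq; rewrite /GRing.scale/=; field.
  have := @is_derive_comp_fun R expR (fun t => s ^+ 2 / 2 * t ^+ 2) t _ _ (is_derive_expR _) dl.
  by move=> h; apply: (is_derive_cast h); rewrite mulrC.
have dce t : is_derive t (1 : R) (c * e) 0.
  have h := is_deriveM (dc t) (de t).
  by apply: (is_derive_cast h); rewrite /GRing.scale/=; ring.
have := @is_derive_0_is_cst R (c * e) t0 0 dce.
have c0 : c 0 = cos th.
  rewrite /c /f; under eq_Rintegral do rewrite mul0r add0r.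
  by rewrite Rintegral_cst//= probability_setT/= mulr1.
rewrite !fctE c0 /e expr0n/= mulr0 expR0 mulr1 => h.
by rewrite -/(c t0) -h expRN mulrCA mulVf ?mulr1// gt_eqF// expR_gt0.
Qed.

End normal_cos.

(** * Sigma-algebras from bounded pointwise limits *)

Section bounded_closure.
Context {T : Type} {R : realType}.
Implicit Types (f g : T -> R) (S : set (T -> R)).

(** A functional form of the monotone class theorem. The inductive presentation lets an identity
    between integrals be proved on generators and carried through [bcl_lim] by dominated
    convergence. *)
Inductive bcl S : (T -> R) -> Prop :=
| bcl_base f : S f -> bcl S f
| bcl_lim (f_ : nat -> T -> R) f (M : R) :
    (forall n, bcl S (f_ n)) -> (forall n x, `|f_ n x| <= M) ->
    (forall x, f_ n x @[n --> \oo] --> f x) -> bcl S f.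

Definition bounded_algebra S :=
  [/\ S (cst 1), (forall f g, S f -> S g -> S (fun x => f x * g x)),
      (forall a f g, S f -> S g -> S (fun x => a * f x + g x)) &
      forall f, S f -> exists M, forall x, `|f x| <= M].

Variable S : set (T -> R).
Hypothesis aS : bounded_algebra S.

Lemma bcl_bounded f : bcl S f -> exists M, forall x, `|f x| <= M.
Proof.
case: aS => _ _ _ bS; case=> [{}f|h {}f M _ hM hf]; first exact: bS.
exists M => x.
have hn : `|h n x| @[n --> \oo] --> `|f x| by apply: cvg_norm; exact: hf.
rewrite -(cvg_lim _ hn)//; apply: limr_le; first by apply/cvg_ex; eexists; exact: hn.
by apply: nearW => n; exact: hM.
Qed.

(** Limits are taken in one factor at a time: in [g] while [f] belongs to [S], then in [f] while [g]
    is merely bounded. *)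
Lemma bclM f g : bcl S f -> bcl S g -> bcl S (fun x => f x * g x).
Proof.
case: aS => _ SM _ bS bf bg; elim: bf => {f} [f Sf|f_ f M _ IH hM hf].
  elim: bg => {g} [g Sg|g_ g M bg_ IH hM hg]; first exact/bcl_base/SM.
  have [B hB] := bS _ Sf.
  apply: (@bcl_lim _ (fun n x => f x * g_ n x) _ (B * M)) => //.
    by move=> n x; rewrite normrM ler_pM.
  by move=> x; apply: cvgM; [exact: cvg_cst|exact: hg].
have [B hB] := bcl_bounded bg.
apply: (@bcl_lim _ (fun n x => f_ n x * g x) _ (M * B)) => //.
  by move=> n x; rewrite normrM ler_pM.
by move=> x; apply: cvgM; [exact: hf|exact: cvg_cst].
Qed.

Lemma bcl_lin a f g : bcl S f -> bcl S g -> bcl S (fun x => a * f x + g x).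
Proof.
case: aS => _ _ SL bS bf bg; elim: bf => {f} [f Sf|f_ f M _ IH hM hf].
  elim: bg => {g} [g Sg|g_ g M bg_ IH hM hg]; first exact/bcl_base/SL.
  have [B hB] := bS _ Sf.
  apply: (@bcl_lim _ (fun n x => a * f x + g_ n x) _ (`|a| * B + M)) => //.
    by move=> n x; rewrite (le_trans (ler_normD _ _))// normrM lerD// ler_wpM2l.
  by move=> x; apply: cvgD; [exact: cvg_cst|exact: hg].
have [B hB] := bcl_bounded bg.
apply: (@bcl_lim _ (fun n x => a * f_ n x + g x) _ (`|a| * M + B)) => //.
  by move=> n x; rewrite (le_trans (ler_normD _ _))// normrM lerD// ler_wpM2l.
move=> x; apply: cvgD; last exact: cvg_cst.
by apply: cvgM; [exact: cvg_cst|exact: hf].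
Qed.

Lemma bcl_cst a : bcl S (fun=> a).
Proof.
have [S1 _ SL _] := aS.
have -> : (fun=> a) = (fun x : T => (a - 1) * cst 1 x + cst 1 x).
  by apply/funext => x /=; ring.
exact/bcl_base/SL.
Qed.

Lemma bclZ a f : bcl S f -> bcl S (fun x => a * f x).
Proof.
move=> bf; have := bcl_lin a bf (bcl_cst 0).
by under eq_fun do rewrite addr0.
Qed.

Lemma bclD f g : bcl S f -> bcl S g -> bcl S (fun x => f x + g x).
Proof.
move=> bf bg; have := bcl_lin 1 bf bg.
by under eq_fun do rewrite mul1r.
Qed.

Lemma bclX f n : bcl S f -> bcl S (fun x => f x ^+ n).
Proof.
move=> bf; elim: n => [|n IH]; first exact: bcl_cst.
by under eq_fun do rewrite exprS; exact: bclM.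
Qed.

(** The polynomial iteration [q + (x - q^2) / 2] from the classical proof of the Stone-Weierstrass
    theorem, increasing to the square root on the unit interval. *)
Fixpoint sqrt_approx n (x : R) : R :=
  if n is m.+1 then sqrt_approx m x + (x - sqrt_approx m x ^+ 2) / 2 else 0.

(** With [r] the root, one step multiplies the error [r - q] by [1 - (r + q) / 2], which lies
    between 0 and [1 - r / 2]. *)
Lemma sqrt_approx_bound n (x : R) : 0 <= x <= 1 ->
  0 <= Num.sqrt x - sqrt_approx n x <= Num.sqrt x * (1 - Num.sqrt x / 2) ^+ n
  /\ 0 <= sqrt_approx n x.
Proof.
move=> /andP[x0 x1]; set r := Num.sqrt x.
have xE : x = r ^+ 2 by rewrite sqr_sqrtr.
have r0 : 0 <= r by exact: sqrtr_ge0.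
have r1 : r <= 1 by rewrite -(@expr_le1 _ 2)// -xE.
have step (q B : R) : 0 <= q -> 0 <= r - q <= r * B -> 0 <= B ->
    0 <= r - (q + (x - q ^+ 2) / 2) <= r * ((1 - r / 2) * B) /\
    0 <= q + (x - q ^+ 2) / 2.
  move=> q0 /andP[q1 q2] B0; rewrite xE.
  move: r0 r1 q0 q1 q2 B0; clear; move: r => r r0 r1 q0 q1 q2 B0.
  have -> : r - (q + (r ^+ 2 - q ^+ 2) / 2) = (r - q) * (1 - (r + q) / 2) by field.
  have h : 0 <= (r - q) * (r + q) by rewrite mulr_ge0//; lra.
  split; last by rewrite subr_sqr; lra.
  rewrite mulr_ge0/=; [|lra..].
  rewrite mulrCA [leRHS]mulrC ler_pM//; lra.
elim: n => [|n [q1 q2]] /=; first by rewrite subr0 expr0 mulr1 r0 lexx.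
by rewrite [(1 - r / 2) ^+ _]exprS; apply: step => //; rewrite exprn_ge0//; lra.
Qed.

Lemma bcl_sqrt f : bcl S f -> (forall x, 0 <= f x <= 1) ->
  bcl S (fun x => Num.sqrt (f x)).
Proof.
move=> bf f01.
apply: (@bcl_lim _ (fun n x => sqrt_approx n (f x)) _ 1).
- elim=> [|n IH] /=; first exact: bcl_cst.
  apply: bclD => //.
  have -> : (fun x => (f x - sqrt_approx n (f x) ^+ 2) / 2) =
    (fun x => 2^-1 * (-1 * sqrt_approx n (f x) ^+ 2 + f x)).
    by apply/funext => x; ring.
  by apply: bclZ; apply: bcl_lin => //; exact: bclX.
- move=> n x; have [/andP[h1 h2] h3] := sqrt_approx_bound n (f01 x).
  rewrite ger0_norm//; apply: (@le_trans _ _ (Num.sqrt (f x))).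
    by rewrite -subr_ge0.
  by rewrite -[leRHS]sqrtr1 ler_wsqrtr//; case/andP : (f01 x).
- move=> x; set r := Num.sqrt (f x).
  have [r0|r0] := eqVneq r 0.
    apply: cvg_near_cst; apply: nearW => n.
    have [/andP[h1 h2] h3] := sqrt_approx_bound n (f01 x).
    by move: h1; rewrite -/r r0 sub0r oppr_ge0 => h1; apply/eqP; rewrite eq_le h1.
  have rp : 0 < r by rewrite lt_neqAle eq_sym r0 sqrtr_ge0.
  have r1 : r <= 1.
    by rewrite /r -[leRHS]sqrtr1 ler_wsqrtr//; case/andP : (f01 x).
  apply/subr_cvg0 => /=; apply: norm_cvg0.
  have hg : r * (1 - r / 2) ^+ n @[n --> \oo] --> (0 : R).
    rewrite -(mulr0 r); apply: cvgM; first exact: cvg_cst.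
    by apply: cvg_expr; rewrite ger0_norm; lra.
  apply: (squeeze_cvgr _ (cvg_cst 0) hg); apply: nearW => n.
  have [/andP[h1 h2] h3] := sqrt_approx_bound n (f01 x).
  by rewrite normr_ge0/= distrC ger0_norm.
Qed.

Definition bset : set (set T) := [set E | bcl S \1_E].

Lemma bset0 : bset set0.
Proof. by rewrite /bset/= indic0; exact: bcl_cst. Qed.

Lemma bsetC E : bset E -> bset (~` E).
Proof.
move=> bE; rewrite /bset/=.
have -> : \1_(~` E) = (fun x => -1 * \1_E x + 1) :> (T -> R).
  apply/funext => x; rewrite !indicE in_setC; case: (x \in E) => /=; ring.
by apply: bcl_lin => //; exact: bcl_cst.
Qed.

Lemma bsetI E F : bset E -> bset F -> bset (E `&` F).
Proof. by move=> bE bF; rewrite /bset/= indicI; exact: bclM. Qed.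

Lemma bsetU E F : bset E -> bset F -> bset (E `|` F).
Proof.
move=> bE bF; rewrite -(setCK (E `|` F)) setCU.
by apply: bsetC; apply: bsetI; exact: bsetC.
Qed.

Lemma bset_lim (E_ : nat -> set T) (E : set T) : (forall n, bset (E_ n)) ->
  (forall x, \forall n \near \oo, E_ n x <-> E x) -> bset E.
Proof.
move=> bE hE; apply: (@bcl_lim _ (fun n => \1_(E_ n)) _ 1) => //.
  by move=> n x; rewrite indicE; case: (_ \in _); rewrite ?normr1 ?normr0.
move=> x; apply: cvg_near_cst; near=> n; rewrite !indicE.
have h : E_ n x <-> E x by near: n; exact: hE.
suff -> : (x \in E_ n) = (x \in E) by [].
by apply/idP/idP; rewrite !inE; apply h.
Unshelve. all: end_near. Qed.

Lemma bset_sigma_algebra : sigma_algebra setT bset.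
Proof.
split.
- exact: bset0.
- by move=> A bA; rewrite setTD; exact: bsetC.
- move=> A bA; apply: (@bset_lim (fun n => \big[setU/set0]_(i < n) A i)).
    by elim=> [|n IH]; [rewrite big_ord0; exact: bset0|
      rewrite big_ord_recr/=; exact: bsetU].
  move=> x; have [[i _ Aix]|nA] := pselect ((\bigcup_k A k) x); last first.
    apply: nearW => n; split => //; rewrite -bigcup_mkord => -[i _ Aix].
    by exists i.
  near=> n; split=> _; first by exists i.
  rewrite -bigcup_mkord; exists i => //=.
  by near: n; exact: nbhs_infty_gt.
Unshelve. all: end_near. Qed.

(** The positive part [h] of [f] is obtained from [|f| = sqrt (f^2)], and [1 - (1 - h) ^+ n.+1]
    tends to 1 where [h > 0] while it is 0 where [h = 0]. *)
Lemma bset_pos f : bcl S f -> (forall x, `|f x| <= 1) -> bset [set x | 0 < f x].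
Proof.
move=> bf f1; pose h x := 2^-1 * (f x + Num.sqrt (f x ^+ 2)).
have h01 x : 0 <= h x <= 1.
  rewrite /h sqrtr_sqr; have := f1 x; have := ler_norm (f x); have := ler_norm (- f x).
  by rewrite normrN => *; apply/andP; split; lra.
have hpos x : (0 < h x) = (0 < f x).
  rewrite /h sqrtr_sqr; have [f0|f0] := lerP (f x) 0.
    by rewrite ler0_norm// subrr mulr0 ltxx.
  by rewrite gtr0_norm//; lra.
have bh : bcl S h.
  apply: bclZ; apply: bclD => //; apply: bcl_sqrt; first exact: bclX.
  by move=> x; rewrite sqr_ge0/= -real_normK ?num_real// exprn_ile1.
apply: (@bcl_lim _ (fun n x => -1 * (-1 * h x + 1) ^+ n.+1 + 1) _ 1).
- move=> n; apply: bcl_lin; last exact: bcl_cst.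
  by apply: bclX; apply: bcl_lin => //; exact: bcl_cst.
- move=> n x; have /andP[h0 h1] := h01 x.
  set u := -1 * h x + 1.
  have u0 : 0 <= u by rewrite /u; lra.
  have u1 : u <= 1 by rewrite /u; lra.
  have := exprn_ge0 n.+1 u0; have := exprn_ile1 n.+1 u0 u1 => *.
  by rewrite ger0_norm; lra.
- move=> x; rewrite indicE; have [f0|f0] := ltrP 0 (f x).
    rewrite mem_set//= (_ : true%:R = -1 * 0 + 1 :> R); last by rewrite mulr0 add0r.
    apply: cvgD; last exact: cvg_cst.
    apply: cvgM; first exact: cvg_cst.
    under eq_fun do rewrite exprS.
    have /andP[h0 h1] := h01 x; move: f0; rewrite -hpos => hp.
    rewrite -(mulr0 (-1 * h x + 1)); apply: cvgM; first exact: cvg_cst.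
    by apply: cvg_expr; rewrite ger0_norm; lra.
  rewrite memNset/=; last by rewrite ltNge f0.
  apply: cvg_near_cst; apply: nearW => n.
  have -> : h x = 0.
    by rewrite /h sqrtr_sqr ler0_norm// subrr mulr0.
  by rewrite mulr0 add0r expr1n mulr1 addNr.
Qed.

(* For fixed real [y], [sin (y / n)] has the sign of [y] once [n] is large. *)
Lemma bset_gt (X : T -> R) (c : R) :
  (forall n : nat, bcl S (fun x => sin ((X x - c) / n.+1%:R))) ->
  bset [set x | c < X x].
Proof.
move=> bX; apply: (@bset_lim (fun n => [set x | 0 < sin ((X x - c) / n.+1%:R)])).
  by move=> n; apply: bset_pos => // x; exact: sin_max.
move=> x; near=> n => /=; rewrite -[c < X x]subr_gt0; set y := X x - c.
have yn : `|y| < n.+1%:R.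
  rewrite (@le_lt_trans _ _ n%:R) ?ltr_nat//; near: n; exact: nbhs_infty_ger.
have n0 : 0 < n.+1%:R :> R by [].
have pi1 : 1 < pi :> R by rewrite (lt_le_trans _ (pi_ge2 R))// ltr1n.
have yn1 : `|y / n.+1%:R| < 1.
  by rewrite normrM normfV (ger0_norm (ltW n0)) ltr_pdivrMr// mul1r.
have [y0|y0] := ltrP 0 y; split => //.
- move=> _; apply: sin_gt0_pi; rewrite divr_gt0//=.
  by rewrite (lt_trans _ pi1)// (le_lt_trans (ler_norm _) yn1).
- have : 0 <= sin (- (y / n.+1%:R)).
    apply: sin_ge0_pi; rewrite oppr_ge0 pmulr_lle0 ?invr_gt0// y0/=.
    by rewrite (le_trans _ (ltW pi1))// (le_trans (ler_norm _))// normrN ltW.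
  by rewrite sinN oppr_ge0 leNgt => /negP.
Unshelve. all: end_near. Qed.

End bounded_closure.

(** * Square-integrable random variables *)

Section L2.
Context {R : realType} {d : measure_display} {T : measurableType d}.
Variable P : probability T R.
Implicit Types (X Y Z : T -> R).

Lemma ge0_fatou_le (f_ : nat -> T -> R) (f : T -> R) (e : R) :
  (forall n, measurable_fun [set: T] (f_ n)) -> measurable_fun [set: T] f ->
  (forall n w, 0 <= f_ n w) -> (forall w, 0 <= f w) ->
  {ae P, forall w, f_ n w @[n --> \oo] --> f w} ->
  (forall n, \int[P]_w (f_ n w)%:E <= e%:E)%E ->
  (\int[P]_w (f w)%:E <= e%:E)%E.
Proof.
move=> mf_ mf f_0 f0 fcv fe.
have mE n : measurable_fun [set: T] (fun w => (f_ n w)%:E) by exact/measurable_EFinP.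
have := @fatou _ _ _ P setT measurableT (fun n w => (f_ n w)%:E) mE.
move=> /(_ _)/Wrap[n w _|hf]; first by rewrite lee_fin.
apply: (@le_trans _ _ (\int[P]_w (limn_einf (fun n => (f_ n w)%:E)))%E).
  rewrite le_eqVlt; apply/orP; left; apply/eqP; apply: ae_eq_integral => //.
  - exact/measurable_EFinP.
  - apply: measurableT_comp => //; apply: measurable_fun_limn_esup => n.
    exact: measurableT_comp.
  - apply: filterS fcv => w hw _.
    have hw' : (f_ n w)%:E @[n --> \oo] --> (f w)%:E by apply: cvg_EFin => //; exact: nearW.
    by rewrite is_cvg_limn_einfE; [rewrite (cvg_lim _ hw')|apply/cvg_ex; eexists; exact: hw'].
apply: (le_trans hf); rewrite limn_einf_lim; apply: lime_le; first exact: is_cvg_einfs.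
apply: nearW => n; apply: le_trans (fe n).
by apply: ereal_inf_lbound; exists n => /=.
Qed.

Definition L2 X := measurable_fun [set: T] X /\
  P.-integrable setT (fun w => (X w ^+ 2)%:E).

Definition ip X Y := \int[P]_w (X w * Y w).

Definition sub X Y : T -> R := fun w => X w - Y w.

Definition dist2 X Y := ip (sub X Y) (sub X Y).

Lemma L2P X : measurable_fun [set: T] X ->
  (\int[P]_w (X w ^+ 2)%:E < +oo)%E -> L2 X.
Proof.
move=> mX iX; split => //; apply/integrableP; split.
  by apply/measurable_EFinP/measurable_funX.
by under eq_integral do rewrite /= ger0_norm ?sqr_ge0//.
Qed.

Lemma integrable_le X Y : measurable_fun [set: T] X ->
  P.-integrable setT (EFin \o Y) -> (forall w, `|X w| <= Y w) ->
  P.-integrable setT (EFin \o X).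
Proof.
move=> mX iY XY; apply: le_integrable iY => //; first exact/measurable_EFinP.
by move=> w _ /=; rewrite lee_fin (le_trans (XY w))// ler_norm.
Qed.

Lemma integrable_cst (a : R) : P.-integrable setT (EFin \o cst a).
Proof. exact: finite_measure_integrable_cst. Qed.

Lemma integrableDR X Y : P.-integrable setT (EFin \o X) ->
  P.-integrable setT (EFin \o Y) -> P.-integrable setT (EFin \o (fun w => X w + Y w)).
Proof.
move=> iX iY.
apply: (eq_integrable _ ((EFin \o X) \+ (EFin \o Y))%E) => //.
exact: integrableD.
Qed.

Lemma integrableZR (a : R) X : P.-integrable setT (EFin \o X) ->
  P.-integrable setT (EFin \o (fun w => a * X w)).
Proof.
by move=> iX; apply: (eq_integrable _ (fun w => a%:E * (EFin \o X) w)%E) => //; exact: integrableZl.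
Qed.

Lemma bounded_integrable X (M : R) : measurable_fun [set: T] X ->
  (forall w, `|X w| <= M) -> P.-integrable setT (EFin \o X).
Proof. by move=> mX XM; apply: (integrable_le mX (integrable_cst M)). Qed.

Lemma bounded_cvg_Rintegral (f_ : nat -> T -> R) (f : T -> R) (M : R) :
  (forall n, measurable_fun [set: T] (f_ n)) -> measurable_fun [set: T] f ->
  (forall n w, `|f_ n w| <= M) ->
  {ae P, forall w, f_ n w @[n --> \oo] --> f w} ->
  \int[P]_w f_ n w @[n --> \oo] --> \int[P]_w f w.
Proof.
move=> mf_ mf fM fcv.
have mE n : measurable_fun [set: T] (fun w => (f_ n w)%:E) by exact/measurable_EFinP.
have [] // := @dominated_convergence _ _ _ P setT measurableT
  (fun n w => (f_ n w)%:E) (EFin \o f) (EFin \o cst M) mE.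
- exact/measurable_EFinP.
- by apply: filterS fcv => w hw _; apply: cvg_EFin => //; exact: nearW.
- exact: integrable_cst.
- by apply: aeW => w n _ /=; rewrite lee_fin.
move=> h _ ?; apply: fine_cvg; rewrite fineK//; exact: integrable_fin_num.
Qed.

Lemma L2_ip X Y : L2 X -> L2 Y -> P.-integrable setT (EFin \o (fun w => X w * Y w)).
Proof.
move=> [mX iX] [mY iY]; apply: (integrable_le _ (integrableDR iX iY)).
  exact: measurable_funM.
move=> w; rewrite ler_norml; apply/andP; split; nra.
Qed.

Lemma L2_cst a : L2 (cst a).
Proof. by split => //; exact: (integrable_cst (a ^+ 2)). Qed.

Lemma L2_int X : L2 X -> P.-integrable setT (EFin \o X).
Proof.
move=> lX; have := L2_ip lX (L2_cst 1).
by apply: eq_integrable => // w _ /=; rewrite mulr1.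
Qed.

Lemma L2_lin a X Y : L2 X -> L2 Y -> L2 (fun w => a * X w + Y w).
Proof.
move=> lX lY; split.
  by apply: measurable_funD; [apply: measurable_funM => //; case: lX|case: lY].
have i1 := integrableZR (a ^+ 2) (L2_ip lX lX).
have i2 := integrableZR (2 * a) (L2_ip lX lY).
apply: (eq_integrable _ _ _ _ (integrableDR (integrableDR i1 i2) (L2_ip lY lY))) => //.
by move=> w _ /=; congr EFin; ring.
Qed.

Lemma L2_sub X Y : L2 X -> L2 Y -> L2 (sub X Y).
Proof.
move=> lX lY; have := L2_lin (-1) lY lX.
by rewrite (_ : (fun w => _) = sub X Y)//; apply/funext => w; rewrite /sub; ring.
Qed.

Lemma L2_sum n (c : 'I_n -> R) (X : 'I_n -> T -> R) : (forall i, L2 (X i)) ->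
  L2 (fun w => \sum_(i < n) c i * X i w).
Proof.
elim: n c X => [|n IH] c X lX.
  by under eq_fun do rewrite big_ord0; exact: L2_cst.
by under eq_fun do rewrite big_ord_recl; apply: L2_lin => //; exact: IH.
Qed.

Lemma ipC X Y : ip X Y = ip Y X.
Proof. by apply: eq_Rintegral => w _; rewrite mulrC. Qed.

Lemma ip_lin a X Y Z : L2 X -> L2 Y -> L2 Z ->
  ip (fun w => a * X w + Y w) Z = a * ip X Z + ip Y Z.
Proof.
move=> lX lY lZ; rewrite /ip.
under eq_Rintegral do rewrite mulrDl -mulrA.
rewrite RintegralD//; last 2 first.
- by apply: integrableZR; exact: L2_ip.
- exact: L2_ip.
by rewrite RintegralZl//; exact: L2_ip.
Qed.

Lemma ip_subl X Y Z : L2 X -> L2 Y -> L2 Z -> ip (sub X Y) Z = ip X Z - ip Y Z.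
Proof.
move=> lX lY lZ; rewrite -[RHS]addrC -mulN1r -ip_lin//.
by apply: eq_Rintegral => w _; rewrite /sub; ring.
Qed.

Lemma ip_subr X Y Z : L2 X -> L2 Y -> L2 Z -> ip Z (sub X Y) = ip Z X - ip Z Y.
Proof. by move=> lX lY lZ; rewrite ipC ip_subl// ipC (ipC Y). Qed.

Lemma ip0l X : ip (cst 0) X = 0.
Proof.
rewrite /ip; under eq_Rintegral do rewrite /= mul0r.
by rewrite Rintegral_cst// mul0r.
Qed.

Lemma ip_suml n (c : 'I_n -> R) (X : 'I_n -> T -> R) Y : (forall i, L2 (X i)) ->
  L2 Y -> ip (fun w => \sum_(i < n) c i * X i w) Y = \sum_(i < n) c i * ip (X i) Y.
Proof.
move=> + lY; elim: n c X => [|n IH] c X lX.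
  by under eq_fun do rewrite big_ord0; rewrite big_ord0 ip0l.
under eq_fun do rewrite big_ord_recl.
by rewrite ip_lin ?IH ?big_ord_recl//; apply: L2_sum.
Qed.

Lemma ip_sumr n (c : 'I_n -> R) (X : 'I_n -> T -> R) Y : (forall i, L2 (X i)) ->
  L2 Y -> ip Y (fun w => \sum_(i < n) c i * X i w) = \sum_(i < n) c i * ip Y (X i).
Proof. by move=> lX lY; rewrite ipC ip_suml//; apply: eq_bigr => i _; rewrite ipC. Qed.

Lemma ipZl a X Y : L2 X -> L2 Y -> ip (fun w => a * X w) Y = a * ip X Y.
Proof.
move=> lX lY; rewrite /ip; under eq_Rintegral do rewrite -mulrA.
by rewrite RintegralZl//; exact: L2_ip.
Qed.

Lemma ipZr a X Y : L2 X -> L2 Y -> ip X (fun w => a * Y w) = a * ip X Y.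
Proof. by move=> lX lY; rewrite ipC ipZl// ipC. Qed.

Lemma ip_ge0 X : 0 <= ip X X.
Proof. by apply: Rintegral_ge0 => w _; rewrite -expr2 sqr_ge0. Qed.

Lemma ip_linear_sq a X Y : L2 X -> L2 Y ->
  ip (fun w => a * X w + Y w) (fun w => a * X w + Y w) =
  a ^+ 2 * ip X X + 2 * a * ip X Y + ip Y Y.
Proof.
move=> lX lY; have lXY := L2_lin a lX lY.
rewrite ip_lin// (ipC X) (ipC Y) !ip_lin// (ipC Y X); ring.
Qed.

Lemma ip_cauchy_schwarz X Y : L2 X -> L2 Y -> ip X Y ^+ 2 <= ip X X * ip Y Y.
Proof.
move=> lX lY; have key a := ip_linear_sq a lX lY.
have pos a : 0 <= a ^+ 2 * ip X X + 2 * a * ip X Y + ip Y Y by rewrite -key ip_ge0.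
have := ip_ge0 X; rewrite le_eqVlt => /predU1P[/esym x0|x0].
  rewrite x0 mul0r; have [->|xy] := eqVneq (ip X Y) 0; first by rewrite expr0n.
  (* When [ip X X = 0] the quadratic polynomial in [a] is affine; this value of [a] makes it equal
     to -1. *)
  have := pos (- (ip Y Y + 1) / (2 * ip X Y)); rewrite x0 mulr0 add0r.
  rewrite (_ : 2 * _ * _ = - (ip Y Y + 1)); last by field.
  by move=> h; exfalso; have := ip_ge0 Y; lra.
have := pos (- ip X Y / ip X X).
rewrite (_ : _ + _ = ip Y Y - ip X Y ^+ 2 / ip X X); last by field; rewrite gt_eqF.
by rewrite subr_ge0 ler_pdivrMr// mulrC.
Qed.

Lemma ip_norm0 X Y : L2 X -> L2 Y -> ip X X = 0 -> ip X Y = 0.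
Proof.
move=> lX lY x0; have := ip_cauchy_schwarz lX lY; rewrite x0 mul0r => h.
by apply/eqP; rewrite -sqrf_eq0 eq_le h sqr_ge0.
Qed.

Lemma ip_norm0_ae X : L2 X -> ip X X = 0 -> {ae P, forall w, X w = 0}.
Proof.
move=> lX; rewrite /ip /Rintegral => x0.
have iX := L2_ip lX lX.
have {}x0 : (\int[P]_w (X w * X w)%:E = 0)%E.
  by rewrite -[LHS]fineK ?x0//; exact: integrable_fin_num.
have /ae_eq_integral_abs : (\int[P]_w `|(X w * X w)%:E| = 0)%E.
  by under eq_integral do rewrite /= ger0_norm -?expr2 ?sqr_ge0// expr2.
move=> /(_ measurableT); rewrite /ae_eq.
case/integrableP : iX => mX _ /(_ mX); apply: filterS => w /(_ Logic.I) [] /eqP.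
by rewrite mulf_eq0 orbb => /eqP.
Qed.

(** Fatou's lemma applied to [(X_ n - X_ m) ^+ 2] as [m] grows identifies the mean-square limit of a
    Cauchy sequence with an almost sure limit that is already at hand. *)
Lemma L2_fatou (X_ : nat -> T -> R) X : (forall n, L2 (X_ n)) ->
  measurable_fun [set: T] X ->
  {ae P, forall w, X_ n w @[n --> \oo] --> X w} ->
  (forall e, 0 < e -> exists N, forall m n, (N <= m)%N -> (N <= n)%N ->
     dist2 (X_ m) (X_ n) <= e) ->
  L2 X /\ dist2 (X_ n) X @[n --> \oo] --> (0 : R).
Proof.
move=> lX mX cX hX.
have key e N : (forall m n, (N <= m)%N -> (N <= n)%N -> dist2 (X_ m) (X_ n) <= e) ->
    forall n, (N <= n)%N -> (\int[P]_w ((X_ n w - X w) ^+ 2)%:E <= e%:E)%E.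
  move=> hN n Nn.
  apply: (@ge0_fatou_le (fun m w => (X_ n w - X_ (m + N)%N w) ^+ 2)).
  - move=> m; apply: measurable_funX; apply: measurable_funB;
    [by case: (lX n)|by case: (lX (m + N)%N)].
  - by apply: measurable_funX; apply: measurable_funB => //; case: (lX n).
  - by move=> *; exact: sqr_ge0.
  - by move=> *; exact: sqr_ge0.
  - apply: filterS cX => w hw.
    have h : X_ n w - X_ (m + N)%N w @[m --> \oo] --> X_ n w - X w.
      by apply: cvgB; [exact: cvg_cst|rewrite (cvg_shiftn N (X_ ^~ w))].
    by rewrite expr2; under eq_fun do rewrite expr2; exact: cvgM.
  - move=> m; have lXX := L2_sub (lX n) (lX (m + N)%N).
    have := hN n (m + N)%N Nn (leq_addl _ _); rewrite -lee_fin /dist2 /ip /Rintegral.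
    by rewrite fineK//; exact: integrable_fin_num (L2_ip lXX lXX).
have lX' : L2 X.
  have [N hN] := hX 1 ltr01.
  have : L2 (sub (X_ N) X).
    apply: L2P; first by apply: measurable_funB => //; case: (lX N).
    by apply: (le_lt_trans (key _ _ hN N (leqnn N))); rewrite ltry.
  move=> /(L2_sub (lX N)); rewrite (_ : sub _ _ = X)//.
  by apply/funext => w; rewrite /sub; ring.
split => //; apply/cvgr0Pnorm_le => e e0; have [N hN] := hX e e0.
near=> n; rewrite ger0_norm ?ip_ge0//.
have Nn : (N <= n)%N by near: n; exact: nbhs_infty_ge.
have lXX := L2_sub (lX n) lX'.
rewrite -lee_fin /dist2 /ip /Rintegral fineK; first exact: key hN n Nn.
exact: integrable_fin_num (L2_ip lXX lXX).
Unshelve. all: end_near. Qed.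

Lemma ip_cvg (X_ : nat -> T -> R) X Y : (forall n, L2 (X_ n)) -> L2 X -> L2 Y ->
  dist2 (X_ n) X @[n --> \oo] --> (0 : R) -> ip (X_ n) Y @[n --> \oo] --> ip X Y.
Proof.
move=> lX_ lX lY dX; apply/subr_cvg0.
have h : dist2 (X_ n) X * ip Y Y @[n --> \oo] --> (0 : R).
  by rewrite -(mul0r (ip Y Y)); apply: cvgM => //; exact: cvg_cst.
apply/cvgr0Pnorm_le => e e0.
move/cvgr0Pnorm_le : h => /(_ (e ^+ 2)); rewrite exprn_gt0// => /(_ isT).
apply: filterS => n; rewrite ger0_norm; last by rewrite mulr_ge0// ip_ge0.
move=> hn; rewrite -ip_subl// -(@ler_pXn2r _ 2)// ?nnegrE ?(ltW e0)//.
rewrite real_normK ?num_real// (le_trans _ hn)//.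
by apply: ip_cauchy_schwarz => //; exact: L2_sub.
Qed.

End L2.

Lemma measurable_cos {R : realType} : measurable_fun [set: R] (@cos R).
Proof. by apply: continuous_measurable_fun => x; exact: continuous_cos. Qed.

(** * Trigonometric polynomials in a linear space of random variables *)

Section trigonometric_algebra.
Context {T : Type} {R : realType}.
Implicit Types (L : set (T -> R)) (X Y f g : T -> R).

Definition linear_set L :=
  L (cst 0) /\ forall a X Y, L X -> L Y -> L (fun w => a * X w + Y w).

Lemma linear_setZ L a X : linear_set L -> L X -> L (fun w => a * X w).
Proof.
move=> [L0 lL] LX; have := lL a X (cst 0) LX L0.
by under eq_fun do rewrite addr0.
Qed.

Lemma linear_set_sum L n (c : 'I_n -> R) (X : 'I_n -> T -> R) : linear_set L ->
  (forall i, L (X i)) -> L (fun w => \sum_(i < n) c i * X i w).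
Proof.
move=> [L0 lL]; elim: n c X => [|n IH] c X LX.
  by under eq_fun do rewrite big_ord0.
by under eq_fun do rewrite big_ord_recl; apply: lL => //; exact: IH.
Qed.

(** The free phase [th] makes sines available as well and is what the product formula for two
    cosines requires. *)
Inductive trig L : (T -> R) -> Prop :=
| trig_cos X (th : R) : L X -> trig L (fun w => cos (X w + th))
| trig_lin a f g : trig L f -> trig L g -> trig L (fun w => a * f w + g w).

Variable L : set (T -> R).
Hypothesis lL : linear_set L.

Lemma trigZ a f : trig L f -> trig L (fun w => a * f w).
Proof.
move=> tf; have := trig_lin (a - 1) tf tf.
by under eq_fun do rewrite mulrBl mul1r subrK.
Qed.

Lemma trig_algebra : bounded_algebra (trig L).
Proof.
have [L0 lL'] := lL; split.
- have := @trig_cos L (cst 0) 0 L0.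
  by under eq_fun do rewrite /= addr0 cos0.
- move=> f g tf tg; elim: tf => {f} [X th LX|a f1 f2 t1 IH1 t2 IH2]; last first.
    rewrite (_ : (fun w => _) = (fun w => a * (f1 w * g w) + f2 w * g w)).
      exact: trig_lin.
    by apply/funext => w; ring.
  elim: tg => {g} [Y th' LY|a g1 g2 t1 IH1 t2 IH2]; last first.
    rewrite (_ : (fun w => _) = (fun w => a * (cos (X w + th) * g1 w) + cos (X w + th) * g2 w)).
      exact: trig_lin.
    by apply/funext => w; ring.
  have t1 := @trig_cos L _ (th + th') (lL' 1 _ _ LX LY).
  have t2 := @trig_cos L _ (th - th') (lL' (-1) _ _ LY LX).
  rewrite (_ : (fun w => _) = (fun w => 2^-1 * cos (1 * X w + Y w + (th + th')) +
    2^-1 * cos (-1 * Y w + X w + (th - th')))).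
    by apply: trig_lin => //; exact: trigZ.
  apply/funext => w.
  rewrite (_ : 1 * X w + Y w + _ = (X w + th) + (Y w + th')); last by ring.
  rewrite (_ : -1 * Y w + X w + _ = (X w + th) - (Y w + th')); last by ring.
  by move: (X w + th) (Y w + th') => p q; rewrite cosB cosD; field.
- by move=> a f g; exact: trig_lin.
- move=> f; elim=> {f} [X th _|a f g _ [M hM] _ [N hN]].
    by exists 1 => w; exact: cos_max.
  exists (`|a| * M + N) => w.
  by rewrite (le_trans (ler_normD _ _))// normrM lerD// ler_wpM2l.
Qed.

(** It suffices to treat the half-lines [c < X], which [bset_gt] reduces to sines of
    [(X - c) / n.+1]; these are cosines of a multiple of [X] with phase shifted by [pi / 2]. *)
Lemma bset_trig X (A : set R) : L X -> measurable A -> bset (trig L) (X @^-1` A).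
Proof.
move=> LX mA; have aL := trig_algebra.
have [s0 sC sU] := bset_sigma_algebra aL.
pose G : set (set R) := [set B | bset (trig L) (X @^-1` B)].
suff : (@RGenOInfty.G R).-sigma.-measurable `<=` G.
  by apply; rewrite -RGenOInfty.measurableE.
apply: smallest_sub.
  split.
  - by rewrite /G/= preimage_set0.
  - by move=> B GB; rewrite /G/= setTD preimage_setC; exact: bsetC.
  - by move=> B GB; rewrite /G/= preimage_bigcup; exact: sU.
move=> _ [c ->]; rewrite /G/= (_ : _ @^-1` _ = [set x | c < X x]); last first.
  by apply/seteqP; split => x /=; rewrite in_itv/= andbT.
apply: bset_gt => // n; apply: bcl_base.
have LX' := @linear_setZ L n.+1%:R^-1 X lL LX.
have := @trig_cos L _ (- c / n.+1%:R - pi / 2) LX'.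
rewrite (_ : (fun w => _) = (fun x => sin ((X x - c) / n.+1%:R)))//.
apply/funext => w; rewrite addrA -cosBpihalf; congr cos; ring.
Qed.

End trigonometric_algebra.

(** * Equality of laws and independence from integrals of cosines *)

Section law_uniqueness.
Context {R : realType} {d : measure_display} {T : measurableType d}.
Variable P : probability T R.
Implicit Types (X f g : T -> R).

Let L1 : set (R -> R) := [set X | exists t, X = (fun x => t * x)].

Let lL1 : linear_set L1.
Proof.
split; first by exists 0; apply/funext => x; rewrite mul0r.
move=> a _ _ [s ->] [t ->]; exists (a * s + t).
by apply/funext => x; ring.
Qed.

(** The functions [x |-> cos (t * x + th)] generate a bounded algebra on the line. Equality of the
    two integrals survives linear combinations and bounded limits, hence reaches the indicators of
    measurable sets. *)
Lemma law_unique (Q : probability (measurableTypeR R) R) X :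
  measurable_fun [set: T] X ->
  (forall t th, \int[P]_w cos (t * X w + th) = \int[Q]_x cos (t * x + th)) ->
  forall A : set R, measurable A -> P (X @^-1` A) = Q A.
Proof.
move=> mX hX A mA.
have aL := trig_algebra lL1.
have mcos (t th : R) : measurable_fun [set: R] (fun x => cos (t * x + th)).
  apply: measurableT_comp; first exact: measurable_cos.
  by apply: measurable_funD => //; exact: measurable_funM.
have key (f : R -> R) : bcl (trig L1) f ->
    measurable_fun [set: R] f /\ \int[P]_w f (X w) = \int[Q]_x f x.
  elim=> {f} [f|f_ f M bf_ IH hM hf].
    elim=> {f} [_ th [t ->]|a f g tf [mf If] tg [mg Ig]]; first by split.
    have [Mf hf] := (let: And4 _ _ _ h := aL in h) _ tf.
    have [Mg hg] := (let: And4 _ _ _ h := aL in h) _ tg.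
    split; first by apply: measurable_funD => //; exact: measurable_funM.
    have iQf := @bounded_integrable _ _ _ Q _ _ mf hf.
    have iQg := @bounded_integrable _ _ _ Q _ _ mg hg.
    have iPf := @bounded_integrable _ _ _ P (f \o X) _ (measurableT_comp mf mX) (fun w => hf _).
    have iPg := @bounded_integrable _ _ _ P (g \o X) _ (measurableT_comp mg mX) (fun w => hg _).
    rewrite RintegralD//; [|exact: integrableZR].
    rewrite RintegralD//; [|exact: integrableZR].
    by rewrite RintegralZl// RintegralZl// If Ig.
  have mf : measurable_fun [set: R] f.
    by apply: (measurable_fun_cvg (h := f_)) => [n|x _]; [case: (IH n)|exact: hf].
  split => //.
  have c1 : \int[P]_w f_ n (X w) @[n --> \oo] --> \int[P]_w f (X w).
    apply: (@bounded_cvg_Rintegral _ _ _ P (fun n w => f_ n (X w)) _ M) => //.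
    - by move=> n; apply: measurableT_comp => //; case: (IH n).
    - exact: measurableT_comp.
    - by apply: aeW => w; exact: hf.
  have c2 : \int[Q]_x f_ n x @[n --> \oo] --> \int[Q]_x f x.
    apply: (@bounded_cvg_Rintegral _ _ _ Q f_ _ M) => //.
    - by move=> n; case: (IH n).
    - by apply: aeW => w; exact: hf.
  rewrite (_ : (fun n => \int[P]_w f_ n (X w)) = (fun n => \int[Q]_x f_ n x)) in c1.
    exact: (cvg_unique _ c1 c2).
  by apply/funext => n; case: (IH n).
have Lid : L1 id by exists 1; apply/funext => x; rewrite mul1r.
have [_] := key _ (bset_trig lL1 Lid mA); rewrite preimage_id.
have -> : \int[Q]_x \1_A x = fine (Q A).
  by rewrite /Rintegral integral_indic// setIT.
rewrite /Rintegral => h.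
rewrite -[RHS]fineK ?fin_num_measure// -h -[LHS]fineK ?fin_num_measure//; last first.
  by rewrite -[_ @^-1` _]setTI; exact: mX.
congr (fine _)%:E.
rewrite (eq_integral (fun w => (\1_(X @^-1` A) w)%:E)).
  by rewrite integral_indic// ?setIT// -[_ @^-1` _]setTI; exact: mX.
move=> w _; rewrite !indicE; congr ((_ : bool)%:R)%:E.
Qed.

Definition factor f g := \int[P]_w (f w * g w) = \int[P]_w f w * \int[P]_w g w.

Let bm f := measurable_fun [set: T] f /\ exists M, forall w, `|f w| <= M.

Let bm_int f : bm f -> P.-integrable setT (EFin \o f).
Proof. by move=> [mf [M hM]]; exact: bounded_integrable hM. Qed.

Let bmM f g : bm f -> bm g -> bm (fun w => f w * g w).
Proof.
move=> [mf [M hM]] [mg [N hN]]; split; first exact: measurable_funM.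
by exists (M * N) => w; rewrite normrM ler_pM.
Qed.

Let factor_lin a f1 f2 g : bm f1 -> bm f2 -> bm g -> factor f1 g -> factor f2 g ->
  factor (fun w => a * f1 w + f2 w) g.
Proof.
move=> b1 b2 bg; rewrite /factor => h1 h2.
under eq_Rintegral do rewrite mulrDl -mulrA.
rewrite RintegralD//; last 2 first.
- by apply: integrableZR; apply: bm_int; exact: bmM.
- by apply: bm_int; exact: bmM.
rewrite RintegralZl//; last by apply: bm_int; exact: bmM.
rewrite [X in _ = X * _]RintegralD//; last 2 first.
- by apply: integrableZR; exact: bm_int.
- exact: bm_int.
by rewrite RintegralZl//; [rewrite h1 h2; ring|exact: bm_int].
Qed.

Lemma factorC f g : factor f g -> factor g f.
Proof.
rewrite /factor => h; rewrite [RHS]mulrC -h.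
by apply: eq_Rintegral => w _; rewrite mulrC.
Qed.

(** Factorisation against a fixed bounded [g] is linear in [f] and stable under bounded limits. *)
Let factor_bcl (L : set (T -> R)) g : linear_set L ->
  (forall X, L X -> measurable_fun [set: T] X) -> bm g ->
  (forall X th, L X -> factor (fun w => cos (X w + th)) g) ->
  forall f, bcl (trig L) f -> bm f /\ factor f g.
Proof.
move=> lL mL bg hg f; have aL := trig_algebra lL.
elim=> {f} [f|f_ f M bf_ IH hM hf].
  elim=> {f} [X th LX|a f1 f2 t1 [b1 h1] t2 [b2 h2]].
    split; last exact: hg.
    split; last by exists 1 => w; exact: cos_max.
    apply: measurableT_comp; first exact: measurable_cos.
    by apply: measurable_funD => //; exact: mL.
  split; last exact: factor_lin.
  split; last exact: ((let: And4 _ _ _ h := aL in h) _ (trig_lin a t1 t2)).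
  by apply: measurable_funD; [apply: measurable_funM => //; case: b1|case: b2].
have mf_ n : measurable_fun [set: T] (f_ n) by case: (IH n) => -[].
have mf : measurable_fun [set: T] f.
  by apply: (measurable_fun_cvg (h := f_)) => // x _; exact: hf.
have bf : bm f by split => //; exact: bcl_bounded aL _ (bcl_lim bf_ hM hf).
split => //; case: (bg) => mg [N hN].
have c1 : \int[P]_w (f_ n w * g w) @[n --> \oo] --> \int[P]_w (f w * g w).
  apply: (@bounded_cvg_Rintegral _ _ _ P (fun n w => f_ n w * g w) _ (M * N)).
  - by move=> n; exact: measurable_funM.
  - exact: measurable_funM.
  - by move=> n w; rewrite normrM ler_pM.
  - by apply: aeW => w; apply: cvgM; [exact: hf|exact: cvg_cst].
have c2 : \int[P]_w f_ n w * \int[P]_w g w @[n --> \oo] --> \int[P]_w f w * \int[P]_w g w.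
  apply: cvgM; last exact: cvg_cst.
  by apply: (@bounded_cvg_Rintegral _ _ _ P f_ _ M) => //; apply: aeW => w; exact: hf.
rewrite (_ : (fun n => \int[P]_w (f_ n w * g w)) =
    (fun n => \int[P]_w f_ n w * \int[P]_w g w)) in c1.
  exact: (cvg_unique _ c1 c2).
by apply/funext => n; case: (IH n).
Qed.

(** Two passes: against a fixed cosine from [L'], factorisation extends from cosines of [L] to the
    indicator of [E]; against that indicator, it then extends from cosines of [L'] to the indicator
    of [E']. Measurability of both events, which [bset] does not contain by definition, comes out of
    the same induction. *)
Lemma independent_bset (L L' : set (T -> R)) : linear_set L -> linear_set L' ->
  (forall X, L X -> measurable_fun [set: T] X) ->
  (forall X, L' X -> measurable_fun [set: T] X) ->
  (forall X Y a b, L X -> L' Y ->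
    factor (fun w => cos (X w + a)) (fun w => cos (Y w + b))) ->
  forall E E', bset (trig L) E -> bset (trig L') E' ->
  [/\ measurable E, measurable E' & P (E `&` E') = (P E * P E')%E].
Proof.
move=> lL lL' mL mL' hL E E' bE bE'.
have bcos X th : measurable_fun [set: T] X -> bm (fun w => cos (X w + th)).
  move=> mX; split; last by exists 1 => w; exact: cos_max.
  apply: measurableT_comp; first exact: measurable_cos.
  exact: measurable_funD.
have h1 Y b : L' Y -> bm \1_E /\ factor \1_E (fun w => cos (Y w + b)).
  move=> L'Y; apply: (factor_bcl lL mL _ _ bE); first by apply: bcos; exact: mL'.
  by move=> X a LX; exact: hL.
have [bmE _] := h1 _ 0 (proj1 lL').
have [bmE' fEE'] : bm \1_E' /\ factor \1_E' \1_E.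
  apply: (factor_bcl lL' mL' bmE _ bE') => Y b L'Y.
  by apply: factorC; have [] := h1 Y b L'Y.
have mind (F : set T) : measurable_fun [set: T] (\1_F : T -> R) -> measurable F.
  move=> mF; have := mF measurableT [set 1] (measurable_set1 1).
  rewrite setTI (_ : _ @^-1` _ = F)//; apply/seteqP; split => x /=; rewrite indicE.
    by case: (boolP (x \in F)) => [/set_mem//|_ /esym/eqP]; rewrite oner_eq0.
  by move=> Fx; rewrite mem_set.
have mE : measurable E by apply: mind; case: bmE.
have mE' : measurable E' by apply: mind; case: bmE'.
split => //; move: fEE'; rewrite /factor.
have II (F : set T) : measurable F -> \int[P]_w \1_F w = fine (P F).
  by move=> mF; rewrite /Rintegral integral_indic ?setIT.
under eq_Rintegral do rewrite -[_ * _]/((\1_E' \* \1_E) _) -indicI.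
rewrite !II//; last exact: measurableI.
move=> h; rewrite setIC -[LHS]fineK ?fin_num_measure//; last exact: measurableI.
by rewrite h EFinM !fineK ?fin_num_measure// muleC.
Qed.

End law_uniqueness.

(** * Gaussian spaces *)

Lemma bigcap_ord_recr {T : Type} n (E : 'I_n.+1 -> set T) :
  \bigcap_(l in [set: 'I_n.+1]) E l =
  (\bigcap_(l in [set: 'I_n]) E (lift ord_max l)) `&` E ord_max.
Proof.
apply/seteqP; split => [x h|x [h1 h2] l _].
  by split=> [l _|]; exact: h.
by case: (unliftP ord_max l) => [j|] ->; [exact: h1|exact: h2].
Qed.

Lemma bset_bigcap {T : Type} {R : realType} (S : set (T -> R)) n (E : 'I_n -> set T) :
  bounded_algebra S -> (forall l, bset S (E l)) ->
  bset S (\bigcap_(l in [set: 'I_n]) E l).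
Proof.
move=> aS; elim: n E => [|n IH] E bE.
  rewrite (_ : \bigcap_(l in _) _ = ~` set0); first by apply: bsetC => //; exact: bset0.
  by apply/seteqP; split => // x _ [].
by rewrite bigcap_ord_recr; apply: bsetI => //; exact: IH.
Qed.

Definition mfun_of {d d' : measure_display} {T : measurableType d}
  {T' : measurableType d'} (f : T -> T') (mf : measurable_fun [set: T] f) :
  {mfun T >-> T'} :=
  MeasurableFun.Pack (MeasurableFun.Class (isMeasurableFun.Build _ _ _ _ _ mf)).

Lemma law_transfer {R : realType} {d : measure_display} {T : measurableType d}
  (P : probability T R) (N : probability (measurableTypeR R) R) (X : T -> R) (f : R -> R) :
  measurable_fun [set: T] X ->
  (forall A : set R, measurable A -> P (X @^-1` A) = N A) ->
  measurable_fun [set: R] f -> N.-integrable setT (EFin \o f) ->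
  P.-integrable setT (EFin \o (fun w => f (X w))) /\
  \int[P]_w f (X w) = \int[N]_x f x.
Proof.
move=> mX lX mf iF.
pose X' := @mfun_of _ _ T (measurableTypeR R) X mX.
have E (A : set (measurableTypeR R)) : measurable A -> A `<=` setT ->
    N A = distribution P X' A.
  by move=> mA _; rewrite /distribution /pushforward /= lX.
have mF : measurable_fun [set: measurableTypeR R] (EFin \o f).
  by case/integrableP : iF.
have i2 : P.-integrable setT (EFin \o (fun w => f (X w))).
  apply/integrableP; split.
    by apply/measurable_EFinP; exact: measurableT_comp.
  case/integrableP : iF => _; rewrite (eq_measure_integral (distribution P X'))//.
  by rewrite ge0_integral_distribution//; exact: measurableT_comp.
split => //; rewrite /Rintegral; congr fine.
by rewrite (eq_measure_integral (distribution P X'))// integral_distribution.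
Qed.

Lemma normal_transfer {R : realType} {d : measure_display} {T : measurableType d}
  (P : probability T R) (m s : R) (X : T -> R) (f : R -> R) :
  measurable_fun [set: T] X ->
  (forall A : set R, measurable A -> P (X @^-1` A) = normal_prob m s A) ->
  measurable_fun [set: R] f -> (normal_prob m s).-integrable setT (EFin \o f) ->
  P.-integrable setT (EFin \o (fun w => f (X w))) /\
  \int[P]_w f (X w) = \int[normal_prob m s]_x f x.
Proof. exact: (@law_transfer _ _ _ P (normal_prob m s)). Qed.

Section gaussian_space.
Context {R : realType} {d : measure_display} {T : measurableType d}.
Variable P : probability T R.
Local Notation ip := (ip P).
Local Notation L2 := (L2 P).

(** A linear space of centred normal variables, with normality expressed by the characteristic
    function. Variables of zero variance need no separate clause, and the condition is stable under
    limits. *)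
Definition gaussian_space (H : set (T -> R)) :=
  [/\ linear_set H, (forall X, H X -> L2 X) &
    forall X th, H X -> \int[P]_w cos (X w + th) = expR (- (ip X X) / 2) * cos th].

Variable H : set (T -> R).
Hypothesis gH : gaussian_space H.
Implicit Types (X Y : T -> R) (L : set (T -> R)).

Let HL2 X : H X -> L2 X. Proof. by case: gH => _ h _; exact: h. Qed.
Let Hlin : linear_set H. Proof. by case: gH. Qed.
Let Hm X : H X -> measurable_fun [set: T] X. Proof. by move=> /HL2[]. Qed.

(** By the product formula, only the laws of [X + Y] and [X - Y] matter; orthogonality gives both
    the variance [ip X X + ip Y Y], so the exponential splits. *)
Lemma gaussian_factor X Y a b : H X -> H Y -> ip X Y = 0 ->
  factor P (fun w => cos (X w + a)) (fun w => cos (Y w + b)).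
Proof.
move=> HX HY XY; case: gH => _ _ hcos; case: Hlin => _ hl.
have lX := HL2 HX; have lY := HL2 HY.
rewrite /factor !hcos//.
have H1 := hl 1 _ _ HX HY; have H2 := hl (-1) _ _ HY HX.
have cint Z th : H Z -> P.-integrable setT (EFin \o (fun w => cos (Z w + th))).
  move=> HZ; apply: (@bounded_integrable _ _ _ P _ 1); last by move=> w; exact: cos_max.
  apply: measurableT_comp; first exact: measurable_cos.
  by apply: measurable_funD => //; exact: Hm.
transitivity (\int[P]_w (2^-1 * cos (1 * X w + Y w + (a + b)) +
    2^-1 * cos (-1 * Y w + X w + (a - b)))).
  apply: eq_Rintegral => w _.
  rewrite (_ : 1 * X w + Y w + _ = (X w + a) + (Y w + b)); last by ring.
  rewrite (_ : -1 * Y w + X w + _ = (X w + a) - (Y w + b)); last by ring.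
  by move: (X w + a) (Y w + b) => p q; rewrite cosB cosD; field.
rewrite RintegralD//; [|by apply: integrableZR; exact: cint..].
rewrite !RintegralZl//; [|exact: cint..].
rewrite !hcos// !ip_linear_sq// (ipC P Y X) XY cosB cosD.
rewrite (_ : - (1 ^+ 2 * _ + _ + _) / 2 = - ip X X / 2 + - ip Y Y / 2); last by field.
rewrite (_ : - ((-1) ^+ 2 * _ + _ + _) / 2 = - ip X X / 2 + - ip Y Y / 2); last by field.
by rewrite expRD; field.
Qed.

Definition perp L : set (T -> R) := [set X | H X /\ forall Y, L Y -> ip X Y = 0].

Lemma linear_perp L : L `<=` H -> linear_set (perp L).
Proof.
move=> LH; case: Hlin => H0 hl; split; first by split => // Y _; exact: ip0l.
move=> a X Y [HX oX] [HY oY]; split; first exact: hl.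
move=> Z LZ; rewrite ip_lin ?oX ?oY ?mulr0 ?addr0//; first exact: HL2.
  exact: HL2.
exact/HL2/LH.
Qed.

(** Orthogonality of single variables is upgraded to independence of everything generated by [L] and
    by its complement. No dimension is restricted. *)
Lemma gaussian_indep L E E' : linear_set L -> L `<=` H ->
  bset (trig L) E -> bset (trig (perp L)) E' ->
  [/\ measurable E, measurable E' & P (E `&` E') = (P E * P E')%E].
Proof.
move=> lL LH; apply: independent_bset => //.
- exact: linear_perp.
- by move=> X /LH; exact: Hm.
- by move=> X [HX _]; exact: Hm.
- move=> X Y a b LX [HY oY]; apply: gaussian_factor => //; first exact: LH.
  by rewrite ipC oY.
Qed.

Lemma gaussian_law X : H X -> 0 < ip X X -> forall A : set R, measurable A ->
  P (X @^-1` A) = normal_prob 0 (Num.sqrt (ip X X)) A.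
Proof.
move=> HX v0; apply: law_unique; first exact: Hm.
move=> t th; rewrite normal_cos ?sqrtr_gt0// sqr_sqrtr ?(ltW v0)//.
case: gH => _ _ hcos; rewrite (hcos (fun w => t * X w)); last exact: linear_setZ.
have lX := HL2 HX; rewrite ipZl// ?ipZr//.
  by congr (expR _ * _); field.
by apply: HL2; exact: linear_setZ.
Qed.

Lemma gaussian_std_normal X : H X -> ip X X = 1 -> std_normal P X.
Proof.
move=> HX v1; split; first exact: Hm.
by move=> A mA; rewrite gaussian_law ?v1// sqrtr1.
Qed.

Lemma gaussian_m4 X : H X -> P.-integrable setT (EFin \o (fun w => X w ^+ 4)) /\
  \int[P]_w X w ^+ 4 = 3 * ip X X ^+ 2.
Proof.
move=> HX; have := ip_ge0 P X; rewrite le_eqVlt => /predU1P[/esym v0|v0].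
  have lX := HL2 HX; have X0 := ip_norm0_ae lX v0.
  have m4 : measurable_fun [set: T] (fun w => (X w ^+ 4)%:E).
    by apply/measurable_EFinP/measurable_funX; exact: Hm.
  have ae4 : ae_eq P setT (fun w => (X w ^+ 4)%:E) (cst 0%E).
    by apply: filterS X0 => w -> _; rewrite expr0n.
  split.
    apply/integrableP; split => //.
    rewrite (_ : (\int[P]_w _ = 0)%E)//; apply/ae_eq_integral_abs => //.
  rewrite v0 expr0n mulr0 /Rintegral (ae_eq_integral (cst 0%E))// integral0//.
have s0 : 0 < Num.sqrt (ip X X) by rewrite sqrtr_gt0.
have iN : (normal_prob 0 (Num.sqrt (ip X X))).-integrable setT (EFin \o (fun x : R => x ^+ 4)).
  have := @integrable_normalX R 0 _ s0 4 isT.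
  by apply: eq_integrable => // x _ /=; rewrite subr0.
have [|i4 E] := normal_transfer (Hm HX) (gaussian_law HX v0) _ iN; first exact: measurable_funX.
split => //; rewrite E.
transitivity (\int[normal_prob 0 (Num.sqrt (ip X X))]_x (x - 0) ^+ 4).
  by apply: eq_Rintegral => x _; rewrite subr0.
rewrite !normal_moment// sqr_sqrtr ?(ltW v0)//.
under eq_Rintegral do rewrite expr0.
by rewrite normal_total; ring.
Qed.

(** The element of the second Wiener chaos attached to the rank-one form [h |-> ip X h ^+ 2]. *)
Definition chaos X : T -> R := fun w => X w ^+ 2 - ip X X.

Lemma L2_sqr X : H X -> L2 (fun w => X w ^+ 2).
Proof.
move=> HX; have [i4 _] := gaussian_m4 HX; split.
  by apply: measurable_funX; exact: Hm.
by apply: eq_integrable i4 => // w _ /=; congr EFin; ring.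
Qed.

Lemma L2_chaos X : H X -> L2 (chaos X).
Proof. by move=> HX; apply: L2_sub; [exact: L2_sqr|exact: (L2_cst P (ip X X))]. Qed.

(** Polarisation of fourth moments: [X^2 Y^2] is [((X + Y)^4 + (Y - X)^4) / 12 - (X^4 + Y^4) / 6],
    and each fourth moment is three times a squared variance. Up to the factor 2, this is the
    Hilbert-Schmidt product of the two rank-one forms. *)
Lemma gaussian_chaos X Y : H X -> H Y -> ip (chaos X) (chaos Y) = 2 * ip X Y ^+ 2.
Proof.
move=> HX HY; have lX := HL2 HX; have lY := HL2 HY.
have l2X := L2_sqr HX; have l2Y := L2_sqr HY; have [_ hl] := Hlin.
have Hp := hl 1 _ _ HX HY; have Hm' := hl (-1) _ _ HX HY.
have [ip4 Ep] := gaussian_m4 Hp; have [im4 Em] := gaussian_m4 Hm'.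
have [iX4 EX] := gaussian_m4 HX; have [iY4 EY] := gaussian_m4 HY.
have E2 : ip (fun w => X w ^+ 2) (fun w => Y w ^+ 2) = ip X X * ip Y Y + 2 * ip X Y ^+ 2.
  rewrite {1}/ip.
  transitivity (\int[P]_w (12^-1 * ((1 * X w + Y w) ^+ 4 + (-1 * X w + Y w) ^+ 4) +
      (- 6^-1) * (X w ^+ 4 + Y w ^+ 4))).
    by apply: eq_Rintegral => w _; field.
  have i1 := integrableDR ip4 im4; have i2 := integrableDR iX4 iY4.
  rewrite RintegralD//; [|exact: integrableZR..].
  rewrite !RintegralZl// !RintegralD// Ep Em EX EY !ip_linear_sq//.
  by field.
have E1 Z : H Z -> ip (fun w => Z w ^+ 2) (cst 1) = ip Z Z.
  by move=> HZ; rewrite /ip; apply: eq_Rintegral => w _ /=; rewrite mulr1 expr2.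
have l1 := L2_cst P 1.
have -> : chaos X = (fun w => (- ip X X) * cst 1 w + X w ^+ 2).
  by apply/funext => w; rewrite /chaos /=; ring.
have -> : chaos Y = (fun w => (- ip Y Y) * cst 1 w + Y w ^+ 2).
  by apply/funext => w; rewrite /chaos /=; ring.
have E11 : ip (cst 1) (cst 1) = 1.
  rewrite /ip; under eq_Rintegral do rewrite /= mul1r.
  by rewrite Rintegral_cst//= probability_setT mulr1.
have lYc : L2 (fun w => (- ip Y Y) * cst 1 w + Y w ^+ 2) by exact: L2_lin.
rewrite ip_lin// (ipC P (cst 1)) (ipC P (fun w => X w ^+ 2)) !ip_lin//.
by rewrite (ipC P (cst 1) (fun w => X w ^+ 2)) E11 !E1// (ipC P (fun w => Y w ^+ 2)) E2; ring.
Qed.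

(** Induction on the number of variables: the last one spans a line, and the others lie in its
    orthogonal complement. *)
Lemma gaussian_mutual_indep n (X : 'I_n -> T -> R) : (forall l, H (X l)) ->
  (forall l l', l != l' -> ip (X l) (X l') = 0) -> mutually_independent P X.
Proof.
move=> HX oX; split; first by move=> l; exact: Hm.
elim: n X HX oX => [|n IH] X HX oX A mA.
  rewrite big_ord0 (_ : \bigcap_(l in _) _ = setT) ?probability_setT//.
  by apply/seteqP; split => // x _ [].
pose L : set (T -> R) := [set Y | exists t, Y = (fun w => t * X ord_max w)].
have lL : linear_set L.
  split; first by exists 0; apply/funext => x; rewrite mul0r.
  move=> a _ _ [s ->] [t ->]; exists (a * s + t).
  by apply/funext => x; ring.
have LH : L `<=` H by move=> _ [t ->]; exact: linear_setZ.
have lP := linear_perp LH.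
have LX : L (X ord_max) by exists 1; apply/funext => w; rewrite mul1r.
have PX l : perp L (X (lift ord_max l)).
  split => // _ [t ->]; rewrite ipZr//; [|exact: HL2..].
  by rewrite oX ?mulr0// eq_sym neq_lift.
have [_ _] := gaussian_indep lL LH (bset_trig lL LX (mA ord_max))
  (bset_bigcap (trig_algebra lP) (fun l => bset_trig lP (PX l) (mA (lift ord_max l)))).
rewrite bigcap_ord_recr setIC => ->; rewrite IH//; last first.
  by move=> l l' ll'; apply: oX; rewrite (inj_eq lift_inj).
rewrite big_ord_recr/= muleC; congr (_ * _)%E.
apply: eq_bigr => l _; congr (P (X _ @^-1` A _));
  by apply: val_inj; rewrite /= /bump leqNgt ltn_ord.
Qed.

End gaussian_space.

(** An upper limit exists at every point, so the result is measurable for any sigma-algebra that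
    makes the terms measurable. No modification on a null set is involved, which would leave the
    sigma-algebra of an orthogonal complement. *)
Definition limfun {T : Type} {R : realType} (X_ : nat -> T -> R) : T -> R :=
  fun w => fine (limn_esup (fun n => (X_ n w)%:E)).

Lemma limfunE {T : Type} {R : realType} (X_ : nat -> T -> R) w (l : R) :
  X_ n w @[n --> \oo] --> l -> limfun X_ w = l.
Proof.
move=> h; have h' : (X_ n w)%:E @[n --> \oo] --> l%:E.
  by apply: cvg_EFin => //; exact: nearW.
rewrite /limfun is_cvg_limn_esupE; last by apply/cvg_ex; eexists; exact: h'.
by rewrite (cvg_lim _ h').
Qed.

Lemma measurable_limfun {R : realType} {d : measure_display} {T : measurableType d}
  (X_ : nat -> T -> R) : (forall n, measurable_fun [set: T] (X_ n)) ->
  measurable_fun [set: T] (limfun X_).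
Proof.
move=> mX; apply: measurableT_comp => //.
by apply: measurable_fun_limn_esup => n; exact/measurable_EFinP.
Qed.

Lemma bounded_sums_cauchy {R : realType} (a : nat -> R) (B : R) :
  (forall j, 0 <= a j) -> (forall n, \sum_(j < n) a j <= B) ->
  forall e, 0 < e -> exists N, forall m n, (N <= n)%N -> (n <= m)%N ->
    \sum_(j < m) a j - \sum_(j < n) a j <= e.
Proof.
move=> a0 aB e e0; pose s n := \sum_(j < n) a j.
have snd : nondecreasing_seq s.
  by apply/nondecreasing_seqP => n; rewrite /s big_ord_recr/= lerDl.
have scv : cvgn s.
  by apply: nondecreasing_is_cvgn => //; exists B => _ [n _ <-]; exact: aB.
have sle n : s n <= limn s by exact: nondecreasing_cvgn_le.
move/cvgrPdist_le : (scv) => /(_ e e0)[N _ hN].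
exists N => m n Nn nm; apply: (@le_trans _ _ (limn s - s n)).
  by rewrite lerD2r sle.
by rewrite (le_trans (ler_norm _))//; exact: hN.
Qed.

(** * Almost sure and mean-square convergence of orthogonal series *)

Section series.
Context {R : realType} {d : measure_display} {T : measurableType d}.
Variable P : probability T R.
Local Notation ip := (ip P).
Local Notation L2 := (L2 P).

(** The sum of the absolute values has finite integral, hence is finite almost everywhere, and the
    series converges absolutely there. *)
Lemma L1_series_ae (Y : nat -> T -> R) (u : nat -> R) (B : R) :
  (forall j, P.-integrable setT (EFin \o Y j)) ->
  (forall j, \int[P]_w `|Y j w| <= u j) -> (forall n, \sum_(j < n) u j <= B) ->
  {ae P, forall w, cvgn (fun n => \sum_(j < n) Y j w)}.
Proof.
move=> iY Yu uB.
have iY' j : P.-integrable setT (fun w => `|Y j w|%:E).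
  by have := integrable_abse (iY j); apply: eq_integrable.
have mY j : measurable_fun [set: T] (fun w => `|Y j w|%:E).
  by case/integrableP : (iY' j).
pose S w := (\sum_(0 <= j <oo) (`|Y j w|)%:E)%E.
have IS : (\int[P]_w S w <= B%:E)%E.
  rewrite integral_nneseries//.
  apply: lime_le; first by apply: is_cvg_nneseries => n _ _; apply: integral_ge0.
  apply: nearW => n; rewrite big_mkord.
  apply: (@le_trans _ _ (\sum_(j < n) (u j)%:E)%E); last by rewrite sumEFin lee_fin.
  apply: lee_sum => j _; rewrite -[leLHS]fineK; last exact: integrable_fin_num.
  by rewrite lee_fin; exact: Yu.
have mS : measurable_fun [set: T] S by exact: ge0_emeasurable_sum.
have S0 w : (0 <= S w)%E by apply: nneseries_ge0.
have iS : P.-integrable setT S.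
  apply/integrableP; split => //.
  under eq_integral do rewrite gee0_abs//.
  by rewrite (le_lt_trans IS)// ltry.
have := integrable_ae measurableT iS; apply: filterS => w /(_ Logic.I) Sfin.
have : cvgn (series (fun j => Y j w)).
  apply: normed_cvg; apply: nondecreasing_is_cvgn.
    by apply: nondecreasing_series => n _; rewrite normr_ge0.
  exists (fine (S w)) => _ [n _ <-]; rewrite -lee_fin fineK//.
  rewrite /series /= -sumEFin; apply: (@nneseries_lim_ge _ (fun j => `|Y j w|%:E) xpredT 0) => //.
rewrite (_ : series _ = (fun n => \sum_(j < n) Y j w))//.
by apply/funext => n; rewrite /series/= big_mkord.
Qed.

Variable Y : nat -> T -> R.
Hypothesis lY : forall j, L2 (Y j).
Hypothesis oY : forall j j', j <> j' -> ip (Y j) (Y j') = 0.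

Let psum (a : nat -> R) n : T -> R := fun w => \sum_(j < n) a j * Y j w.

Lemma orth_dist2 (a : nat -> R) m n : (n <= m)%N ->
  dist2 P (psum a m) (psum a n) =
  \sum_(j < m) (a j ^+ 2 * ip (Y j) (Y j)) - \sum_(j < n) (a j ^+ 2 * ip (Y j) (Y j)).
Proof.
move=> nm; pose c (j : 'I_m) := if (n <= j)%N then a j else 0.
have splitn (F : nat -> R) : \sum_(j < m) F j - \sum_(j < n) F j =
    \sum_(j < m) (if (n <= j)%N then F j else 0).
  rewrite -(subnKC nm) !big_split_ord/= addrAC subrr add0r.
  rewrite [X in _ = X + _]big1 ?add0r; last first.
    by move=> i _; rewrite leqNgt ltn_ord.
  by apply: eq_bigr => i _; rewrite leq_addr.
have E : sub (psum a m) (psum a n) = (fun w => \sum_(j < m) c j * Y j w).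
  apply/funext => w; rewrite /sub /psum (splitn (fun j => a j * Y j w)).
  by apply: eq_bigr => j _; rewrite /c; case: ifP; rewrite ?mul0r.
rewrite /dist2 E ip_suml//; last exact: L2_sum.
rewrite (splitn (fun j => a j ^+ 2 * ip (Y j) (Y j))); apply: eq_bigr => j _.
rewrite ip_sumr// (bigD1 j)//= big1 ?addr0; last first.
  move=> i ij; rewrite oY ?mulr0// => /val_inj ji.
  by rewrite ji eqxx in ij.
by rewrite /c; case: ifP => _; rewrite ?mul0r// mulrA expr2.
Qed.

Lemma orth_series_cauchy (a : nat -> R) (K B : R) : 0 <= K ->
  (forall j, ip (Y j) (Y j) <= K) -> (forall n, \sum_(j < n) a j ^+ 2 <= B) ->
  forall e, 0 < e -> exists N, forall m n, (N <= m)%N -> (N <= n)%N ->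
     dist2 P (psum a m) (psum a n) <= e.
Proof.
move=> K0 YK aB e e0.
have [||N hN] := @bounded_sums_cauchy R (fun j => a j ^+ 2 * ip (Y j) (Y j)) (B * K) _ _ e e0.
- by move=> j; rewrite mulr_ge0 ?sqr_ge0 ?ip_ge0.
- move=> n; apply: (@le_trans _ _ ((\sum_(j < n) a j ^+ 2) * K)); last by rewrite ler_wpM2r.
  by rewrite mulr_suml ler_sum// => j _; rewrite ler_wpM2l// sqr_ge0.
have sym U V : dist2 P U V = dist2 P V U.
  by rewrite /dist2 /ip /sub; apply: eq_Rintegral => w _; ring.
exists N => m n Nm Nn; have [nm|/ltnW mn] := leqP n m; first by rewrite orth_dist2// hN.
by rewrite sym orth_dist2// hN.
Qed.

Lemma bessel (h : T -> R) n : (forall j, ip (Y j) (Y j) = 1) -> L2 h ->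
  \sum_(j < n) ip (Y j) h ^+ 2 <= ip h h.
Proof.
move=> nY lh; pose p : T -> R := fun w => \sum_(j < n) ip (Y j) h * Y j w.
have lp : L2 p by exact: L2_sum.
have ph : ip p h = \sum_(j < n) ip (Y j) h ^+ 2.
  by rewrite /p ip_suml//; apply: eq_bigr => j _; rewrite expr2.
have pp : ip p p = \sum_(j < n) ip (Y j) h ^+ 2.
  rewrite {1}/p ip_suml//; apply: eq_bigr => j _.
  rewrite ip_sumr// (bigD1 j)//= big1 ?addr0; last first.
    move=> i ij; rewrite oY ?mulr0// => /val_inj ji.
    by rewrite ji eqxx in ij.
  by rewrite nY mulr1 expr2.
have := ip_ge0 P (fun w => -1 * p w + h w); rewrite ip_linear_sq// pp ph.
by lra.
Qed.

End series.

(** * From jointly Gaussian families to a Gaussian space stable under limits *)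

Section centered_gaussian.
Context {R : realType} {d : measure_display} {T : measurableType d}.
Variable P : probability T R.
Local Notation ip := (ip P).
Local Notation L2 := (L2 P).

Lemma gaussian_rv_L2 X : gaussian_rv P X -> L2 X.
Proof.
move=> [mX [m [[s [s0 law]]|Xm]]]; split => //.
  have i2 : (normal_prob m s).-integrable setT (EFin \o (fun x : R => x ^+ 2)).
    apply: (@integrable_growth_normal _ m s s0 _ (2 + m ^+ 2 *+ 2)).
      exact: measurable_funX.
    move=> x; rewrite ger0_norm ?sqr_ge0//; set y := x - m.
    have -> : x = y + m by rewrite /y subrK.
    have h2 : y ^+ 2 <= 1 + y ^+ 6.
      have [h|/ltW h] := lerP (y ^+ 2) 1; first by rewrite (le_trans h)// lerDl exprn_even_ge0.
      rewrite (_ : y ^+ 6 = (y ^+ 2) ^+ 3); last by rewrite -exprM.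
      rewrite (@le_trans _ _ ((y ^+ 2) ^+ 3))//; last by rewrite lerDr.
      by rewrite -[leLHS]expr1 ler_weXn2l.
    have h6 : 0 <= y ^+ 6 by rewrite exprn_even_ge0.
    have := sqr_ge0 m; have := sqr_ge0 (y - m); nra.
  have [|i _] := normal_transfer mX law _ i2; [exact: measurable_funX|exact: i].
have ae2 : ae_eq P setT (fun w => (X w ^+ 2)%:E) (cst (m ^+ 2)%:E).
  by apply: filterS Xm => w -> _.
have m2 : measurable_fun [set: T] (fun w => (X w ^+ 2)%:E).
  by apply/measurable_EFinP; exact: measurable_funX.
apply/integrableP; split => //.
rewrite (ae_eq_integral (cst `|(m ^+ 2)%:E|%E))//.
- by rewrite integral_cst//= probability_setT mule1 ltry.
- exact: measurableT_comp.
- by apply: filterS ae2 => w h _; rewrite h.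
Qed.

(** Zero mean forces [m = 0] in both cases of the definition; a degenerate variable is then almost
    surely 0, and the formula holds with variance 0. *)
Lemma gaussian_rv_cos X th : gaussian_rv P X -> \int[P]_w X w = 0 ->
  \int[P]_w cos (X w + th) = expR (- ip X X / 2) * cos th.
Proof.
move=> gX X0; have lX := gaussian_rv_L2 gX.
case: gX => mX [m [[s [s0 law]]|Xm]].
  have iN (f : R -> R) K := @integrable_growth_normal _ m s s0 f K.
  have ix : (normal_prob m s).-integrable setT (EFin \o (fun x : R => x)).
    apply: (iN _ (1 + `|m|)) => // x.
    have g1 : `|x - m| <= 1 + (x - m) ^+ 6.
      set y := x - m; rewrite -(@ger0_norm _ (y ^+ 6)) ?exprn_even_ge0//.
      have [h|/ltW h] := lerP `|y| 1; first by rewrite (le_trans h)// lerDl normr_ge0.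
      rewrite normrX (@le_trans _ _ (`|y| ^+ 6))//; last by rewrite lerDr.
      by rewrite -[leLHS]expr1 ler_weXn2l.
    rewrite mulrDl mul1r -[x in leLHS](subrK m) (le_trans (ler_normD _ _))//.
    by rewrite lerD// ler_peMr// lerDl exprn_even_ge0.
  have [_ EX] := normal_transfer mX law (@measurable_id _ _ _) ix.
  have m0 : m = 0 by rewrite -(normal_mean m s0) -EX.
  rewrite m0 in law iN.
  have i2 : (normal_prob 0 s).-integrable setT (EFin \o (fun x : R => x ^+ 2)).
    have := @integrable_normalX R 0 s s0 2 isT.
    by apply: eq_integrable => // x _ /=; rewrite subr0.
  have [|_ E2] := normal_transfer mX law _ i2; first exact: measurable_funX.
  have v : ip X X = s ^+ 2.
    rewrite /ip; transitivity (\int[P]_w X w ^+ 2).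
      by apply: eq_Rintegral => w _; rewrite expr2.
    rewrite E2; transitivity (\int[normal_prob 0 s]_x (x - 0) ^+ 2).
      by apply: eq_Rintegral => x _; rewrite subr0.
    rewrite normal_moment//; under eq_Rintegral do rewrite expr0.
    by rewrite normal_total !mulr1.
  have mc : measurable_fun [set: R] (fun x => cos (x + th)).
    by apply: measurableT_comp; [exact: measurable_cos|exact: measurable_funD].
  have ic : (normal_prob 0 s).-integrable setT (EFin \o (fun x : R => cos (x + th))).
    apply: (iN _ 1) => // x; rewrite mul1r (le_trans (cos_max _))//.
    by rewrite lerDl exprn_even_ge0.
  have [_ ->] := normal_transfer mX law mc ic.
  transitivity (\int[normal_prob 0 s]_x cos (1 * x + th)).
    by apply: eq_Rintegral => x _; rewrite mul1r.
  by rewrite normal_cos// v expr1n mulr1 mulNr.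
have aeR (f : R -> R) : measurable_fun [set: R] f -> \int[P]_w f (X w) = f m.
  move=> mf; rewrite /Rintegral (ae_eq_integral (cst (f m)%:E))//.
  - by rewrite integral_cst//= probability_setT mule1.
  - by apply/measurable_EFinP; exact: measurableT_comp.
  - by apply: filterS Xm => w -> _.
have m0 : m = 0 by rewrite -X0 (aeR id).
have mc : measurable_fun [set: R] (fun x => cos (x + th)).
  by apply: measurableT_comp; [exact: measurable_cos|exact: measurable_funD].
rewrite (aeR (fun x => cos (x + th)))// m0 add0r.
rewrite /ip (aeR (fun x => x * x)); last exact: measurable_funM.
by rewrite m0 mulr0 oppr0 mul0r expR0 mul1r.
Qed.

End centered_gaussian.

Section closure.
Context {R : realType} {d : measure_display} {T : measurableType d}.
Variable P : probability T R.
Local Notation ip := (ip P).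
Local Notation L2 := (L2 P).
Variable S : set (T -> R).
Hypothesis gS : gaussian_space P S.

(** One sequence has to converge in both senses: almost sure convergence passes to the limit under
    cosines, mean-square convergence controls the variances. The series built below provide both, so
    no subsequence has to be extracted. *)
Definition L2closure : set (T -> R) := [set X | L2 X /\
  exists X_ : nat -> T -> R, [/\ forall n, S (X_ n),
    {ae P, forall w, X_ n w @[n --> \oo] --> X w} &
    dist2 P (X_ n) X @[n --> \oo] --> (0 : R)]].

Lemma L2closure_lim (X_ : nat -> T -> R) (X : T -> R) : (forall n, S (X_ n)) ->
  measurable_fun [set: T] X ->
  {ae P, forall w, X_ n w @[n --> \oo] --> X w} ->
  (forall e, 0 < e -> exists N, forall m n, (N <= m)%N -> (N <= n)%N ->
     dist2 P (X_ m) (X_ n) <= e) -> L2closure X.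
Proof.
case: gS => _ SL _ SX mX cX hX.
have [lX dX] := L2_fatou (fun n => SL _ (SX n)) mX cX hX.
by split => //; exists X_.
Qed.

Lemma sub_L2closure : S `<=` L2closure.
Proof.
case: gS => _ SL _ X SX; split; first exact: SL.
exists (fun=> X); split => //.
  by apply: aeW => w; exact: cvg_cst.
rewrite (_ : (fun=> _) = fun=> 0); first exact: cvg_cst.
apply/funext => n; rewrite /dist2 (_ : sub X X = cst 0) ?ip0l//.
by apply/funext => w; rewrite /sub subrr.
Qed.

Lemma gaussian_L2closure : gaussian_space P L2closure.
Proof.
case: (gS) => -[S0 Slin] SL Scos; split.
- split; first exact: sub_L2closure.
  move=> a X Y [lX [X_ [SX cX dX]]] [lY [Y_ [SY cY dY]]].
  split; first exact: L2_lin.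
  exists (fun n w => a * X_ n w + Y_ n w); split.
  + by move=> n; exact: Slin.
  + apply: filterS2 cX cY => w hX hY; apply: cvgD => //.
    by apply: cvgM => //; exact: cvg_cst.
  + have hb : (a ^+ 2 *+ 2) * dist2 P (X_ n) X + 2 * dist2 P (Y_ n) Y @[n --> \oo] --> (0 : R).
      rewrite (_ : 0 = (a ^+ 2 *+ 2) * 0 + 2 * 0); last by ring.
      by apply: cvgD; apply: cvgM => //; exact: cvg_cst.
    apply: (squeeze_cvgr _ (cvg_cst 0) hb); apply: nearW => n.
    rewrite ip_ge0/=.
    have l1 := L2_sub (SL _ (SX n)) lX; have l2 := L2_sub (SL _ (SY n)) lY.
    have := ip_ge0 P (fun w => (- a) * sub (X_ n) X w + sub (Y_ n) Y w).
    rewrite ip_linear_sq// /dist2.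
    have -> : sub (fun w => a * X_ n w + Y_ n w) (fun w => a * X w + Y w) =
        (fun w => a * sub (X_ n) X w + sub (Y_ n) Y w).
      by apply/funext => w; rewrite /sub; ring.
    by rewrite ip_linear_sq// mulr2n sqrrN; lra.
- by move=> X [].
- move=> X th [lX [X_ [SX cX dX]]].
  have mX_ n : measurable_fun [set: T] (X_ n) by case: (SL _ (SX n)).
  have mc (Z : T -> R) : measurable_fun [set: T] Z ->
      measurable_fun [set: T] (fun w => cos (Z w + th)).
    move=> mZ; apply: measurableT_comp; first exact: measurable_cos.
    exact: measurable_funD.
  have c1 : \int[P]_w cos (X_ n w + th) @[n --> \oo] --> \int[P]_w cos (X w + th).
    apply: (@bounded_cvg_Rintegral _ _ _ P (fun n w => cos (X_ n w + th)) _ 1).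
    + by move=> n; exact: mc.
    + by apply: mc; case: lX.
    + by move=> n w; exact: cos_max.
    + apply: filterS cX => w hw; apply: (cvg_comp _ (@cos R)); last exact: continuous_cos.
      by apply: cvgD => //; exact: cvg_cst.
  have n2 : ip (X_ n) (X_ n) @[n --> \oo] --> ip X X.
    have E n : ip (X_ n) (X_ n) = dist2 P (X_ n) X + 2 * ip (X_ n) X - ip X X.
      have ln := SL _ (SX n); have ls := L2_sub ln lX.
      rewrite /dist2 ip_subl// ip_subr// ip_subr// (ipC P X (X_ n)); ring.
    rewrite (_ : (fun n => _) = (fun n => dist2 P (X_ n) X + 2 * ip (X_ n) X - ip X X)); last first.
      by apply/funext => n; exact: E.
    rewrite [X in _ --> X](_ : _ = 0 + 2 * ip X X - ip X X); last by ring.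
    apply: cvgB; last exact: cvg_cst.
    apply: cvgD => //; apply: cvgM; first exact: cvg_cst.
    by apply: ip_cvg => // n; exact: SL.
  have c2 : expR (- ip (X_ n) (X_ n) / 2) * cos th @[n --> \oo] --> expR (- ip X X / 2) * cos th.
    apply: cvgM; last exact: cvg_cst.
    apply: (cvg_comp _ (@expR R)); last exact: continuous_expR.
    by apply: cvgM; [exact: cvgN|exact: cvg_cst].
  rewrite (_ : (fun n => \int[P]_w cos (X_ n w + th)) =
    (fun n => expR (- ip (X_ n) (X_ n) / 2) * cos th)) in c1.
    exact: (cvg_unique _ c1 c2).
  by apply/funext => n; exact: Scos.
Qed.

End closure.

Section gaussian_span.
Context {R : realType} {d : measure_display} {T : measurableType d}.
Variables (P : probability T R) (I : Type) (g : I -> T -> R).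
Hypothesis jg : jointly_gaussian P g.
Hypothesis g0 : forall i, \int[P]_w g i w = 0.

Definition gspan : set (T -> R) := [set X | exists n (c : 'I_n -> R) (idx : 'I_n -> I),
  X = (fun w => \sum_(l < n) c l * g (idx l) w)].

Lemma gspan_gen i : gspan (g i).
Proof.
exists 1%N, (fun=> 1), (fun=> i); apply/funext => w.
by rewrite big_ord1 mul1r.
Qed.

(** Joint normality says exactly that every finite combination is normal, possibly degenerate; it is
    centred because the generators are. *)
Lemma gaussian_gspan : gaussian_space P gspan.
Proof.
have gL2 i : L2 P (g i).
  apply: gaussian_rv_L2; have := jg (fun=> i) (fun _ : 'I_1 => 1).
  by under eq_fun do rewrite big_ord1 mul1r.
split.
- split.
    exists 0%N, (fun=> 0), (fun i : 'I_0 => match notF (ltn_ord i) with end).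
    by apply/funext => w; rewrite big_ord0.
  move=> a _ _ [n [c [idx ->]]] [m [e [jdx ->]]].
  exists (n + m)%N, (fun l => match fintype.split l with inl i => a * c i | inr j => e j end),
    (fun l => match fintype.split l with inl i => idx i | inr j => jdx j end).
  apply/funext => w; rewrite big_split_ord/= mulr_sumr; congr (_ + _).
    by apply: eq_bigr => i _; rewrite (unsplitK (inl i)) mulrA.
  by apply: eq_bigr => i _; rewrite (unsplitK (inr i)).
- by move=> _ [n [c [idx ->]]]; apply: gaussian_rv_L2; exact: jg.
- move=> _ th [n [c [idx ->]]]; apply: gaussian_rv_cos; first exact: jg.
  have E1 (X : T -> R) : \int[P]_w X w = ip P X (cst 1).
    by apply: eq_Rintegral => w _; rewrite mulr1.
  rewrite E1 ip_suml//; last exact: L2_cst.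
  by apply: big1 => i _; rewrite -E1 g0 mulr0.
Qed.

End gaussian_span.

(** * The quadratic form of a series in the second chaos *)

Section quadratic_operator.
Context {R : realType} {d : measure_display} {T : measurableType d}.
Variable P : probability T R.
Local Notation ip := (ip P).
Local Notation L2 := (L2 P).
Variable S : set (T -> R).
Hypothesis gS : gaussian_space P S.
Local Notation H := (L2closure P S).
Variables (e : nat -> T -> R) (l : nat -> R) (B : R).
Hypothesis Se : forall j, S (e j).
Hypothesis ne : forall j, ip (e j) (e j) = 1.
Hypothesis oe : forall j j', j <> j' -> ip (e j) (e j') = 0.
Hypothesis lB : forall n, \sum_(j < n) l j ^+ 2 <= B.

Let Le j : L2 (e j). Proof. by case: gS => _ h _; exact: h. Qed.

Let gH : gaussian_space P H. Proof. exact: gaussian_L2closure. Qed.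
Let HL2 X : H X -> L2 X. Proof. by case: gH => _ h _; exact: h. Qed.

Let coef h j := l j * ip (e j) h.

(** The Hilbert-Schmidt operator with orthonormal eigenvectors [e j] and eigenvalues [l j], realised
    as a function defined at every sample point. *)
Definition quad_op (h : T -> R) : T -> R :=
  limfun (fun n w => \sum_(j < n) (l j * ip (e j) h) * e j w).

Let coef_l1 h j : `|coef h j| <= (l j ^+ 2 + ip (e j) h ^+ 2) / 2.
Proof.
rewrite /coef; set a := l j; set b := ip _ _.
have := sqr_ge0 (a - b); have := sqr_ge0 (a + b).
by rewrite ler_norml => *; apply/andP; split; nra.
Qed.

Let e_l1 j : \int[P]_w `|e j w| <= 1.
Proof.
have i2 := L2_ip (Le j) (Le j); have i1 := integrable_cst P 1.
have ib : P.-integrable setT (EFin \o (fun w => 2^-1 * (cst 1 w + e j w * e j w))).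
  by apply: integrableZR; exact: integrableDR.
have ia : P.-integrable setT (EFin \o (fun w => `|e j w|)).
  exact: integrable_norm (L2_int (Le j)).
apply: (@le_trans _ _ (\int[P]_w (2^-1 * (cst 1 w + e j w * e j w)))).
  apply: le_Rintegral => // w _ /=.
  by rewrite ler_norml; have := sqr_ge0 (e j w - 1); have := sqr_ge0 (e j w + 1);
    move=> *; apply/andP; split; nra.
rewrite RintegralZl//; last exact: integrableDR.
rewrite RintegralD// Rintegral_cst//= probability_setT -/(ip _ _) ne.
by rewrite mulr1 (_ : 1 + 1 = 2)// mulVf.
Qed.

(** The coefficients are absolutely summable, not just square-summable: [|l j * ip (e j) h|] is at
    most half the sum of the two squares, and Bessel's inequality bounds the second. As [|e j|] has
    integral at most 1, almost sure convergence needs no maximal inequality. *)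
Lemma quad_op_ae h : L2 h -> {ae P, forall w,
  (\sum_(j < n) (l j * ip (e j) h) * e j w) @[n --> \oo] --> quad_op h w}.
Proof.
move=> lh.
have : {ae P, forall w, cvgn (fun n => \sum_(j < n) (coef h j) * e j w)}.
  apply: (@L1_series_ae _ _ _ P (fun j w => coef h j * e j w)
    (fun j => (l j ^+ 2 + ip (e j) h ^+ 2) / 2) ((B + ip h h) / 2)).
  - by move=> j; apply: integrableZR; exact: L2_int.
  - move=> j; rewrite (le_trans _ (coef_l1 h j))//.
    under eq_Rintegral do rewrite normrM.
    rewrite RintegralZl//; last exact: integrable_norm (L2_int (Le j)).
    by rewrite ler_piMr ?e_l1.
  - move=> n; rewrite -mulr_suml ler_wpM2r// big_split/=.
    by apply: lerD; [exact: lB|exact: bessel].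
apply: filterS => w /cvg_ex[/= x hx].
by rewrite /quad_op (limfunE hx).
Qed.

Let coef_l2 h : L2 h -> forall n, \sum_(j < n) coef h j ^+ 2 <= B * ip h h.
Proof.
move=> lh n; apply: (@le_trans _ _ (\sum_(j < n) l j ^+ 2 * ip h h)).
  apply: ler_sum => j _; rewrite exprMn ler_wpM2l ?sqr_ge0//.
  by rewrite (le_trans (ip_cauchy_schwarz (Le j) lh))// ne mul1r.
by rewrite -mulr_suml ler_wpM2r// ip_ge0.
Qed.

Let psum_S h n : S (fun w => \sum_(j < n) (l j * ip (e j) h) * e j w).
Proof. by case: gS => lS _ _; apply: linear_set_sum. Qed.

Let quad_op_cauchy h : L2 h -> forall eps, 0 < eps ->
  exists N, forall m n, (N <= m)%N -> (N <= n)%N ->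
    dist2 P (fun w => \sum_(j < m) (l j * ip (e j) h) * e j w)
      (fun w => \sum_(j < n) (l j * ip (e j) h) * e j w) <= eps.
Proof.
move=> lh; apply: (@orth_series_cauchy _ _ _ P e Le oe (coef h) 1 (B * ip h h)) => //.
  by move=> j; rewrite ne.
exact: coef_l2.
Qed.

Let measurable_quad_op h : measurable_fun [set: T] (quad_op h).
Proof.
apply: measurable_limfun => n; case: gS => _ SL _.
by case: (SL _ (psum_S h n)).
Qed.

Lemma quad_op_H h : L2 h -> H (quad_op h).
Proof.
move=> lh; apply: (L2closure_lim gS (psum_S h)) => //; first exact: quad_op_ae.
exact: quad_op_cauchy.
Qed.

Lemma quad_op_ip h Y : L2 h -> L2 Y ->
  (\sum_(j < n) l j * ip (e j) h * ip (e j) Y) @[n --> \oo] --> ip (quad_op h) Y.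
Proof.
move=> lh lY; case: gS => _ SL _.
have lS n := SL _ (psum_S h n).
have [lA dA] := L2_fatou lS (measurable_quad_op h) (quad_op_ae lh) (quad_op_cauchy lh).
have := ip_cvg lS lA lY dA.
by under eq_fun do rewrite ip_suml//.
Qed.

Lemma quad_op_sym h Y : L2 h -> L2 Y -> ip (quad_op h) Y = ip (quad_op Y) h.
Proof.
move=> lh lY; have c1 := quad_op_ip lh lY; have c2 := quad_op_ip lY lh.
rewrite (_ : (fun n => \sum_(j < n) l j * ip (e j) Y * ip (e j) h) =
  (fun n => \sum_(j < n) l j * ip (e j) h * ip (e j) Y)) in c2.
  exact: (cvg_unique _ c1 c2).
by apply/funext => n; apply: eq_bigr => j _; rewrite mulrAC.
Qed.

Variable F : T -> R.
Hypothesis mF : measurable_fun [set: T] F.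
Hypothesis cF : {ae P, forall w, (\sum_(j < n) l j * (e j w ^+ 2 - 1)) @[n --> \oo] --> F w}.

Let He j : H (e j). Proof. exact: sub_L2closure. Qed.

Let chaosE n : (fun w => \sum_(j < n) l j * (e j w ^+ 2 - 1)) =
  (fun w => \sum_(j < n) l j * chaos P (e j) w).
Proof.
by apply/funext => w; apply: eq_bigr => j _; rewrite /chaos ne.
Qed.

(** Chaos elements of orthogonal unit variables are orthogonal with squared norm 2, so the partial
    sums are Cauchy in mean square; the given almost sure limit must be their mean-square limit. *)
Lemma quad_form_L2 : L2 F /\
  dist2 P (fun w => \sum_(j < n) l j * (e j w ^+ 2 - 1)) F @[n --> \oo] --> (0 : R).
Proof.
have lC j : L2 (chaos P (e j)) by apply: (L2_chaos gH).
apply: L2_fatou => //.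
  by move=> n; rewrite chaosE; exact: L2_sum.
move=> eps eps0.
have oC j j' : j <> j' -> ip (chaos P (e j)) (chaos P (e j')) = 0.
  by move=> jj'; rewrite (gaussian_chaos gH)// oe// expr0n mulr0.
have [||N hN] := @orth_series_cauchy _ _ _ P _ lC oC l 2 B _ _ lB eps eps0 => //.
  by move=> j; rewrite (gaussian_chaos gH)// ne expr1n mulr1.
by exists N => m n Nm Nn; rewrite !chaosE; exact: hN.
Qed.

(** The link between [F] and its form: pairing with chaos elements recovers the diagonal values of
    the form, term by term from [gaussian_chaos]. *)
Lemma quad_form_chaos Y : H Y -> ip F (chaos P Y) = 2 * ip (quad_op Y) Y.
Proof.
move=> HY; have lY := HL2 HY; have [lF dF] := quad_form_L2.
have lC j : L2 (chaos P (e j)) by apply: (L2_chaos gH).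
have lCY : L2 (chaos P Y) by apply: (L2_chaos gH).
have lS n : L2 (fun w => \sum_(j < n) l j * (e j w ^+ 2 - 1)).
  by rewrite chaosE; exact: L2_sum.
have c1 := ip_cvg lS lF lCY dF.
have c2 : 2 * (\sum_(j < n) l j * ip (e j) Y * ip (e j) Y) @[n --> \oo] --> 2 * ip (quad_op Y) Y.
  by apply: cvgM; [exact: cvg_cst|exact: quad_op_ip].
rewrite (_ : (fun n => ip _ _) = (fun n => 2 * (\sum_(j < n) l j * ip (e j) Y * ip (e j) Y))) in c1.
  exact: (cvg_unique _ c1 c2).
apply/funext => n; rewrite chaosE ip_suml// mulr_sumr; apply: eq_bigr => j _.
by rewrite (gaussian_chaos gH)//; ring.
Qed.

End quadratic_operator.

(** * Linear algebra *)

Section spectral.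
Context {R : rcfType}.
Import complex.

(** Take a complex eigenvector [x + i y] with eigenvalue [z]. Comparing [x S y^T] with [y S x^T]
    gives [Im z * (|x|^2 + |y|^2) = 0], so [z] is real and whichever of [x], [y] is nonzero is a
    real eigenvector. *)
Lemma sym_eigenvector n (S : 'M[R]_n.+1) : S^T = S ->
  exists (a : R) (v : 'rV[R]_n.+1), v != 0 /\ v *m S = a *: v.
Proof.
move=> Ssym; pose C := (R[i])%C; pose Sc : 'M[C]_n.+1 := map_mx (real_complex R) S.
have : size (char_poly Sc) != 1 by rewrite size_char_poly.
case/closed_rootP => z; rewrite -eigenvalue_root_char => /eigenvalueP[w wS w0].
pose x : 'rV[R]_n.+1 := \row_j Re (w 0 j).
pose y : 'rV[R]_n.+1 := \row_j Im (w 0 j).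
have ReD (I : finType) (F : I -> C) : Re (\sum_i F i) = \sum_i Re (F i).
  by apply: (big_morph (fun z : C => Re z)) => [[a b] [a' b']|].
have ImD (I : finType) (F : I -> C) : Im (\sum_i F i) = \sum_i Im (F i).
  by apply: (big_morph (fun z : C => Im z)) => [[a b] [a' b']|].
have xS : x *m S = Re z *: x - Im z *: y.
  apply/rowP => l; move/rowP : wS => /(_ l); rewrite !mxE => /(congr1 (fun z : C => Re z)).
  rewrite ReD; under eq_bigr do rewrite !mxE.
  case: z => a b; case: (w 0 l) => p q /= <-.
  by apply: eq_bigr => j _; rewrite !mxE; case: (w 0 j) => u v /=; rewrite mulr0 subr0.
have yS : y *m S = Im z *: x + Re z *: y.
  clear xS.
  apply/rowP => l; move/rowP : wS => /(_ l); rewrite !mxE => /(congr1 (fun z : C => Im z)).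
  rewrite ImD; under eq_bigr do rewrite !mxE.
  case: z => a b; case: (w 0 l) => p q /=; rewrite addrC => <-.
  by apply: eq_bigr => j _; rewrite !mxE; case: (w 0 j) => u v /=; rewrite mulr0 add0r.
pose q (u : 'rV[R]_n.+1) := (u *m u^T) 0 0.
have qE u : q u = \sum_j u 0 j ^+ 2.
  by rewrite /q mxE; apply: eq_bigr => j _; rewrite mxE expr2.
have q0 u : 0 <= q u by rewrite qE sumr_ge0// => j _; exact: sqr_ge0.
have qeq0 u : q u = 0 -> u = 0.
  rewrite qE => /eqP; rewrite psumr_eq0; last by move=> j _; exact: sqr_ge0.
  move=> /allP h; apply/rowP => j; rewrite mxE.
  by have := h j (mem_index_enum j); rewrite /= sqrf_eq0 => /eqP.
have sym : (x *m S *m y^T) 0 0 = (y *m S *m x^T) 0 0.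
  have -> : x *m S *m y^T = (y *m S *m x^T)^T by rewrite !trmx_mul trmxK Ssym mulmxA.
  by rewrite mxE.
have xy : (x *m y^T) 0 0 = (y *m x^T) 0 0.
  have -> : x *m y^T = (y *m x^T)^T by rewrite trmx_mul trmxK.
  by rewrite mxE.
have Iz : Im z * (q x + q y) = 0.
  move: sym; rewrite xS yS mulmxBl mulmxDl -!scalemxAl !mxE -!/(q _).
  have -> : \sum_j x 0 j * y^T j 0 = (x *m y^T) 0 0 by rewrite mxE.
  have -> : \sum_j y 0 j * x^T j 0 = (y *m x^T) 0 0 by rewrite mxE.
  have -> : \sum_j x 0 j * x^T j 0 = q x by rewrite /q mxE.
  have -> : \sum_j y 0 j * y^T j 0 = q y by rewrite /q mxE.
  by rewrite xy => /eqP; rewrite -subr_eq0 => /eqP h; lra.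
have qxy : q x + q y != 0.
  apply/eqP => h; have qx : q x = 0 by apply/eqP; rewrite eq_le q0 andbT; have := q0 y; lra.
  have qy : q y = 0 by lra.
  move: w0; apply/negP; rewrite negbK; apply/eqP/rowP => j; rewrite mxE.
  have := congr1 (fun u : 'rV_n.+1 => u 0 j) (qeq0 _ qx).
  have := congr1 (fun u : 'rV_n.+1 => u 0 j) (qeq0 _ qy).
  by rewrite !mxE; case: (w 0 j) => a b /= -> ->.
have {Iz} z0 : Im z = 0.
  by move/eqP : Iz; rewrite mulf_eq0 (negbTE qxy) orbF => /eqP.
rewrite z0 !scale0r subr0 add0r in xS yS.
exists (Re z); have [x0|x0] := eqVneq x 0; last by exists x.
exists y; split => //; apply: contra qxy => /eqP ->.
by rewrite x0 /q !mul0mx mxE addr0.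
Qed.

(* Householder reflection *)
Lemma orthogonal_first_row n (v : 'rV[R]_(1 + n)) : v *m v^T = 1%:M ->
  exists Q : 'M[R]_(1 + n), [/\ Q *m Q^T = 1%:M, Q^T *m Q = 1%:M &
    (delta_mx 0 0 : 'rV_(1 + n)) *m Q = v].
Proof.
move=> v1; pose e : 'rV[R]_(1 + n) := delta_mx 0 0.
have [->|ve] := eqVneq v e; first by exists 1%:M; rewrite trmx1 !mulmx1.
have ee : e *m e^T = 1%:M.
  by rewrite /e trmx_delta mul_delta_mx; apply/matrixP => i j; rewrite !ord1 !mxE.
have [u ue] : exists u, u = v - e by exists (v - e).
pose b := v 0 0.
have ve0 : v *m e^T = b%:M.
  apply/matrixP => i j; rewrite !ord1 /e trmx_delta !mxE (bigD1 0)//= big1 => [|l /negbTE l0].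
    by rewrite !mxE !eqxx mulr1 addr0.
  by rewrite !mxE l0 mulr0.
have ev : e *m v^T = b%:M by rewrite -[LHS]trmxK trmx_mul trmxK ve0 tr_scalar_mx.
have uu : u *m u^T = (2 - 2 * b)%:M.
  rewrite ue linearB/= mulmxBl !mulmxBr v1 ee ve0 ev.
  by apply/matrixP => i j; rewrite !ord1 !mxE /=; ring.
have u0 : 2 - 2 * b != 0.
  apply: contra ve => /eqP h; rewrite h in uu.
  have : \sum_j u 0 j ^+ 2 = 0.
    have E : (u *m u^T) 0 0 = 0 by rewrite uu mxE mul0rn.
    by rewrite -[RHS]E mxE; apply: eq_bigr => j _; rewrite [u^T _ _]mxE expr2.
  move=> /eqP; rewrite psumr_eq0; last by move=> j _; exact: sqr_ge0.
  move=> /allP h'; rewrite -subr_eq0 -ue; apply/eqP/rowP => j; rewrite [RHS]mxE.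
  by have := h' j (mem_index_enum j); rewrite /= sqrf_eq0 => /eqP.
pose c := 2 / (2 - 2 * b).
pose Q := 1%:M - c *: (u^T *m u).
have Qt : Q^T = Q by rewrite /Q linearB/= linearZ/= trmx_mul trmxK trmx1.
have QQ : Q *m Q = 1%:M.
  rewrite /Q mulmxBl mul1mx mulmxBr mulmx1 -scalemxAl -!scalemxAr mulmxA.
  rewrite -[u^T *m u *m u^T]mulmxA uu mul_mx_scalar -scalemxAl !scalerA.
  rewrite (_ : c * (c * (2 - 2 * b)) = c + c); last by rewrite /c; field.
  by rewrite scalerDl opprB addrK subrK.
exists Q; rewrite Qt QQ; split => //.
rewrite -/e /Q mulmxBr mulmx1 -scalemxAr mulmxA.
have -> : e *m u^T = (b - 1)%:M.
  rewrite ue linearB/= mulmxBr ev ee.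
  by apply/matrixP => i j; rewrite !ord1 !mxE /=; ring.
rewrite mul_scalar_mx scalerA (_ : c * (b - 1) = -1); last first.
  by rewrite /c; field.
by rewrite scaleN1r opprK ue addrC subrK.
Qed.

(** An orthogonal [Q] whose first row is a unit eigenvector turns [S] into [Q S Q^T]; by symmetry
    this is block diagonal, and the induction applies to the lower block. *)
Lemma sym_spectral n (S : 'M[R]_n) : S^T = S ->
  exists (O : 'M[R]_n) (a : 'rV[R]_n),
    O *m O^T = 1%:M /\ S = O^T *m diag_mx a *m O.
Proof.
elim: n S => [|n IH] S Ssym.
  by exists 1%:M, 0; split; apply/matrixP => -[].
have [a [v' [v'0 v'S]]] := sym_eigenvector Ssym.
pose r := \sum_j v' 0 j ^+ 2.
have r0 : 0 < r.
  rewrite lt_neqAle sumr_ge0 ?andbT; last by move=> j _; exact: sqr_ge0.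
  apply: contra v'0 => /eqP /esym /eqP; rewrite psumr_eq0; last by move=> j _; exact: sqr_ge0.
  move=> /allP h; apply/eqP/rowP => j; rewrite mxE.
  by have := h j (mem_index_enum j); rewrite /= sqrf_eq0 => /eqP.
pose v : 'rV[R]_(1 + n) := (Num.sqrt r)^-1 *: v'.
have v1 : v *m v^T = 1%:M.
  rewrite /v linearZ/= -scalemxAl -scalemxAr scalerA -invfM -expr2 sqr_sqrtr ?ltW//.
  apply/matrixP => i j; rewrite !ord1 !mxE /=.
  rewrite (eq_bigr (fun j => v' 0 j ^+ 2)); last by move=> l _; rewrite mxE expr2.
  by rewrite -/r mulVf// gt_eqF.
pose S' : 'M[R]_(1 + n) := S.
have vS : v *m S' = a *: v.
  by rewrite /v -scalemxAl v'S !scalerA mulrC.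
have [Q [QQt QtQ eQ]] := orthogonal_first_row v1.
pose e : 'rV[R]_(1 + n) := delta_mx 0 0.
have [M MQ] : exists M : 'M[R]_(1 + n), M = Q *m S' *m Q^T by eexists.
have Msym : M^T = M by rewrite MQ !trmx_mul trmxK mulmxA [S'^T]Ssym.
have eM : e *m M = a *: e.
  rewrite MQ !mulmxA eQ vS -scalemxAl -eQ -mulmxA QQt mulmx1//.
have M0 j : M 0 j = a *+ (j == 0).
  move/rowP : eM => /(_ j).
  rewrite -rowE !mxE => ->; by rewrite eqxx /= mulr_natr.
have dsym : (drsubmx M)^T = drsubmx M by rewrite trmx_drsub Msym.
have [U' [a' [UU' Sd]]] := IH (drsubmx M) dsym.
have ME : M = block_mx a%:M 0 0 (drsubmx M).
  rewrite -[LHS]submxK; congr block_mx.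
  - by apply/matrixP => i j; rewrite !ord1 !mxE lshift0 M0.
  - apply/matrixP => i j; rewrite !ord1 !mxE lshift0 M0.
    by rewrite -(inj_eq val_inj).
  - apply/matrixP => i j; rewrite !ord1 !mxE lshift0 -Msym mxE M0.
    by rewrite -(inj_eq val_inj).
change (exists (O : 'M[R]_(1 + n)) (a : 'rV[R]_(1 + n)),
  O *m O^T = 1%:M /\ S' = O^T *m diag_mx a *m O).
exists (block_mx 1%:M 0 0 U' *m Q), (row_mx a%:M a'); split.
  rewrite trmx_mul mulmxA -[_ *m Q *m _]mulmxA QQt mulmx1.
  rewrite tr_block_mx !trmx0 trmx1 mulmx_block !mulmx0 !mul0mx !mulmx1 !addr0 add0r UU'.
  by rewrite -scalar_mx_block.
have SE : S' = Q^T *m M *m Q.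
  by rewrite MQ !mulmxA QtQ mul1mx -mulmxA QtQ mulmx1.
rewrite [LHS]SE ME Sd diag_mx_row trmx_mul tr_block_mx !trmx0 trmx1.
rewrite -!mulmxA; congr (_ *m _); rewrite !mulmxA; congr (_ *m _).
rewrite !mulmx_block !mulmx0 !mul0mx !mulmx1 !mul1mx !addr0 !add0r.
congr block_mx; rewrite ?mul0mx//.
by apply/matrixP => i j; rewrite !ord1 !mxE.
Qed.

End spectral.

(** * Minors and semicontinuity of the rank *)

Section minors.
Context {F : realFieldType}.

Lemma rank_minor m n (A : 'M[F]_(m, n)) : exists (f : 'I_(\rank A) -> 'I_m)
  (g : 'I_(\rank A) -> 'I_n), \det (mxsub f g A) != 0.
Proof.
pose f := maxrankfun A.
have rf : row_full (rowsub f A)^T.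
  by rewrite /row_full mxrank_tr; exact: maxrowsub_free.
exists f, (fullrankfun rf).
have := fullrowsub_unit rf; rewrite unitmxE unitfE -det_tr.
congr (\det _ != 0); apply/matrixP => i j; by rewrite !mxE.
Qed.

Lemma rank_eq_minor m n r (A : 'M[F]_(m, n)) : \rank A = r ->
  exists (f : 'I_r -> 'I_m) (g : 'I_r -> 'I_n), \det (mxsub f g A) != 0.
Proof. by move=> <-; exact: rank_minor. Qed.

Lemma minor_rank m n r (A : 'M[F]_(m, n)) (f : 'I_r -> 'I_m) (g : 'I_r -> 'I_n) :
  \det (mxsub f g A) != 0 -> (r <= \rank A)%N.
Proof.
move=> dA; have u : mxsub f g A \in unitmx by rewrite unitmxE unitfE.
rewrite -(mxrank_unit u).
have -> : mxsub f g A = rowsub f 1%:M *m A *m colsub g 1%:M.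
  rewrite mul_rowsub_mx mul1mx mulmx_colsub mulmx1.
  by apply/matrixP => i j; rewrite !mxE.
by rewrite (leq_trans (mxrankM_maxl _ _))// mxrankM_maxr.
Qed.

(** The numbers 1, ..., [size p] are too many to be all roots. *)
Lemma poly_nonroot (p : {poly F}) : p != 0 -> exists2 t, t != 0 & p.[t] != 0.
Proof.
move=> p0; pose s := [seq (i.+1)%:R : F | i <- iota 0 (size p)].
have us : uniq s.
  by rewrite map_inj_uniq ?iota_uniq// => i j /eqP; rewrite eqr_nat => /eqP[].
have [/allP h|] := boolP (all (root p) s).
  have : all (root p) s by exact/allP.
  by move=> /(max_poly_roots p0)/(_ us); rewrite size_map size_iota ltnn.
rewrite -has_predC => /hasP[t /mapP[i _ ->]] /=; rewrite rootE => pt.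
by exists i.+1%:R => //; rewrite pnatr_eq0.
Qed.

(** Lower semicontinuity of the rank in algebraic form: a maximal nonzero minor of [X] is the value
    at 0 of a polynomial in [t], which is therefore nonzero also at some [t != 0]. *)
Lemma rank_pencil m n r (X Y : 'M[F]_(m, n)) :
  (forall t, t != 0 -> (\rank (X + t *: Y)%R <= r)%N) -> (\rank X <= r)%N.
Proof.
move=> h; have [f [g dX]] := rank_minor X.
pose M : 'M[{poly F}]_(\rank X) :=
  map_mx polyC (mxsub f g X) + 'X *: map_mx polyC (mxsub f g Y).
have Mt t : (\det M).[t] = \det (mxsub f g (X + t *: Y)).
  rewrite -[LHS]/(horner_eval t (\det M)) -det_map_mx; congr (\det _).
  by apply/matrixP => i j; rewrite !mxE /= /horner_eval !hornerE.
have M0 : \det M != 0.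
  apply: contra dX => /eqP M0; have := Mt 0; rewrite M0 horner0 scale0r addr0.
  by move=> <-.
have [t t0] := poly_nonroot M0; rewrite Mt => /minor_rank h'.
exact: leq_trans h' (h t t0).
Qed.

End minors.

Section forms.
Context {R : realType} {T : Type}.
Variables (H : set (T -> R)) (k : nat) (B : 'I_k -> (T -> R) -> (T -> R) -> R).
Hypothesis lH : linear_set H.
Hypothesis Blin : forall i a x y z, H x -> H y -> H z ->
  B i (fun w => a * x w + y w) z = a * B i x z + B i y z.

Let M n h (e : 'I_n -> T -> R) : 'M[R]_(n, k) := \matrix_(p, i) B i h (e p).

(* Two applications of maximality of the rank [r] of [M h0 e0]: adding a row [y]
   does not increase it, and neither does perturbing [h0] to [h0 + t h]; dividing
   the added row by [t] and letting [t] tend to 0 gives the claim. *)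
Lemma locally_dependent_forms :
  (forall h (e : 'I_k -> T -> R), H h -> (forall p, H (e p)) -> \det (M h e) = 0) ->
  exists (a : 'I_k -> R) (h0 : T -> R), [/\ exists i, a i != 0, H h0,
    (forall y, H y -> \sum_i a i * B i h0 y = 0) &
    (forall y, H y -> (forall i, B i h0 y = 0) ->
      forall h, H h -> \sum_i a i * B i h y = 0)].
Proof.
move=> hdet.
pose Q r := `[< exists n (e : 'I_n -> T -> R) h, [/\ H h, forall p, H (e p) & \rank (M h e) = r] >].
have exQ : exists r, Q r.
  exists (\rank (M (cst 0) (fun _ : 'I_0 => cst 0))); apply/asboolP.
  by exists 0%N, (fun=> cst 0), (cst 0); split => //; case: lH.
have ubQ r : Q r -> (r <= k)%N.
  by move=> /asboolP[n [e [h [_ _ <-]]]]; exact: rank_leq_col.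
case: (ex_maxnP exQ ubQ) => r /asboolP[n [e0 [h0 [Hh0 He0 rk]]]] max.
have le m (e : 'I_m -> T -> R) h : H h -> (forall p, H (e p)) -> (\rank (M h e) <= r)%N.
  by move=> Hh He; apply: max; apply/asboolP; exists m, e, h.
(* Rank [k] would select [k] of the vectors [e0] with nonzero determinant, against [hdet]. The
   column selection [g] of the minor factors out as a matrix product, leaving all columns in their
   natural order. *)
have rk_k : (r < k)%N.
  rewrite ltn_neqAle (ubQ r) ?andbT; last by apply/asboolP; exists n, e0, h0.
  apply/eqP => rE; have [f [g dg]] := rank_eq_minor (etrans rk rE).
  have : \det (mxsub f id (M h0 e0)) != 0.
    have : mxsub f g (M h0 e0) = mxsub f id (M h0 e0) *m mxsub id g 1%:M.
      apply/matrixP => i j; rewrite !mxE (bigD1 (g j))//= big1 ?addr0.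
        by rewrite !mxE eqxx mulr1.
      by move=> l /negbTE lj; rewrite !mxE lj mulr0.
    move=> E; move: dg; rewrite E det_mulmx mulf_eq0 negb_or => /andP[].
    by [].
  have := hdet h0 (fun p => e0 (f p)) Hh0 (fun p => He0 (f p)).
  rewrite (_ : mxsub f id (M h0 e0) = M h0 (fun p => e0 (f p))) => [->|]; first by rewrite eqxx.
  by apply/matrixP => i j; rewrite !mxE.
pose M0 := M h0 e0.
have [a [a0 M0a]] : exists a : 'cV[R]_k, a != 0 /\ M0 *m a = 0.
  have : kermx M0^T != 0.
    by rewrite -mxrank_eq0 mxrank_ker mxrank_tr rk -lt0n subn_gt0.
  move=> /rowV0Pn[v /sub_kermxP vM v0]; exists v^T; split.
    by rewrite -(inj_eq trmx_inj) trmxK trmx0.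
  by apply: trmx_inj; rewrite trmx_mul trmxK vM trmx0.
pose ext m (e : 'I_m -> T -> R) y (p : 'I_(m + 1)) :=
  match fintype.split p with inl q => e q | inr _ => y end.
have extE m (e : 'I_m -> T -> R) y h :
    M h (ext m e y) = col_mx (M h e) (\row_i B i h y).
  apply/matrixP => p i; rewrite !mxE /ext.
  by case: (fintype.split p) => q; rewrite !mxE.
have Hext m (e : 'I_m -> T -> R) y : (forall p, H (e p)) -> H y -> forall p, H (ext m e y p).
  by move=> He Hy p; rewrite /ext; case: (fintype.split p).
have sub_a (y : 'rV[R]_k) : (\rank (col_mx M0 y) <= r)%N -> y *m a = 0.
  move=> hr; have : (y <= M0)%MS.
    have s1 : (M0 <= col_mx M0 y)%MS by rewrite -addsmxE addsmxSl.
    have : (col_mx M0 y <= M0)%MS by rewrite -(geq_leqif (mxrank_leqif_sup s1)) rk.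
    by apply: submx_trans; rewrite -addsmxE addsmxSr.
  by move=> /submxP[D ->]; rewrite -mulmxA M0a mulmx0.
have row_a (y : 'I_k -> R) : (\row_i y i) *m a = 0 -> \sum_i a i 0 * y i = 0.
  move=> /matrixP/(_ 0 0); rewrite !mxE => h; rewrite -[RHS]h.
  by apply: eq_bigr => i _; rewrite !mxE mulrC.
exists (fun i => a i 0), h0; split => //.
- move: a0 => /eqP a0; apply: contrapT => h; apply: a0; apply/colP => i.
  by rewrite mxE; apply/eqP; apply: contrapT => /negP ai; apply: h; exists i.
- move=> y Hy; apply: row_a; apply: sub_a; rewrite /M0 -extE; apply: le => //.
  exact: Hext.
- move=> y Hy y0 h Hh; apply: row_a; apply: sub_a.
  pose Y : 'M[R]_(n + 1, k) := col_mx (M h e0) 0.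
  apply: (@rank_pencil _ _ _ _ _ Y) => t t0.
  have Hht : H (fun w => t * h w + h0 w) by case: lH => _; exact.
  have := le _ _ _ Hht (Hext n e0 y He0 Hy); apply: leq_trans; rewrite extE.
  have -> : M (fun w => t * h w + h0 w) e0 = M0 + t *: M h e0.
    by apply/matrixP => p i; rewrite !mxE Blin// addrC.
  have -> : \row_i B i (fun w => t * h w + h0 w) y = t *: \row_i B i h y.
    by apply/rowP => i; rewrite !mxE Blin// y0 addr0.
  rewrite scale_col_mx scaler0 add_col_mx addr0 -!addsmxE.
  by rewrite (adds_eqmx (eqmx_refl _) (eqmx_scale _ t0)).
Qed.

End forms.

(** * Linearly dependent forms *)

Section gram_schmidt.
Context {R : realType} {d : measure_display} {T : measurableType d}.
Variable P : probability T R.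
Local Notation ip := (ip P).
Local Notation L2 := (L2 P).
Variable H : set (T -> R).
Hypothesis lH : linear_set H.
Hypothesis HL2 : forall X, H X -> L2 X.

Definition orthonormal n (w : 'I_n -> T -> R) :=
  forall l l', ip (w l) (w l') = (l == l')%:R.

Variable e : nat -> T -> R.
Hypothesis He : forall j, H (e j).
Hypothesis ne : forall j, ip (e j) (e j) = 1.
Hypothesis oe : forall j j', j <> j' -> ip (e j) (e j') = 0.

Let normalize x : H x -> ip x x != 0 -> exists c, c != 0 /\
  ip (fun w => c * x w) (fun w => c * x w) = 1.
Proof.
move=> Hx x0; have xp : 0 < ip x x by rewrite lt_neqAle eq_sym x0 ip_ge0.
exists (Num.sqrt (ip x x))^-1; split.
  by rewrite invr_eq0 gt_eqF// sqrtr_gt0.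
have lx := HL2 Hx; rewrite ipZl// ?ipZr//; last by apply: HL2; exact: linear_setZ.
by rewrite mulrA -invfM -expr2 sqr_sqrtr ?ip_ge0// mulVf.
Qed.

(** A combination of [n.+1] members of the orthonormal sequence [e] has to satisfy only [n] linear
    conditions. It supplies a fresh vector when Gram-Schmidt meets a dependent one. *)
Lemma orthonormal_extend n (w : 'I_n -> T -> R) : (forall l, H (w l)) ->
  exists y, [/\ H y, ip y y = 1 & forall l, ip y (w l) = 0].
Proof.
move=> Hw; pose G : 'M[R]_(n.+1, n) := \matrix_(j, l) ip (e j) (w l).
have : kermx G != 0.
  by rewrite -mxrank_eq0 mxrank_ker -lt0n subn_gt0 ltnS rank_leq_col.
move=> /rowV0Pn[z /sub_kermxP zG z0].
pose y := (fun t => \sum_(j < n.+1) z 0 j * e j t).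
have Hy : H y by apply: linear_set_sum.
have ly := HL2 Hy.
have yw l : ip y (w l) = 0.
  rewrite /y ip_suml//; [|by move=> j; exact: HL2|exact: HL2].
  move/rowP : zG => /(_ l); rewrite !mxE => h; rewrite -[RHS]h.
  by apply: eq_bigr => j _; rewrite mxE.
have yy : ip y y = \sum_(j < n.+1) z 0 j ^+ 2.
  rewrite {1}/y ip_suml//; [|by move=> j; exact: HL2].
  apply: eq_bigr => j _; rewrite /y ip_sumr//; [|by move=> i; exact: HL2|exact: HL2].
  rewrite (bigD1 j)//= big1 ?addr0; last first.
    move=> i ij; rewrite oe ?mulr0// => /val_inj ji.
    by rewrite ji eqxx in ij.
  by rewrite ne mulr1 expr2.
have y0 : ip y y != 0.
  rewrite yy; apply: contra z0; rewrite psumr_eq0; last by move=> j _; exact: sqr_ge0.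
  move=> /allP h; apply/eqP/rowP => j; rewrite mxE.
  by have := h j (mem_index_enum j); rewrite /= sqrf_eq0 => /eqP.
have [c [c0 yc]] := normalize Hy y0.
exists (fun t => c * y t); split => //; first exact: linear_setZ.
by move=> l; rewrite ipZl// ?yw ?mulr0//; exact: HL2.
Qed.

(** Exactly [n] orthonormal vectors result even if the [u p] are dependent, since a prescribed
    number of normal variables has to be produced. The expansion is stated through inner products
    because it holds only almost everywhere as an identity of functions. *)
Lemma gram_schmidt n (u : 'I_n -> T -> R) : (forall p, H (u p)) ->
  exists w : 'I_n -> T -> R, [/\ forall l, H (w l), orthonormal w &
    forall p Y, L2 Y -> ip (u p) Y = \sum_l ip (u p) (w l) * ip (w l) Y].
Proof.
elim: n u => [|n IH] u Hu.
  by exists u; split => //; move=> [].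
have [w [Hw ow uw]] := IH (fun p => u (lift ord0 p)) (fun p => Hu _).
pose x := u ord0; have Hx : H x := Hu _; have lx := HL2 Hx.
have lw l : L2 (w l) by exact: HL2.
pose s t := \sum_(l < n) ip x (w l) * w l t.
have Hs : H s by apply: linear_set_sum.
have ls := HL2 Hs.
pose r t := -1 * s t + x t.
have Hr : H r by case: lH => _; exact.
have lr := HL2 Hr.
have ipr Y : L2 Y -> ip x Y = ip r Y + \sum_(l < n) ip x (w l) * ip (w l) Y.
  by move=> lY; rewrite /r ip_lin// /s ip_suml//; ring.
have rw l : ip r (w l) = 0.
  have := ipr _ (lw l); rewrite (bigD1 l)//= big1 ?addr0; last first.
    by move=> j jl; rewrite ow (negbTE jl) mulr0.
  by rewrite ow eqxx mulr1 => /eqP; rewrite -subr_eq subrr eq_sym => /eqP.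
have [y [Hy yy yw ry]] : exists y, [/\ H y, ip y y = 1, forall l, ip y (w l) = 0 &
    forall Y, L2 Y -> ip r Y = ip r y * ip y Y].
  have [r0|r0] := eqVneq (ip r r) 0.
    have [y [Hy yy yw]] := orthonormal_extend Hw.
    exists y; split => // Y lY.
    by rewrite (ip_norm0 lr lY r0) (ip_norm0 lr (HL2 Hy) r0) mul0r.
  have [c [c0 rc]] := normalize Hr r0.
  have Hy : H (fun t => c * r t) by exact: linear_setZ.
  exists (fun t => c * r t); split => //.
    by move=> l; rewrite ipZl// rw mulr0.
  move=> Y lY; rewrite ipZr// ipZl//.
  have : c * (c * ip r r) = 1.
    by rewrite -[RHS]rc ipZl ?ipZr//; exact: HL2.
  by move=> h; rewrite -[LHS]mul1r -h; ring.
have ly := HL2 Hy.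
pose w' l := oapp w y (unlift ord0 l).
have w'0 : w' ord0 = y by rewrite /w' unlift_none.
have w'S l : w' (lift ord0 l) = w l by rewrite /w' liftK.
exists w'; split.
- by move=> l; case: (unliftP ord0 l) => [j|] ->; rewrite ?w'0 ?w'S.
- move=> l l'; case: (unliftP ord0 l) => [j|] ->; case: (unliftP ord0 l') => [j'|] ->.
  + by rewrite !w'S ow (inj_eq lift_inj).
  + by rewrite w'S w'0 ipC yw eq_sym (negbTE (neq_lift _ _)).
  + by rewrite w'S w'0 yw (negbTE (neq_lift _ _)).
  + by rewrite w'0 yy eqxx.
- move=> p Y lY; rewrite big_ord_recl w'0.
  under eq_bigr do rewrite w'S.
  case: (unliftP ord0 p) => [j|] ->.
    rewrite (uw j y)// big1 ?mul0r ?add0r; first exact: uw.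
    by move=> l _; rewrite (ipC P (w l)) yw mulr0.
  rewrite -/x ipr// (ipr y)// (ry Y)// [X in ip r y + X]big1 ?addr0//.
  by move=> l _; rewrite (ipC P (w l)) yw mulr0.
Qed.

End gram_schmidt.

Section dependent_case.
Context {R : realType} {d : measure_display} {T : measurableType d}.
Variable P : probability T R.
Local Notation ip := (ip P).
Local Notation L2 := (L2 P).
Variable S : set (T -> R).
Hypothesis gS : gaussian_space P S.
Local Notation H := (L2closure P S).
Variables (k : nat) (g : 'I_k.+1 -> nat -> T -> R) (lam : 'I_k.+1 -> nat -> R).
Variables (bd : 'I_k.+1 -> R) (F : 'I_k.+1 -> T -> R).
Hypothesis Sg : forall i j, S (g i j).
Hypothesis ng : forall i j, ip (g i j) (g i j) = 1.
Hypothesis og : forall i j j', j <> j' -> ip (g i j) (g i j') = 0.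
Hypothesis lamB : forall i n, \sum_(j < n) lam i j ^+ 2 <= bd i.
Hypothesis mF : forall i, measurable_fun [set: T] (F i).
Hypothesis cF : forall i, {ae P, forall w,
  (\sum_(j < n) lam i j * (g i j w ^+ 2 - 1)) @[n --> \oo] --> F i w}.

Let gH : gaussian_space P H. Proof. exact: gaussian_L2closure. Qed.
Let lH : linear_set H. Proof. by case: gH. Qed.
Let HL2 X : H X -> L2 X. Proof. by case: gH => _ h _; exact: h. Qed.
Let Hg i j : H (g i j). Proof. exact: sub_L2closure. Qed.

Definition form i x y := ip (quad_op P (g i) (lam i) x) y.

Lemma form_op i x : H x -> H (quad_op P (g i) (lam i) x).
Proof. by move=> /HL2 lx; exact: (quad_op_H gS (Sg i) (ng i) (@og i) (lamB i)). Qed.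

Lemma formC i x y : H x -> H y -> form i x y = form i y x.
Proof.
by move=> /HL2 lx /HL2 ly; exact: (quad_op_sym gS (Sg i) (ng i) (@og i) (lamB i)).
Qed.

(** [quad_op] is an upper limit, so linearity in the first variable is not visible; symmetry moves
    the sum to the second one, where the inner product is linear. *)
Lemma form_suml i n (c : 'I_n -> R) (x : 'I_n -> T -> R) y : (forall l, H (x l)) -> H y ->
  form i (fun w => \sum_(l < n) c l * x l w) y = \sum_(l < n) c l * form i (x l) y.
Proof.
move=> Hx Hy; rewrite formC//; last exact: linear_set_sum.
rewrite /form ip_sumr//; first by apply: eq_bigr => l _; rewrite -/(form i y (x l)) formC.
  by move=> l; exact: HL2.
exact/HL2/form_op.
Qed.

Lemma form_lin i a x y z : H x -> H y -> H z ->
  form i (fun w => a * x w + y w) z = a * form i x z + form i y z.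
Proof.
move=> Hx Hy Hz; rewrite formC//; last by case: lH => _; exact.
rewrite /form ipC ip_lin ?(ipC P x) ?(ipC P y); [|exact: HL2|exact: HL2|exact/HL2/form_op].
by rewrite -/(form i z x) -/(form i z y) (formC i Hz Hx) (formC i Hz Hy).
Qed.

Lemma dependent_case :
  (forall h (e : 'I_k.+1 -> T -> R), H h -> (forall p, H (e p)) ->
    \det (\matrix_(p, i) form i h (e p)) = 0) ->
  exists (eta : 'I_k -> T -> R) (a : 'I_k.+1 -> R) (b : 'I_k -> R),
    mutually_independent P eta /\
    (forall l, std_normal P (eta l)) /\
    (exists i, a i != 0) /\
    {ae P, forall w, \sum_(i < k.+1) a i * F i w =
                     \sum_(l < k) b l * (eta l w ^+ 2 - 1)}.
Proof.
move=> hdet.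
have [a [h0 [[i0 ai0] Hh0 ah0 hK]]] := locally_dependent_forms lH form_lin hdet.
pose u i := quad_op P (g i) (lam i) h0.
have Hu i : H (u i) by exact: form_op.
(* The vector [u i0] may be left out: as [a i0 != 0], the linear relation makes [form i0 h0] vanish
   wherever the other forms do. This saves one dimension and yields as many [eta] as the theorem
   allows. *)
have [w [Hw ow uw]] := gram_schmidt lH HL2 (Hg ord0) (ng ord0) (@og ord0)
  (fun p : 'I_k => Hu (lift i0 p)).
have lw l : L2 (w l) by exact: HL2.
have u0 y : H y -> (forall l, ip (w l) y = 0) -> forall i, form i h0 y = 0.
  move=> Hy wy; have h p : form (lift i0 p) h0 y = 0.
    rewrite /form -/(u _) uw; last exact: HL2.
    by apply: big1 => l _; rewrite wy mulr0.
  move=> i; case: (unliftP i0 i) => [p|] ->; first exact: h.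
  have := ah0 y Hy; rewrite (bigD1 i0)//= big1 ?addr0.
    by move=> /eqP; rewrite mulf_eq0 (negbTE ai0) => /eqP.
  move=> j ji0; case: (unliftP i0 j) => [p ->|jE]; first by rewrite h mulr0.
  by rewrite jE eqxx in ji0.
pose Ba x y := \sum_i a i * form i x y.
have BaC x y : H x -> H y -> Ba x y = Ba y x.
  by move=> Hx Hy; apply: eq_bigr => i _; rewrite formC.
have Ba0 x y : H x -> H y -> (forall l, ip (w l) y = 0) -> Ba x y = 0.
  by move=> Hx Hy wy; apply: hK => //; exact: u0.
pose M : 'M[R]_k := \matrix_(p, q) Ba (w p) (w q).
have Msym : M^T = M by apply/matrixP => p q; rewrite !mxE BaC.
have [U [b [UU Mspec]]] := sym_spectral Msym.
pose eta l : T -> R := fun t => \sum_p U l p * w p t.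
have Heta l : H (eta l) by apply: linear_set_sum.
have leta l : L2 (eta l) by exact: HL2.
have ipw x (c : 'I_k -> R) : H x ->
    ip (fun t => \sum_p c p * w p t) x = \sum_p c p * ip (w p) x.
  by move=> Hx; rewrite ip_suml//; exact: HL2.
have oeta l l' : ip (eta l) (eta l') = (l == l')%:R.
  move/matrixP : UU => /(_ l l'); rewrite !mxE => <-.
  rewrite {1}/eta ipw//; apply: eq_bigr => p _; rewrite mxE; congr (_ * _).
  rewrite ipC ipw// (bigD1 p)//= big1 ?addr0; first by rewrite ow eqxx mulr1.
  by move=> q qp; rewrite ow (negbTE qp) mulr0.
(* Split [x] into its projection [x'] on the span of [w] and the rest [x'']. [Ba0] kills every term
   containing [x''], and the spectral decomposition of [M] diagonalises the form on the span. *)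
have Baeta x : H x -> Ba x x = \sum_l b 0 l * ip (eta l) x ^+ 2.
  move=> Hx; pose c p := ip (w p) x; pose x' t := \sum_p c p * w p t.
  have Hx' : H x' by apply: linear_set_sum.
  pose x'' t := -1 * x' t + x t.
  have Hx'' : H x'' by case: lH => _; exact.
  have wx'' l : ip (w l) x'' = 0.
    rewrite ipC /x'' ip_lin; [|exact: HL2..|exact: lw].
    rewrite (ipC P x) -/(c l) /x' ipw// (bigD1 l)//= big1 ?addr0.
      by rewrite ow eqxx mulr1 mulN1r addNr.
    by move=> q qp; rewrite ow (negbTE qp) mulr0.
  have xE : x = (fun t => 1 * x' t + x'' t) by apply/funext => t; rewrite /x''; ring.
  have Ba1 y : H y -> Ba x y = Ba x' y + Ba x'' y.
    move=> Hy; rewrite /Ba -big_split/=; apply: eq_bigr => i _.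
    by rewrite {1}xE form_lin// mul1r mulrDr.
  rewrite (Ba1 x)// (BaC x'')// (Ba0 x x'')// addr0 (BaC x')// (Ba1 x')// (BaC x'')//.
  rewrite (Ba0 x' x'')// addr0.
  have Bl y (v : 'I_k -> R) : H y -> Ba (fun t => \sum_p v p * w p t) y =
      \sum_p v p * Ba (w p) y.
    move=> Hy; rewrite /Ba.
    transitivity (\sum_i \sum_p a i * (v p * form i (w p) y)).
      by apply: eq_bigr => i _; rewrite (@form_suml i k v w y Hw Hy) mulr_sumr.
    rewrite exchange_big/=; apply: eq_bigr => p _; rewrite mulr_sumr.
    by apply: eq_bigr => i _; rewrite mulrCA.
  have ME p q : Ba (w p) (w q) = \sum_l U l p * b 0 l * U l q.
    move/matrixP : Mspec => /(_ p q); rewrite mxE => ->.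
    by rewrite mul_mx_diag !mxE; apply: eq_bigr => l _; rewrite !mxE.
  rewrite /x' Bl//.
  transitivity (\sum_p \sum_q \sum_l b 0 l * ((U l p * c p) * (U l q * c q))).
    apply: eq_bigr => p _; rewrite BaC// Bl// mulr_sumr; apply: eq_bigr => q _.
    by rewrite ME !mulr_sumr; apply: eq_bigr => l _; ring.
  under eq_bigr do rewrite exchange_big/=.
  rewrite exchange_big/=; apply: eq_bigr => l _.
  rewrite /eta ipw// expr2 big_distrlr/= mulr_sumr; apply: eq_bigr => p _.
  by rewrite mulr_sumr.
(* [dif] is orthogonal to every chaos element, since both of its parts have the same form [Ba]. It
   is also a mean-square limit of combinations of chaos elements, hence orthogonal to itself and
   almost surely 0. *)
pose dif t := \sum_(i < k.+1) a i * F i t - \sum_(l < k) b 0 l * chaos P (eta l) t.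
have qF i := quad_form_L2 gS (Sg i) (ng i) (@og i) (lamB i) (mF i) (cF i).
have lF i : L2 (F i) by have [] := qF i.
have lC Y : H Y -> L2 (chaos P Y) by exact: L2_chaos gH _.
have lF' : L2 (fun t => \sum_(i < k.+1) a i * F i t) by exact: L2_sum.
have lE' : L2 (fun t => \sum_(l < k) b 0 l * chaos P (eta l) t).
  by apply: L2_sum => l; exact: lC.
have ldif : L2 dif by exact: L2_sub.
have ipdif Y : L2 Y -> ip dif Y = \sum_(i < k.+1) a i * ip (F i) Y -
    \sum_(l < k) b 0 l * ip (chaos P (eta l)) Y.
  move=> lY; rewrite /dif ip_subl// !ip_suml// => l; exact: lC.
have dif0 Y : H Y -> ip dif (chaos P Y) = 0.
  move=> HY; rewrite ipdif; last exact: lC.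
  under eq_bigr do
    rewrite (quad_form_chaos gS (Sg _) (ng _) (@og _) (lamB _) (mF _) (cF _) HY) mulrCA.
  rewrite -mulr_sumr -[X in 2 * X]/(Ba Y Y) Baeta//.
  under [X in _ - X]eq_bigr do rewrite (gaussian_chaos gH)// mulrCA.
  by rewrite -mulr_sumr subrr.
have dF i : ip (F i) dif = 0.
  have [_ dFi] := qF i.
  have lS n : L2 (fun t => \sum_(j < n) lam i j * (g i j t ^+ 2 - 1)).
    have -> : (fun t => \sum_(j < n) lam i j * (g i j t ^+ 2 - 1)) =
       (fun t => \sum_(j < n) lam i j * chaos P (g i j) t).
      by apply/funext => t; apply: eq_bigr => j _; rewrite /chaos ng.
    by apply: L2_sum => j; exact: lC.
  have c1 := ip_cvg lS (lF i) ldif dFi.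
  rewrite (_ : (fun n => ip _ dif) = (fun=> 0)) in c1.
    exact: (cvg_unique _ c1 (cvg_cst _)).
  apply/funext => n.
  have -> : (fun t => \sum_(j < n) lam i j * (g i j t ^+ 2 - 1)) =
     (fun t => \sum_(j < n) lam i j * chaos P (g i j) t).
    by apply/funext => t; apply: eq_bigr => j _; rewrite /chaos ng.
  rewrite ip_suml//; last by move=> j; exact: lC.
  by apply: big1 => j _; rewrite ipC dif0 ?mulr0.
have dd : ip dif dif = 0.
  rewrite ipdif// !big1 ?subr0//; last by move=> i _; rewrite dF mulr0.
  by move=> l _; rewrite ipC dif0 ?mulr0.
exists eta, a, (fun l => b 0 l); split; [|split; [|split]].
- apply: (gaussian_mutual_indep gH) => // l l' ll'.
  by rewrite oeta (negbTE ll').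
- by move=> l; apply: (gaussian_std_normal gH) => //; rewrite oeta eqxx.
- by exists i0.
- apply: filterS (ip_norm0_ae ldif dd) => t /eqP; rewrite /dif subr_eq0 => /eqP ->.
  by apply: eq_bigr => l _; rewrite /chaos oeta eqxx.
Qed.

End dependent_case.

(** * Nondegenerate forms *)

Lemma measurable_between {R : realType} {d : measure_display} {T : measurableType d}
  (f : T -> R) (x y : R) : measurable_fun [set: T] f ->
  measurable [set z | x <= f z <= y].
Proof.
move=> mf; have := mf measurableT `[x, y]%classic (measurable_itv _).
rewrite setTI; congr (measurable _); apply/seteqP; split => z /=;
by rewrite in_itv.
Qed.

Section decoupling.
Context {R : realType} {d : measure_display} {T : measurableType d}.
Variables (P : probability T R) (H : set (T -> R)).
Hypothesis gH : gaussian_space P H.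
Variable L : set (T -> R).
Hypothesis lL : linear_set L.
Hypothesis LH : L `<=` H.
Local Notation L' := (perp P H L).
Local Notation T1 := (g_sigma_algebraType (bset (trig L))).
Local Notation T2 := (g_sigma_algebraType (bset (trig L'))).

Let lL' : linear_set L'. Proof. exact: linear_perp. Qed.

Lemma measurable_span X : L X -> measurable_fun [set: T1] (X : T1 -> R).
Proof.
move=> LX _ A mA; rewrite setTI; apply: sub_sigma_algebra.
exact: bset_trig.
Qed.

Lemma measurable_perp X : L' X -> measurable_fun [set: T2] (X : T2 -> R).
Proof.
move=> LX _ A mA; rewrite setTI; apply: sub_sigma_algebra.
exact: bset_trig.
Qed.

Let bset1 (E : set T1) : measurable E -> bset (trig L) E.
Proof.
by rewrite measurable_g_measurableTypeE//; exact/bset_sigma_algebra/trig_algebra.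
Qed.

Let bset2 (E : set T2) : measurable E -> bset (trig L') E.
Proof.
by rewrite measurable_g_measurableTypeE//; exact/bset_sigma_algebra/trig_algebra.
Qed.

Let m1 : measurable_fun [set: T] (id : T -> T1).
Proof.
move=> _ A /bset1 bA; rewrite setTI preimage_id.
have bT : bset (trig L') set0 by exact/bset0/trig_algebra.
by have [] := gaussian_indep gH lL LH bA bT.
Qed.

Let m2 : measurable_fun [set: T] (id : T -> T2).
Proof.
move=> _ A /bset2 bA; rewrite setTI preimage_id.
have bT : bset (trig L) set0 by exact/bset0/trig_algebra.
by have [] := gaussian_indep gH lL LH bT bA.
Qed.

Let mdiag : measurable_fun [set: T] (fun w => (w, w) : T2 * T1).
Proof. exact: (measurable_fun_pair m2 m1). Qed.

(** Each [bset] is already a sigma-algebra, and independence says that the law of the diagonal map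
    agrees with the product law on rectangles, hence everywhere. A bound on all sections then
    integrates to a bound on the diagonal event; this replaces conditioning on the complement. *)
Lemma decouple_le (E : set (T2 * T1)) (c : R) : measurable E ->
  (forall w2, (P (xsection E w2 : set T) <= c%:E)%E) ->
  (P [set w | E (w, w)] <= c%:E)%E.
Proof.
move=> mE hE.
pose P1 := distribution P (mfun_of m1); pose P2 := distribution P (mfun_of m2).
pose Pd := distribution P (mfun_of mdiag).
have PdE A B : measurable A -> measurable B -> Pd (A `*` B) = (P2 A * P1 B)%E.
  move=> /bset2 bA /bset1 bB; rewrite /Pd /P2 /P1 /distribution /pushforward /=.
  have [_ _ h] := gaussian_indep gH lL LH bB bA.
  rewrite [RHS]muleC -[RHS]h; congr (P _).
  by apply/seteqP; split => w /= [].
have := @product_measure_unique _ _ T2 T1 R P2 P1 Pd PdE E mE.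
move=> E12; have E3 : (P2 \x P1)%E E = P [set w | E (w, w)] := E12.
rewrite -E3.
rewrite /product_measure1.
apply: (@le_trans _ _ (\int[P2]_x (cst c%:E x))%E).
  apply: ge0_le_integral => //.
  - exact: measurable_fun_xsection.
  - by move=> x _; apply: le_trans (hE x).
rewrite integral_cst// [X in (_ * X)%E](_ : _ = 1%E) ?mule1//.
exact: (probability_setT P).
Qed.

End decoupling.

Section estimates.
Context {R : realType}.

(** For a symmetric form, the increment is exactly the sum of the two half-gradients applied to
    [x - y], with no Taylor remainder to control. *)
Lemma quadratic_diff k (b : 'I_k -> 'I_k -> R) (c x y : 'I_k -> R) :
  (forall p q, b p q = b q p) ->
  (\sum_p \sum_q b p q * x p * x q + 2 * \sum_p c p * x p) -
  (\sum_p \sum_q b p q * y p * y q + 2 * \sum_p c p * y p) =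
  \sum_q ((\sum_p b q p * x p + c q) + (\sum_p b q p * y p + c q)) * (x q - y q).
Proof.
move=> bC.
have E (u v : 'I_k -> R) : \sum_q (\sum_p b q p * u p) * v q = \sum_p \sum_q b p q * u p * v q.
  rewrite exchange_big/=; apply: eq_bigr => q _; rewrite mulr_suml.
  by apply: eq_bigr => p _; rewrite bC.
have Es (u v : 'I_k -> R) : \sum_p \sum_q b p q * u p * v q = \sum_p \sum_q b p q * v p * u q.
  rewrite exchange_big/=; apply: eq_bigr => q _; apply: eq_bigr => p _.
  by rewrite bC mulrAC.
transitivity (\sum_q ((\sum_p b q p * x p) * x q - (\sum_p b q p * x p) * y q +
   ((\sum_p b q p * y p) * x q - (\sum_p b q p * y p) * y q) +
   (2 * (c q * x q) - 2 * (c q * y q)))); last first.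
  by apply: eq_bigr => q _; ring.
rewrite !big_split/= !sumrN !E (Es y x) -!mulr_sumr; ring.
Qed.

(* [N] is an approximate left inverse of both Jacobians, hence of their sum up to
   a factor 2, so [v] is controlled by the increment of the quadratic map. *)
Lemma approx_inverse_bound k (N Jx Jy : 'I_k -> 'I_k -> R) (v : 'I_k -> R) (nu del : R) :
  (0 < k)%N -> 0 <= nu -> 0 <= del -> (forall p i, `|N p i| <= nu) ->
  (forall i, `|\sum_q (Jx i q + Jy i q) * v q| <= del) ->
  (forall p q, `|\sum_i N p i * Jx i q - (p == q)%:R| <= (4 * k%:R)^-1) ->
  (forall p q, `|\sum_i N p i * Jy i q - (p == q)%:R| <= (4 * k%:R)^-1) ->
  \sum_p `|v p| <= k%:R ^+ 2 * nu * del.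
Proof.
move=> k0 nu0 del0 Nnu vd hx hy; set s := \sum_p `|v p|.
have k0' : 0 < k%:R :> R by rewrite ltr0n.
(* The tolerance [(4 * k)^-1] is chosen so that the error terms, summed over [q] and [p], contribute
   at most [s / 2] and are absorbed by the [2 * s] on the left. *)
pose E p q := (\sum_i N p i * Jx i q - (p == q)%:R) + (\sum_i N p i * Jy i q - (p == q)%:R).
have id p : 2 * v p = \sum_i N p i * (\sum_q (Jx i q + Jy i q) * v q) - \sum_q E p q * v q.
  have -> : \sum_i N p i * (\sum_q (Jx i q + Jy i q) * v q) =
      \sum_q (\sum_i N p i * Jx i q + \sum_i N p i * Jy i q) * v q.
    under eq_bigr do rewrite mulr_sumr.
    rewrite exchange_big/=; apply: eq_bigr => q _.
    rewrite -big_split/= mulr_suml; apply: eq_bigr => i _; ring.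
  rewrite -sumrB (bigD1 p)//= [X in _ + X]big1 ?addr0.
    by rewrite /E (_ : (p == p)%:R = 1 :> R) ?eqxx//; ring.
  move=> q qp; rewrite /E (_ : (p == q)%:R = 0 :> R); first by ring.
  by rewrite eq_sym (negbTE qp).
have b1 p : 2 * `|v p| <= k%:R * (nu * del) + (2 * k%:R)^-1 * s.
  have -> : 2 * `|v p| = `|2 * v p| by rewrite normrM ger0_norm.
  rewrite id (le_trans (ler_normB _ _))// lerD//.
    rewrite (le_trans (ler_norm_sum _ _ _))//.
    apply: (@le_trans _ _ (\sum_(i < k) nu * del)).
      by apply: ler_sum => i _; rewrite normrM ler_pM.
    by rewrite sumr_const card_ord mulr_natl.
  rewrite (le_trans (ler_norm_sum _ _ _))// mulr_sumr; apply: ler_sum => q _.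
  rewrite normrM ler_wpM2r// (le_trans (ler_normD _ _))//.
  rewrite (_ : (2 * k%:R)^-1 = (4 * k%:R)^-1 + (4 * k%:R)^-1); first exact: lerD.
  by field; rewrite gt_eqF.
have : \sum_(p < k) 2 * `|v p| <= \sum_(p < k) (k%:R * (nu * del) + (2 * k%:R)^-1 * s).
  by apply: ler_sum => p _; exact: b1.
rewrite -mulr_sumr -/s sumr_const card_ord -[X in _ <= X]mulr_natl mulrDr.
rewrite (_ : k%:R * ((2 * k%:R)^-1 * s) = s / 2); last by field; rewrite gt_eqF.
have : 0 <= k%:R ^+ 2 * nu * del by rewrite !mulr_ge0.
by rewrite expr2; nra.
Qed.

(** The density never exceeds its peak [1 / sqrt (2 pi)], which is below 1. *)
Lemma normal_prob_itv (a b : R) : a <= b -> (normal_prob 0 1 `[a, b] <= (b - a)%:E)%E.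
Proof.
move=> ab; rewrite /normal_prob.
apply: (@le_trans _ _ (\int[lebesgue_measure]_(x in `[a, b]) (cst 1%E x))%E).
  apply: ge0_le_integral => //.
  - by move=> x _; rewrite lee_fin normal_pdf_ge0.
  - apply/measurable_EFinP/measurable_funTS; exact: measurable_normal_pdf.
  - move=> x _; rewrite lee_fin (le_trans (normal_pdf_ub _ _ _))//.
    rewrite /normal_peak invf_le1 ?sqrtr_gt0.
      rewrite -[leLHS]sqrtr1 ler_wsqrtr// expr1n mul1r mulr2n.
      by have := pi_ge2 R; lra.
    by rewrite expr1n mul1r mulrn_wgt0// pi_gt0.
rewrite integral_cst//= mul1e lebesgue_measure_itv/=.
by case: ifP => //; rewrite lee_fin subr_ge0.
Qed.

Lemma normal_prob_set1 (a : R) : normal_prob 0 1 [set a] = 0%E.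
Proof.
apply/eqP; rewrite eq_le measure_ge0 andbT.
by have := normal_prob_itv (lexx a); rewrite subrr set_itv1.
Qed.

End estimates.

Lemma lee_prod_ord {R : realType} n (x : 'I_n -> \bar R) (c : R) : 0 <= c ->
  (forall p, 0 <= x p <= c%:E)%E -> (\prod_(p < n) x p <= (c ^+ n)%:E)%E.
Proof.
move=> c0; elim: n x => [|n IH] x hx; first by rewrite big_ord0 expr0.
rewrite big_ord_recl exprS EFinM; apply: lee_pmul.
- by case/andP : (hx ord0).
- by apply: prode_ge0 => p _; case/andP : (hx (lift ord0 p)).
- by case/andP : (hx ord0).
- exact: IH.
Qed.

Section cube.
Context {R : realType} {d : measure_display} {T : measurableType d}.
Variables (P : probability T R) (H : set (T -> R)).
Hypothesis gH : gaussian_space P H.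
Variables (k : nat) (e : 'I_k -> T -> R).
Hypothesis He : forall p, H (e p).
Hypothesis oe : forall p q, ip P (e p) (e q) = (p == q)%:R.

Definition fspan : set (T -> R) :=
  [set X | exists c : 'I_k -> R, X = (fun w => \sum_p c p * e p w)].

Lemma linear_fspan : linear_set fspan.
Proof.
split; first by exists (fun=> 0); apply/funext => w; rewrite big1// => p _; rewrite mul0r.
move=> a _ _ [c ->] [c' ->]; exists (fun p => a * c p + c' p).
apply/funext => w; rewrite mulr_sumr -big_split/=.
by apply: eq_bigr => p _; ring.
Qed.

Lemma fspan_sub : fspan `<=` H.
Proof. by case: gH => lH _ _ _ [c ->]; exact: linear_set_sum. Qed.

Lemma fspan_gen p : fspan (e p).
Proof.
exists (fun q => (q == p)%:R); apply/funext => w.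
rewrite (bigD1 p)//= eqxx mul1r big1 ?addr0// => q /negbTE ->.
by rewrite mul0r.
Qed.

Local Notation T1 := (g_sigma_algebraType (bset (trig fspan))).
Local Notation T2 := (g_sigma_algebraType (bset (trig (perp P H fspan)))).

Variables (b : 'I_k -> 'I_k -> 'I_k -> R) (C : 'I_k -> 'I_k -> T -> R) (r : 'I_k -> T -> R).
Hypothesis bC : forall i p q, b i p q = b i q p.
Hypothesis HC : forall i p, perp P H fspan (C i p).
Hypothesis mr : forall i, measurable_fun [set: T2] (r i : T2 -> R).

Let J i p (w2 w1 : T) := \sum_q b i p q * e q w1 + C i p w2.
Let G i (w2 w1 : T) := \sum_p \sum_q b i p q * e p w1 * e q w1 +
  2 * (\sum_p C i p w2 * e p w1) + r i w2.

Lemma cube_estimate (N : 'M[R]_k) (nu : R) (c : 'I_k -> R) (del : R) :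
  (0 < k)%N -> 0 <= nu -> 0 <= del -> (forall p i, `|N p i| <= nu) ->
  (P [set w | (forall i, (c i <= G i w w <= c i + del)%R) /\
    (forall p q, (`|\sum_i N p i * J i q w w - (p == q)%:R| <= (4 * k%:R)^-1)%R)]
   <= ((2 * (k%:R ^+ 2 * nu * del)) ^+ k)%:E)%E.
Proof.
move=> k0 nu0 del0 Nnu; set kap := k%:R ^+ 2 * nu * del.
have kap0 : 0 <= kap by rewrite !mulr_ge0.
pose E : set (T2 * T1) := [set z | (forall i, c i <= G i z.1 z.2 <= c i + del) /\
    (forall p q, `|\sum_i N p i * J i q z.1 z.2 - (p == q)%:R| <= (4 * k%:R)^-1)].
have me q : measurable_fun [set: T2 * T1] (fun z : T2 * T1 => e q z.2).
  apply: (measurableT_comp (f := (e q : T1 -> R))); last exact: measurable_snd.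
  by apply: measurable_span; [exact: linear_fspan|exact: fspan_gen].
have mC i q : measurable_fun [set: T2 * T1] (fun z : T2 * T1 => C i q z.1).
  apply: (measurableT_comp (f := (C i q : T2 -> R))); last exact: measurable_fst.
  by apply: (measurable_perp gH) => //; exact: fspan_sub.
have mJ i q : measurable_fun [set: T2 * T1] (fun z : T2 * T1 => J i q z.1 z.2).
  apply: measurable_funD => //; apply: measurable_sum => p.
  exact: measurable_funM.
have mG i : measurable_fun [set: T2 * T1] (fun z : T2 * T1 => G i z.1 z.2).
  apply: measurable_funD; last first.
    by apply: (measurableT_comp (f := (r i : T2 -> R))) => //; exact: measurable_fst.
  apply: measurable_funD.
    apply: measurable_sum => p; apply: measurable_sum => q.
    by apply: measurable_funM => //; exact: measurable_funM.
  apply: measurable_funM => //; apply: measurable_sum => p.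
  exact: measurable_funM.
have mE : measurable E.
  have -> : E = (\bigcap_(i in [set: 'I_k]) [set z | c i <= G i z.1 z.2 <= c i + del]) `&`
    (\bigcap_(i in [set: 'I_k * 'I_k]) [set z | - (4 * k%:R)^-1 <=
      \sum_l N i.1 l * J l i.2 z.1 z.2 - (i.1 == i.2)%:R <= (4 * k%:R)^-1]).
    apply/seteqP; split => z.
      move=> [h1 h2]; split; first by move=> i _; exact: h1.
      by move=> [p q] _ /=; rewrite -ler_norml; exact: h2.
    move=> [h1 h2]; split => [i|p q]; first exact: h1.
    by rewrite ler_norml; exact: (h2 (p, q)).
  apply: measurableI; apply: fin_bigcap_measurable => //.
  - by move=> i _; exact: measurable_between.
  - move=> [p q] _; apply: measurable_between; apply: measurable_funB => //.
    by apply: measurable_sum => l; exact: measurable_funM.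
apply: (decouple_le gH linear_fspan fspan_sub mE) => w2.
(* Once a point [x] of the section is fixed, every other point has all its coordinates within [kap]
   of those of [x]. The section thus lies in a product of intervals of length [2 * kap], with no
   need to locate the preimage of the cube. *)
have [[x Ex]|nE] := pselect (exists x, E (w2, x)); last first.
  rewrite (_ : xsection E w2 = set0).
    by rewrite measure0 lee_fin exprn_ge0// mulr_ge0.
  by apply/seteqP; split => y //; rewrite /xsection/= inE => Ey; apply: nE; exists y.
have mI p : measurable (e p @^-1` `[e p x - kap, e p x + kap]).
  case: gH => _ HL2 _; case: (HL2 _ (He p)) => + _ => /(_ measurableT).
  by rewrite -[X in measurable X]setTI; apply.
have sub : (xsection E w2 : set T) `<=`
    \bigcap_(p in [set: 'I_k]) (e p @^-1` `[e p x - kap, e p x + kap]).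
  move=> y; rewrite /xsection/= inE => Ey p _; rewrite /= in_itv/=.
  have : \sum_q `|e q x - e q y| <= kap.
    apply: (@approx_inverse_bound R k N (fun i q => J i q w2 x) (fun i q => J i q w2 y)) => //.
    - move=> i.
      rewrite -(@quadratic_diff R k (b i) (fun p => C i p w2) (e ^~ x) (e ^~ y))//.
      case: Ex Ey => hx _ [hy _]; have := hx i; have := hy i; rewrite /G /=.
      by rewrite ler_norml => /andP[? ?] /andP[? ?]; apply/andP; split; lra.
    - by case: Ex.
    - by case: Ey.
  move=> h; have : `|e p x - e p y| <= kap.
    by rewrite (le_trans _ h)// (bigD1 p)//= lerDl sumr_ge0.
  by rewrite ler_norml => /andP[? ?]; apply/andP; split; lra.
have mS : measurable (xsection E w2 : set T).
  have := @measurable_xsection _ _ T2 T1 E w2 mE.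
  rewrite measurable_g_measurableTypeE; last first.
    exact/bset_sigma_algebra/trig_algebra/linear_fspan.
  move=> bS.
  have b0 : bset (trig (perp P H fspan)) set0.
    by apply/bset0/trig_algebra; apply: linear_perp; [exact: gH|exact: fspan_sub].
  by have [] := gaussian_indep gH linear_fspan fspan_sub bS b0.
apply: (le_trans (le_measure P _ _ sub)); rewrite ?inE//.
  by apply: fin_bigcap_measurable.
have [_ mi] : mutually_independent P e.
  by apply: (gaussian_mutual_indep gH) => // p q pq; rewrite oe (negbTE pq).
have mitvs (p : 'I_k) : measurable (`[e p x - kap, e p x + kap]%classic : set R).
  exact: measurable_itv.
rewrite [leLHS](mi _ mitvs).
apply: lee_prod_ord; first by rewrite mulr_ge0.
move=> p; rewrite measure_ge0/=.
have [_ ->] : std_normal P (e p).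
  by apply: (gaussian_std_normal gH) => //; rewrite oe eqxx.
  apply: (le_trans (normal_prob_itv _)); first lra.
  by rewrite lee_fin; lra.
exact: measurable_itv.
Qed.

End cube.

Lemma cvg_prod_ord {R : realType} k (u : 'I_k -> nat -> R) (l : 'I_k -> R) :
  (forall i, u i n @[n --> \oo] --> l i) ->
  \prod_(i < k) u i n @[n --> \oo] --> \prod_(i < k) l i.
Proof.
elim: k u l => [|k IH] u l h.
  rewrite big_ord0; under eq_fun do rewrite big_ord0; exact: cvg_cst.
rewrite big_ord_recl; under eq_fun do rewrite big_ord_recl.
by apply: cvgM => //; apply: IH => i; exact: h.
Qed.

Lemma measure_bigsetU_seq {R : realType} {d : measure_display} {T : measurableType d}
  (mu : {measure set T -> \bar R}) (I : Type) (s : seq I) (F : I -> set T) :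
  (forall i, measurable (F i)) ->
  (mu (\big[setU/set0]_(i <- s) F i) <= \sum_(i <- s) mu (F i))%E.
Proof.
move=> mF; elim: s => [|i s IH]; first by rewrite !big_nil measure0.
rewrite !big_cons; apply: le_trans (leeD2l _ IH).
by apply: measureU2 => //; exact: bigsetU_measurable.
Qed.

(** * From small cubes to Lebesgue-null sets *)

Section null_sets.
Context {R : realType} {d : measure_display} {T : measurableType d}.
Variables (P : probability T R) (k : nat) (X : 'I_k -> T -> R) (V : set T) (K : R).
Hypothesis mX : forall i, measurable_fun [set: T] (X i).
Hypothesis mV : measurable V.
Hypothesis K0 : 0 <= K.
Hypothesis cubeP : forall (c : 'I_k -> R) (del : R), 0 < del ->
  (P ([set w | forall i, (c i <= X i w <= c i + del)%R] `&` V) <= ((K * del) ^+ k)%:E)%E.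

Let len (lo hi : k.-tuple R) i := Num.max 0 (tnth hi i - tnth lo i).

Let mall (S : 'I_k -> set T) : (forall i, measurable (S i)) ->
  measurable [set w | forall i, S i w].
Proof.
move=> mS; have -> : [set w | forall i, S i w] = \bigcap_(i in [set: 'I_k]) S i.
  by apply/seteqP; split => w h i; [move=> _; exact: h|exact: h].
exact: fin_bigcap_measurable.
Qed.

Lemma measurable_box lo hi :
  measurable [set w | box lo hi [tuple X i w | i < k]].
Proof.
have -> : [set w | box lo hi [tuple X i w | i < k]] =
    [set w | forall i, tnth lo i <= X i w <= tnth hi i].
  by apply/seteqP; split => w /= h i; have := h i; rewrite tnth_mktuple.
by apply: (mall (S := fun i => [set w | tnth lo i <= X i w <= tnth hi i])) => i;
  exact: measurable_between.
Qed.

(** Cover the box by a grid of cubes of side [del], with at most [len / del + 1] of them in each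
    direction. Multiplied by [K * del], this count gives [K * (len + del)] for each coordinate. *)
Let box_bound lo hi del : 0 < del ->
  (P ([set w | box lo hi [tuple X i w | i < k]] `&` V) <=
   (\prod_(i < k) (K * (len lo hi i + del)))%:E)%E.
Proof.
move=> del0; pose N i := (Num.truncn (len lo hi i / del)).+1.
(* A common bound on the grid sizes lets a single finite function type index the cells; a function
   that exceeds some [N i] indexes the empty set. *)
pose M := \max_(i < k) N i.
pose E (f : {ffun 'I_k -> 'I_M}) := [set w | forall i, (f i < N i)%N /\
  (tnth lo i + del * (f i)%:R <= X i w <= tnth lo i + del * (f i)%:R + del)%R] `&` V.
have len0 i : 0 <= len lo hi i by rewrite le_max lexx.
have mE f : measurable (E f).
  apply: measurableI => //.
  apply: (mall (S := fun i => [set w | (f i < N i)%N /\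
    (tnth lo i + del * (f i)%:R <= X i w <= tnth lo i + del * (f i)%:R + del)%R])) => i.
  case: (ltnP (f i) (N i)) => h; last first.
    rewrite (_ : mkset _ = set0)//; apply/seteqP; split => // w []; by [].
  have := measurable_between (tnth lo i + del * (f i)%:R) (tnth lo i + del * (f i)%:R + del) (mX i).
  by congr (measurable _); apply/seteqP; split => w /=; [split|case].
have cover : [set w | box lo hi [tuple X i w | i < k]] `&` V `<=`
    \big[setU/set0]_(f <- index_enum {ffun 'I_k -> 'I_M}) E f.
  move=> w [/= hw Vw].
  have hw' i : tnth lo i <= X i w <= tnth hi i by have := hw i; rewrite tnth_mktuple.
  have lenE i : len lo hi i = tnth hi i - tnth lo i.
    by rewrite /len max_r// subr_ge0; case/andP: (hw' i) => h1 h2; exact: le_trans h1 h2.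
  pose n i := Num.truncn ((X i w - tnth lo i) / del).
  have x0 i : 0 <= (X i w - tnth lo i) / del.
    by rewrite divr_ge0 ?(ltW del0)// subr_ge0; case/andP: (hw' i).
  have nN i : (n i < N i)%N.
    rewrite /n /N ltnS; apply: le_truncn.
    by rewrite lenE ler_wpM2r ?invr_ge0 ?(ltW del0)// lerD2r; case/andP: (hw' i).
  have nM i : (n i < M)%N by apply: leq_trans (nN i) _; exact: (leq_bigmax i).
  pose f := [ffun i => Ordinal (nM i)].
  have : E f w.
    split => // i; rewrite ffunE /=; split; first exact: nN.
    have /andP[h1 h2] := truncn_itv (x0 i); rewrite -/(n i) in h1 h2.
    move: h1 h2; rewrite ler_pdivlMr// ltr_pdivrMr// -natr1 mulrDl mul1r => h1 h2.
    by rewrite mulrC; apply/andP; split; lra.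
  move=> Ef; rewrite (bigD1_seq f)//= ?mem_index_enum ?index_enum_uniq//.
  by left.
apply: (@le_trans _ _ (P (\big[setU/set0]_(f <- index_enum {ffun 'I_k -> 'I_M}) E f))).
  apply: le_measure => //; rewrite inE.
  - by apply: measurableI => //; exact: measurable_box.
  - exact: bigsetU_measurable.
apply: (le_trans (measure_bigsetU_seq _ _ mE)).
apply: (@le_trans _ _ (\sum_(f : {ffun 'I_k -> 'I_M})
    (\prod_(i < k) (if (f i < N i)%N then K * del else 0))%:E)%E).
  apply: lee_sum => f _.
  have [h|/existsNP[i0 h]] := pselect (forall i, (f i < N i)%N).
    rewrite (eq_bigr (fun=> K * del)); last by move=> i _; rewrite h.
    rewrite prodr_const card_ord.
    apply: le_trans (cubeP (fun i => tnth lo i + del * (f i)%:R) del0).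
    apply: le_measure; rewrite ?inE//.
      apply: measurableI => //.
      by apply: (mall (S := fun i => [set w | (tnth lo i + del * (f i)%:R <=
        X i w <= tnth lo i + del * (f i)%:R + del)%R])) => i; exact: measurable_between.
    by move=> w [hw Vw]; split => // i; case: (hw i).
  rewrite (_ : E f = set0).
    rewrite measure0 lee_fin; apply: prodr_ge0 => i _.
    by case: ifP => // _; rewrite mulr_ge0// ltW.
  by apply/seteqP; split => // w [hw _]; case: (hw i0).
(* By distributivity, the sum over all grid functions of a product over coordinates is a product of
   one-dimensional counts. *)
rewrite sumEFin lee_fin -(bigA_distr_bigA (fun (i : 'I_k) (j : 'I_M) =>
  if (j < N i)%N then K * del else 0)).
apply: ler_prod => i _; apply/andP; split.
  by apply: sumr_ge0 => j _; case: ifP => // _; rewrite mulr_ge0// ltW.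
have NM : (N i <= M)%N by exact: (leq_bigmax i).
rewrite -big_mkcond/= -(big_ord_widen M (fun=> K * del) NM) sumr_const card_ord -mulr_natl.
rewrite mulrCA ler_wpM2l// /N -natr1 mulrDl mul1r lerD2r -ler_pdivlMr//.
by have /andP[] := truncn_itv (divr_ge0 (len0 i) (ltW del0)).
Qed.

Let box_bound0 lo hi : (P ([set w | box lo hi [tuple X i w | i < k]] `&` V) <=
   (K ^+ k * box_vol lo hi)%:E)%E.
Proof.
set p := P _; have pf : p \is a fin_num.
  by apply: fin_num_measure; apply: measurableI => //; exact: measurable_box.
rewrite -(fineK pf) lee_fin.
have cv : \prod_(i < k) (K * (len lo hi i + harmonic n)) @[n --> \oo] -->
    \prod_(i < k) (K * (len lo hi i + 0)).
  apply: cvg_prod_ord => i; apply: cvgM; first exact: cvg_cst.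
  by apply: cvgD; [exact: cvg_cst|exact: cvg_harmonic].
have -> : K ^+ k * box_vol lo hi = \prod_(i < k) (K * (len lo hi i + 0)).
  rewrite big_split/= prodr_const card_ord; congr (_ * _).
  by apply: eq_bigr => i _; rewrite addr0.
rewrite -(cvg_lim _ cv)//; apply: limr_ge; first by apply/cvg_ex; eexists; exact: cv.
apply: nearW => n; rewrite -lee_fin fineK//; apply: box_bound.
by rewrite /harmonic/= invr_gt0.
Qed.

Lemma null_of_cubes (A : set (k.-tuple R)) : measurable A -> lebesgue_null A ->
  P ((fun w => [tuple X i w | i < k]) @^-1` A `&` V) = 0%E.
Proof.
move=> mA nA.
have mXA : measurable ((fun w => [tuple X i w | i < k]) @^-1` A).
  have mf : measurable_fun [set: T] (fun w => [tuple X i w | i < k]).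
    apply/measurable_fun_tnthP => i.
    by rewrite (_ : _ \o _ = X i)//; apply/funext => w /=; rewrite tnth_mktuple.
  by rewrite -[_ @^-1` _]setTI; exact: mf.
apply/eqP; rewrite eq_le measure_ge0 andbT; apply/lee_addgt0Pr => eps eps0.
rewrite add0e.
have K1 : 0 < K ^+ k + 1 by rewrite ltr_wpDl// exprn_ge0.
(* The added 1 keeps the denominator positive when [K ^+ k] is 0. *)
have [lo [hi [Acov vol]]] := nA (eps / (K ^+ k + 1)) (divr_gt0 eps0 K1).
pose B n := [set w | box (lo n) (hi n) [tuple X i w | i < k]] `&` V.
have mB n : measurable (B n) by apply: measurableI => //; exact: measurable_box.
have vol0 n : 0 <= box_vol (lo n) (hi n).
  by apply: prodr_ge0 => i _; rewrite le_max lexx.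
apply: (@le_trans _ _ (\sum_(n <oo) P (B n))%E).
  apply: measure_sigma_subadditive => //; first exact: measurableI.
  by move=> w [/= /Acov[n _ hn] Vw]; exists n.
apply: (@le_trans _ _ (\sum_(n <oo) ((K ^+ k)%:E * (box_vol (lo n) (hi n))%:E))%E).
  by apply: lee_nneseries => [n _ _|n _]; [exact: measure_ge0|rewrite -EFinM; exact: box_bound0].
rewrite nneseriesZl//; last by move=> n _; rewrite lee_fin.
apply: (@le_trans _ _ ((K ^+ k)%:E * (eps / (K ^+ k + 1))%:E)%E).
  by apply: lee_wpmul2l => //; rewrite lee_fin exprn_ge0.
rewrite -EFinM lee_fin mulrCA ler_piMr ?(ltW eps0)// ler_pdivrMr// mul1r.
by rewrite lerDl.
Qed.

End null_sets.

Lemma finite_roots {F : fieldType} (p : {poly F}) : p != 0 ->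
  exists s : seq F, forall x, root p x -> x \in s.
Proof.
have [n] := ubnP (size p); elim: n p => // n IH p; rewrite ltnS => pn p0.
have [[a pa]|h] := pselect (exists a, root p a); last first.
  by exists [::] => x px; exfalso; apply: h; exists x.
move: pa => /factor_theorem[q pE].
have q0 : q != 0 by apply: contra p0 => /eqP q0; rewrite pE q0 mul0r.
have [|s hs] := IH q _ q0.
  by move: pn; rewrite pE size_Mmonic ?monicXsubC// size_XsubC addn2/=.
exists (a :: s) => x; rewrite pE rootM root_XsubC inE => /orP[/hs ->|->//].
by rewrite orbT.
Qed.

(** Rational matrices are countable, so the sample points with invertible [D] are covered by
    countably many regions. The error is [(N - D^-1) D]; each entry of the first factor is at most
    [eps / s], and [s] dominates the column sums of [|D|]. *)
Lemma approx_left_inverse {R : realType} n (D : 'M[R]_n) (eps : R) : 0 < eps ->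
  \det D != 0 -> exists N : 'M[rat]_n,
    forall p q, `|\sum_i ratr (N p i) * D i q - (p == q)%:R| <= eps.
Proof.
move=> eps0 dD; have uD : D \in unitmx by rewrite unitmxE unitfE.
pose s := \sum_i \sum_q `|D i q| + 1.
have s0 : 0 < s by rewrite ltr_wpDl// sumr_ge0// => i _; rewrite sumr_ge0.
have ratP (x : R) : {q : rat | `|ratr q - x| <= eps / s}.
  apply: cid; have xy : x - eps / s < x + eps / s.
    by rewrite ltrD2l gtrN// divr_gt0.
  have [q] := rat_in_itvoo xy; rewrite in_itv/= => /andP[h1 h2].
  by exists q; rewrite ler_norml; apply/andP; split; lra.
exists (\matrix_(p, i) sval (ratP (invmx D p i))) => p q.
have -> : \sum_i ratr ((\matrix_(p, i) sval (ratP (invmx D p i))) p i) * D i q - (p == q)%:R =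
    \sum_i (ratr (sval (ratP (invmx D p i))) - invmx D p i) * D i q.
  have /matrixP/(_ p q) := mulVmx uD; rewrite !mxE => <-; rewrite -sumrB.
  by apply: eq_bigr => i _; rewrite mxE mulrBl.
rewrite (le_trans (ler_norm_sum _ _ _))//.
apply: (@le_trans _ _ (\sum_i eps / s * `|D i q|)).
  by apply: ler_sum => i _; rewrite normrM ler_wpM2r//; exact: (svalP (ratP _)).
rewrite -mulr_sumr -mulrA ler_piMr ?(ltW eps0)// mulrC ler_pdivrMr// mul1r /s.
apply: (@le_trans _ _ (\sum_i \sum_q `|D i q|)); last by rewrite lerDl.
by apply: ler_sum => i _; rewrite (bigD1 q)//= lerDl sumr_ge0.
Qed.

Lemma measurable_det {R : realType} {d : measure_display} {T : measurableType d} n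
  (D : 'I_n -> 'I_n -> T -> R) : (forall i p, measurable_fun [set: T] (D i p)) ->
  measurable_fun [set: T] (fun w => \det (\matrix_(i, p) D i p w)).
Proof.
move=> mD; rewrite /determinant.
apply: measurable_sum => s; apply: measurable_funM => //.
apply: measurable_prod => i _; under eq_fun do rewrite mxE.
exact: mD.
Qed.

Section random_det.
Context {R : realType} {d : measure_display} {T : measurableType d}.
Variables (P : probability T R) (H : set (T -> R)).
Hypothesis gH : gaussian_space P H.

(* Along the direction [h], the determinant is a polynomial with leading
   coefficient [det (ip (D i p) h)]. *)
Lemma random_det_neq0 n (D : 'I_n.+1 -> 'I_n.+1 -> T -> R) h :
  (forall i p, H (D i p)) -> H h ->
  \det (\matrix_(i, p) ip P (D i p) h) != 0 ->
  P.-negligible [set w | \det (\matrix_(i, p) D i p w) = 0].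
Proof.
move=> HD Hh dh; case: (gH) => lH HL2 _.
have lh := HL2 _ Hh.
have hh : ip P h h != 0.
  apply: contra dh => /eqP h0; rewrite (_ : \matrix_(i, p) _ = 0) ?det0//.
  by apply/matrixP => i p; rewrite !mxE ipC (ip_norm0 lh)//; exact: HL2.
have hp : 0 < ip P h h by rewrite lt_neqAle eq_sym hh ip_ge0.
pose c := (Num.sqrt (ip P h h))^-1.
have c0 : c != 0 by rewrite invr_eq0 gt_eqF// sqrtr_gt0.
pose u : T -> R := fun w => c * h w.
have Hu : H u by exact: linear_setZ.
have lu := HL2 _ Hu.
have uu : ip P u u = 1.
  by rewrite /u ipZl// ipZr// mulrA -invfM -expr2 sqr_sqrtr ?ip_ge0// mulVf.
pose b : 'M[R]_n.+1 := \matrix_(i, p) ip P (D i p) u.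
have db : \det b != 0.
  have -> : b = c *: \matrix_(i, p) ip P (D i p) h.
    by apply/matrixP => i p; rewrite !mxE /u ipZr//; exact: HL2.
  by rewrite detZ mulf_neq0// expf_neq0.
pose e := fun _ : 'I_1 => u.
pose L := fspan e.
have lL : linear_set L := linear_fspan e.
have LH : L `<=` H by apply: (fspan_sub gH).
have Lu : L u := fspan_gen e ord0.
(* The component of [D i p] orthogonal to [u]. With [D'] frozen, the entries are affine in the
   independent normal variable [u]. *)
pose D' i p w := - b i p * u w + D i p w.
have HD' i p : perp P H L (D' i p).
  split; first by case: lH => _; exact.
  have lD := HL2 _ (HD i p).
  have l' : L2 P (D' i p) by exact: L2_lin.
  move=> _ [a ->]; rewrite ip_sumr//.
  by apply: big1 => j _; rewrite /e /D' ip_lin// uu [b _ _]mxE; ring.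
pose T1 := g_sigma_algebraType (bset (trig L)).
pose T2 := g_sigma_algebraType (bset (trig (perp P H L))).
pose E : set (T2 * T1) :=
  [set z | \det (\matrix_(i, p) (D' i p z.1 + b i p * u z.2)) = 0].
have mE : measurable E.
  have := @measurable_det R _ _ n.+1 (fun i p (z : T2 * T1) =>
     D' i p z.1 + b i p * u z.2).
  move=> /(_ _)/Wrap[i p|].
    apply: measurable_funD.
      apply: (measurableT_comp (f := (D' i p : T2 -> R))); last exact: measurable_fst.
      exact: (measurable_perp gH LH).
    apply: measurable_funM => //.
    apply: (measurableT_comp (f := (u : T1 -> R))); last exact: measurable_snd.
    exact: measurable_span.
  move=> /(_ measurableT [set 0] (measurable_set1 0)).
  by rewrite setTI.
have Eu (r : R) : P (u @^-1` [set r]) = 0%E.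
  have [_ ->] : std_normal P u by apply: (gaussian_std_normal gH).
    exact: normal_prob_set1.
  exact: measurable_set1.
have mu1 (r : R) : measurable (u @^-1` [set r]).
  by case: lu => + _ => /(_ measurableT [set r] (measurable_set1 r)); rewrite setTI.
have PE : (P [set w | E (w, w)] <= 0%:E)%E.
  apply: (decouple_le gH lL LH mE) => w2.
  pose Dw : 'M[R]_n.+1 := \matrix_(i, p) D' i p w2.
  (* [det (Dw + x b)] is [det b] times the characteristic polynomial of [M] at [x]. The latter is
     monic, hence has finitely many roots, and [u] hits each of them with probability 0. *)
  pose M := - (invmx b *m Dw).
  have ub : b \in unitmx by rewrite unitmxE unitfE.
  have charE x : (char_poly M).[x] * \det b = \det (Dw + x *: b).
    rewrite /char_poly -[X in X * _]/(horner_eval x _) -det_map_mx mulrC -det_mulmx.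
    congr (\det _); rewrite /char_poly_mx map_mxB/= map_scalar_mx/= /horner_eval hornerX.
    rewrite (_ : map_mx _ (map_mx _ M) = M); last first.
      by apply/matrixP => i j; rewrite !mxE /= hornerC.
    rewrite mulmxBr mul_mx_scalar /M mulmxN opprK mulmxA mulmxV// mul1mx.
    by rewrite addrC.
  have [s hs] := finite_roots (monic_neq0 (char_poly_monic M)).
  have sub : (xsection E w2 : set T) `<=` \big[setU/set0]_(r <- s) (u @^-1` [set r]).
    move=> w1; rewrite /xsection/= inE => Ew.
    have rt : root (char_poly M) (u w1).
      rewrite rootE; have := charE (u w1).
      rewrite (_ : \det (Dw + u w1 *: b) = 0); last first.
        rewrite -[RHS]Ew; congr (\det _).
        by apply/matrixP => i j; rewrite !mxE mulrC.
      by move=> /eqP; rewrite mulf_eq0 (negbTE db) orbF.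
    have us := hs _ rt.
    by rewrite -bigcup_seq; exists (u w1).
  have mS : measurable (xsection E w2 : set T).
    have := measurable_xsection w2 mE.
    rewrite measurable_g_measurableTypeE; last exact/bset_sigma_algebra/trig_algebra.
    move=> bS.
    have b0 : bset (trig (perp P H L)) set0.
      by apply/bset0/trig_algebra; apply: (linear_perp gH).
    by have [] := gaussian_indep gH lL LH bS b0.
  apply: (@le_trans _ _ (P (\big[setU/set0]_(r <- s) (u @^-1` [set r])))).
    by apply: le_measure; rewrite ?inE//; exact: bigsetU_measurable.
  apply: (le_trans (measure_bigsetU_seq _ _ mu1)).
  by rewrite big1// => r _; exact: Eu.
have EE : [set w | \det (\matrix_(i, p) D i p w) = 0] = [set w | E (w, w)].
  apply/seteqP; split => w /=; rewrite /E/= => hw; rewrite -[RHS]hw; congr (\det _);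
  by apply/matrixP => i p; rewrite [LHS]mxE [RHS]mxE /D'; ring.
rewrite EE; apply/negligibleP; last first.
  by apply/eqP; rewrite eq_le PE/= measure_ge0.
rewrite -EE; have := @measurable_det R _ T n.+1 D (fun i p => proj1 (HL2 _ (HD i p))).
move=> /(_ measurableT [set 0] (measurable_set1 0)).
by rewrite setTI.
Qed.

End random_det.

Lemma ae_forall_fin {R : realType} {d : measure_display} {T : measurableType d}
  (P : probability T R) (I : finType) (Q : I -> T -> Prop) :
  (forall i, {ae P, forall w, Q i w}) -> {ae P, forall w, forall i, Q i w}.
Proof.
move=> hQ; suff : {ae P, forall w, forall i, i \in enum I -> Q i w}.
  by apply: filterS => w h i; apply: h; rewrite mem_enum.
elim: (enum I) => [|i s IH]; first by apply: aeW.
apply: filterS2 (hQ i) IH => w hi hs j; rewrite inE => /orP[/eqP ->//|].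
exact: hs.
Qed.

Lemma cvg_sum_ord {R : realType} k (u : 'I_k -> nat -> R) (l : 'I_k -> R) :
  (forall i, u i n @[n --> \oo] --> l i) ->
  \sum_(i < k) u i n @[n --> \oo] --> \sum_(i < k) l i.
Proof.
elim: k u l => [|k IH] u l h.
  rewrite big_ord0; under eq_fun do rewrite big_ord0; exact: cvg_cst.
rewrite big_ord_recl; under eq_fun do rewrite big_ord_recl.
by apply: cvgD => //; apply: IH => i; exact: h.
Qed.

(** * Absolute continuity when some determinant of the forms is nonzero *)

Section generic_case.
Context {R : realType} {d : measure_display} {T : measurableType d}.
Variable P : probability T R.
Local Notation ip := (ip P).
Local Notation L2 := (L2 P).
Variable S : set (T -> R).
Hypothesis gS : gaussian_space P S.
Local Notation H := (L2closure P S).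
Variables (k : nat) (g : 'I_k.+1 -> nat -> T -> R) (lam : 'I_k.+1 -> nat -> R).
Variables (bd : 'I_k.+1 -> R) (F : 'I_k.+1 -> T -> R).
Hypothesis Sg : forall i j, S (g i j).
Hypothesis ng : forall i j, ip (g i j) (g i j) = 1.
Hypothesis og : forall i j j', j <> j' -> ip (g i j) (g i j') = 0.
Hypothesis lamB : forall i n, \sum_(j < n) lam i j ^+ 2 <= bd i.
Hypothesis mF : forall i, measurable_fun [set: T] (F i).
Hypothesis cF : forall i, {ae P, forall w,
  (\sum_(j < n) lam i j * (g i j w ^+ 2 - 1)) @[n --> \oo] --> F i w}.

Local Notation form := (form P g lam).

Let gH : gaussian_space P H. Proof. exact: gaussian_L2closure. Qed.
Let lH : linear_set H. Proof. by case: gH. Qed.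
Let HL2 X : H X -> L2 X. Proof. by case: gH => _ h _; exact: h. Qed.
Let Hg i j : H (g i j). Proof. exact: sub_L2closure. Qed.
Let fC i x y : H x -> H y -> form i x y = form i y x.
Proof. exact: (formC gS Sg ng og lamB). Qed.
Let fH i x : H x -> H (quad_op P (g i) (lam i) x).
Proof. exact: (form_op gS Sg ng og lamB). Qed.

Section decomposition.
Variable e : 'I_k.+1 -> T -> R.
Hypothesis He : forall p, H (e p).
Hypothesis oe : forall p q, ip (e p) (e q) = (p == q)%:R.

Let D i p := quad_op P (g i) (lam i) (e p).
Let b i p q := form i (e p) (e q).
Let C i p : T -> R := fun w => -1 * (\sum_q b i p q * e q w) + D i p w.
Let g' i j : T -> R := fun w => -1 * (\sum_p ip (g i j) (e p) * e p w) + g i j w.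
(** The part of [F i] that depends on the components [g'] alone, and so is measurable for the
    sigma-algebra of the complement. The centring constant 1 is kept from [F i], although [g' i j]
    need not have unit norm. *)
Let r i := limfun (fun n w => \sum_(j < n) lam i j * (g' i j w ^+ 2 - 1)).

Let le p : L2 (e p). Proof. exact: HL2. Qed.

Let perp_of X (c : 'I_k.+1 -> R) : H X -> (forall q, c q = ip X (e q)) ->
  perp P H (fspan e) (fun w => -1 * (\sum_q c q * e q w) + X w).
Proof.
move=> HX cE; have Hs : H (fun w => \sum_q c q * e q w) by exact: linear_set_sum.
split; first by case: lH => _; exact.
have ls := HL2 Hs; have lX := HL2 HX.
move=> _ [a ->]; rewrite ip_sumr//; last exact: L2_lin.
apply: big1 => q _; rewrite ip_lin// ip_suml// (bigD1 q)//= big1 ?addr0.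
  by rewrite oe eqxx mulr1 cE mulN1r addNr mulr0.
by move=> p pq; rewrite oe (negbTE pq) mulr0.
Qed.

Let perpC i p : perp P H (fspan e) (C i p).
Proof. by apply: perp_of; [exact: fH|]. Qed.

Let perpg' i j : perp P H (fspan e) (g' i j).
Proof. by apply: perp_of; [exact: Hg|]. Qed.

Let measurable_r i : measurable_fun
  [set: g_sigma_algebraType (bset (trig (perp P H (fspan e))))] (r i).
Proof.
apply: measurable_limfun => n; apply: measurable_sum => j.
apply: measurable_funM => //; apply: measurable_funB => //; apply: measurable_funX.
exact: (measurable_perp gH (fspan_sub gH He) (perpg' i j)).
Qed.

Let measurable_rT i : measurable_fun [set: T] (r i).
Proof.
apply: measurable_limfun => n; apply: measurable_sum => j.
apply: measurable_funM => //; apply: measurable_funB => //; apply: measurable_funX.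
by have [/HL2[]] := perpg' i j.
Qed.

Let G i w := \sum_p \sum_q b i p q * e p w * e q w +
  2 * (\sum_p C i p w * e p w) + r i w.

(** In every partial sum, [g i j] is the sum of its projection on the [e p] and of [g' i j]; expand
    the square. The purely projected part and the cross terms converge by [quad_op_ip] and
    [quad_op_ae], so the remaining part converges too, and [r i] takes the right value. *)
Let FG_ae : {ae P, forall w, forall i, F i w = G i w}.
Proof.
have h0 i p : {ae P, forall w, (\sum_(j < n) (lam i j * ip (g i j) (e p)) * g i j w) @[n --> \oo]
    --> D i p w}.
  exact: (quad_op_ae gS (Sg i) (ng i) (@og i) (lamB i) (le p)).
have h1 : {ae P, forall w, forall z : 'I_k.+1 * 'I_k.+1,
    (\sum_(j < n) (lam z.1 j * ip (g z.1 j) (e z.2)) * g z.1 j w) @[n --> \oo]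
    --> D z.1 z.2 w}.
  by apply: ae_forall_fin => -[i p]; exact: h0.
have h2 : {ae P, forall w, forall i,
    (\sum_(j < n) lam i j * (g i j w ^+ 2 - 1)) @[n --> \oo] --> F i w}.
  exact: ae_forall_fin.
apply: filterS2 h1 h2 => w hD hF i.
have cb p q : (\sum_(j < n) lam i j * ip (g i j) (e p) * ip (g i j) (e q)) @[n --> \oo] --> b i p q.
  exact: (quad_op_ip gS (Sg i) (ng i) (@og i) (lamB i) (le p) (le q)).
have cD p := hD (i, p).
suff rE : r i w = F i w - (\sum_p \sum_q b i p q * e p w * e q w +
    2 * (\sum_p C i p w * e p w)) by rewrite /G rE addrC subrK.
apply: limfunE.
pose bn n p q := \sum_(j < n) lam i j * ip (g i j) (e p) * ip (g i j) (e q).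
pose Dn n p := \sum_(j < n) (lam i j * ip (g i j) (e p)) * g i j w.
rewrite (_ : (fun n => _) = (fun n => \sum_(j < n) lam i j * (g i j w ^+ 2 - 1) -
   (\sum_p \sum_q bn n p q * e p w * e q w +
    2 * (\sum_p (-1 * (\sum_q bn n p q * e q w) + Dn n p) * e p w)))); last first.
  apply/funext => n.
  have E1 : \sum_p \sum_q bn n p q * e p w * e q w =
      \sum_(j < n) lam i j * (\sum_p ip (g i j) (e p) * e p w) ^+ 2.
    rewrite /bn; under eq_bigr do under eq_bigr do rewrite !mulr_suml.
    under eq_bigr do rewrite exchange_big/=.
    rewrite exchange_big/=; apply: eq_bigr => j _.
    rewrite expr2 big_distrlr/= mulr_sumr; apply: eq_bigr => p _.
    by rewrite mulr_sumr; apply: eq_bigr => q _; ring.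
  have E2 : \sum_p (-1 * (\sum_q bn n p q * e q w) + Dn n p) * e p w =
      \sum_(j < n) lam i j * (\sum_p ip (g i j) (e p) * e p w) * g' i j w.
    rewrite (eq_bigr (fun p => - (\sum_q bn n p q * e p w * e q w) + Dn n p * e p w)); last first.
      move=> p _; rewrite mulrDl mulN1r mulNr mulr_suml; congr (- _ + _).
      by apply: eq_bigr => q _; ring.
    rewrite big_split/= sumrN E1.
    have -> : \sum_p Dn n p * e p w =
        \sum_(j < n) lam i j * (\sum_p ip (g i j) (e p) * e p w) * g i j w.
      rewrite /Dn; under eq_bigr do rewrite mulr_suml.
      rewrite exchange_big/=; apply: eq_bigr => j _.
      rewrite mulr_sumr mulr_suml; apply: eq_bigr => p _; ring.
    rewrite addrC -sumrB; apply: eq_bigr => j _; rewrite /g'; ring.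
  rewrite E1 E2 mulr_sumr -big_split/= -sumrB; apply: eq_bigr => j _.
  by rewrite /g'; ring.
have cbn p q : bn n p q @[n --> \oo] --> b i p q by exact: cb.
apply: cvgB; first exact: hF.
apply: cvgD.
  apply: cvg_sum_ord => p; apply: cvg_sum_ord => q.
  by apply: cvgM; [apply: cvgM => //|]; exact: cvg_cst.
apply: cvgM; first exact: cvg_cst.
apply: cvg_sum_ord => p; apply: cvgM; last exact: cvg_cst.
apply: cvgD; last exact: cD.
apply: cvgM; first exact: cvg_cst.
by apply: cvg_sum_ord => q; apply: cvgM => //; exact: cvg_cst.
Qed.

(** The sample points where [N] is a left inverse of the half-Jacobian [D] up to the tolerance of
    [approx_inverse_bound]. *)
Let region (N : 'M[R]_k.+1) : set T := [set w | forall p q,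
  `|\sum_i N p i * D i q w - (p == q)%:R| <= (4 * k.+1%:R)^-1].

Let measurable_region (N : 'M[R]_k.+1) : measurable (region N).
Proof.
have mD i q : measurable_fun [set: T] (D i q).
  by have /HL2[] : H (D i q) by exact: fH.
have -> : region N = \bigcap_(i in [set: 'I_k.+1 * 'I_k.+1]) [set z | - (4 * k.+1%:R)^-1 <=
    \sum_l N i.1 l * D l i.2 z - (i.1 == i.2)%:R <= (4 * k.+1%:R)^-1].
  apply/seteqP; split => z.
    by move=> h2 [p q] _ /=; rewrite -ler_norml; exact: h2.
  by move=> h2 p q; rewrite ler_norml; exact: (h2 (p, q)).
apply: fin_bigcap_measurable => //.
move=> [p q] _; apply: measurable_between; apply: measurable_funB => //.
by apply: measurable_sum => l; exact: measurable_funM.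
Qed.

Let region_null (N : 'M[R]_k.+1) (A : set (k.+1.-tuple R)) :
  measurable A -> lebesgue_null A ->
  P ((fun w => [tuple F i w | i < k.+1]) @^-1` A `&` region N) = 0%E.
Proof.
move=> mA nA; set V := region N.
pose nu := \sum_p \sum_i `|N p i|.
have nu0 : 0 <= nu by rewrite sumr_ge0// => p _; rewrite sumr_ge0.
have Nnu p i : `|N p i| <= nu.
  rewrite /nu (bigD1 p)//= (bigD1 i)//= -addrA lerDl addr_ge0 ?sumr_ge0// => q _.
  by rewrite sumr_ge0.
have mV : measurable V by exact: measurable_region.
have mG i : measurable_fun [set: T] (G i).
  have me p : measurable_fun [set: T] (e p) by case: (le p).
  apply: measurable_funD; last exact: measurable_rT.
  apply: measurable_funD.
    apply: measurable_sum => p; apply: measurable_sum => q.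
    by apply: measurable_funM => //; exact: measurable_funM.
  apply: measurable_funM => //; apply: measurable_sum => p.
  by apply: measurable_funM => //; have [/HL2[]] := perpC i p.
apply: (@null_of_cubes _ _ _ P k.+1 F V (2 * (k.+1%:R ^+ 2 * nu))) => //.
  by rewrite !mulr_ge0.
move=> c del del0.
(* [F] and [G] agree only outside the null set [Z], while the cube estimate is about [G]; adding [Z]
   to the event costs nothing. *)
have [Z [mZ Z0 hZ]] := FG_ae.
pose E := [set w | forall i, c i <= G i w <= c i + del] `&` V.
have mcube (Y : 'I_k.+1 -> T -> R) : (forall i, measurable_fun [set: T] (Y i)) ->
    measurable [set w | forall i, c i <= Y i w <= c i + del].
  move=> mY; have -> : [set w | forall i, c i <= Y i w <= c i + del] =
      \bigcap_(i in [set: 'I_k.+1]) [set w | c i <= Y i w <= c i + del].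
    by apply/seteqP; split => w h i; [move=> _; exact: h|exact: h].
  by apply: fin_bigcap_measurable => // i _; exact: measurable_between.
have mE : measurable E by apply: measurableI => //; exact: mcube.
apply: (@le_trans _ _ (P (E `|` Z))).
  apply: le_measure; rewrite ?inE.
  - by apply: measurableI => //; exact: mcube.
  - exact: measurableU.
  - move=> w [hw Vw]; have [Zw|nZ] := pselect (Z w); first by right.
    left; split => // i; have <- : F i w = G i w; last exact: hw.
    by apply: contrapT => h; apply: nZ; apply: hZ => /= h'; exact: h.
apply: (@le_trans _ _ (P E + P Z)%E); first exact: measureU2.
rewrite (_ : P Z = 0%E) ?adde0; last exact: Z0.
have := @cube_estimate _ _ _ P H gH k.+1 e He oe b C r _ perpC measurable_r N nu c del
  (ltn0Sn k) nu0 (ltW del0) Nnu.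
move=> /(_ (fun i p q => fC i (He p) (He q))).
rewrite (_ : (2 * (k.+1%:R ^+ 2 * nu) * del) = 2 * (k.+1%:R ^+ 2 * nu * del)); last by ring.
apply: le_trans; apply: le_measure; rewrite ?inE//.
  suff <- : E = [set w | (forall i, c i <= G i w <= c i + del) /\
    forall p q, `|\sum_i N p i * (\sum_q0 b i q q0 * e q0 w + C i q w) - (p == q)%:R| <=
      (4 * k.+1%:R)^-1] by [].
  apply/seteqP; split => w [h1 h2]; split => // p q; have := h2 p q;
  by (congr (`| _ - _| <= _); apply: eq_bigr => i _; rewrite /C; ring).
move=> w [h1 h2]; split => // p q; have := h2 p q.
by congr (`| _ - _| <= _); apply: eq_bigr => i _; rewrite /C; ring.
Qed.

Lemma decomposition_abs_continuous h : H h ->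
  \det (\matrix_(i, p) form i h (e p)) != 0 -> law_abs_continuous P F.
Proof.
move=> Hh dh A mA nA.
have mXA : measurable ((fun w => [tuple F i w | i < k.+1]) @^-1` A).
  have mf : measurable_fun [set: T] (fun w => [tuple F i w | i < k.+1]).
    apply/measurable_fun_tnthP => i.
    by rewrite (_ : _ \o _ = F i)//; apply/funext => w /=; rewrite tnth_mktuple.
  by rewrite -[_ @^-1` _]setTI; exact: mf.
have HD i p : H (D i p) by exact: fH.
have nD : P.-negligible [set w | \det (\matrix_(i, p) D i p w) = 0].
  apply: (random_det_neq0 gH HD Hh); apply: contra dh => /eqP <-; apply/eqP.
  by congr (\det _); apply/matrixP => i p; rewrite !mxE fC.
pose V (N : 'M[rat]_k.+1) := region (map_mx ratr N).
(* Enumeration of the rational matrices; integers that encode none are given the empty set. *)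
pose B n := if unpickle n is Some N then
  (fun w => [tuple F i w | i < k.+1]) @^-1` A `&` V N else set0.
have nB n : P.-negligible (B n).
  rewrite /B; case: (unpickle n) => [N|]; last exact: negligible_set0.
  have [mVN pVN] : measurable ((fun w => [tuple F i w | i < k.+1]) @^-1` A `&` V N) /\
      P ((fun w => [tuple F i w | i < k.+1]) @^-1` A `&` V N) = 0%E.
    by split; [exact/measurableI/measurable_region|exact: region_null].
  exact/negligibleP.
apply: measure_negligible => //.
apply: (negligibleS _ (negligibleU nD (negligible_bigcup nB))).
move=> w Aw; have [dw|dw] := eqVneq (\det (\matrix_(i, p) D i p w)) 0; first by left.
right; have eps0 : 0 < (4 * k.+1%:R)^-1 :> R by rewrite invr_gt0 mulr_gt0.
have [N hN] := approx_left_inverse eps0 dw.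
exists (pickle N) => //; rewrite /B pickleK; split => // p q.
have := hN p q; congr (`| _ - _| <= _); apply: eq_bigr => i _.
by rewrite !mxE.
Qed.

End decomposition.

(** The matrix for [e] is a matrix of Gram-Schmidt coordinates times the transposed matrix for the
    orthonormal [w], so a nonzero determinant for [e] forces one for [w]. *)
Lemma generic_case h (e : 'I_k.+1 -> T -> R) : H h -> (forall p, H (e p)) ->
  \det (\matrix_(p, i) form i h (e p)) != 0 -> law_abs_continuous P F.
Proof.
move=> Hh He de.
have [w [Hw ow ew]] := gram_schmidt lH HL2 (Hg ord0) (ng ord0) (@og ord0) He.
apply: (decomposition_abs_continuous Hw ow Hh).
apply: contra de => /eqP dw.
have -> : \matrix_(p, i) form i h (e p) =
    (\matrix_(p, l) ip (e p) (w l)) *m (\matrix_(i, p) form i h (w p))^T.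
  apply/matrixP => p i; rewrite !mxE /form ipC ew; last exact/HL2/fH.
  by apply: eq_bigr => l _; rewrite !mxE; congr (_ * _); exact: ipC.
by rewrite det_mulmx det_tr dw mulr0.
Qed.

End generic_case.

(** * Reading the hypotheses and concluding by the dichotomy *)

Lemma std_normal_moments {R : realType} {d : measure_display} {T : measurableType d}
  (P : probability T R) (X : T -> R) : std_normal P X ->
  \int[P]_w X w = 0 /\ ip P X X = 1.
Proof.
move=> [mX hX].
have s1 : 0 < (1 : R) by exact: ltr01.
split.
  have [||_ ->] := normal_transfer (f := id) mX hX; first exact: measurable_id.
    apply: eq_integrable (@integrable_normalX R 0 1 s1 1 isT) => // x _ /=.
    by rewrite expr1 subr0.
  exact: normal_mean.
have [||_] := normal_transfer (f := fun x => x ^+ 2) mX hX.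
- exact: measurable_funX.
- apply: eq_integrable (@integrable_normalX R 0 1 s1 2 isT) => // x _ /=.
  by rewrite subr0.
rewrite /ip; under eq_Rintegral do rewrite expr2.
move=> ->; transitivity (\int[normal_prob (0 : R) 1]_x ((x - 0) ^+ 2)).
  by apply: eq_Rintegral => x _; rewrite subr0.
rewrite normal_moment//; under eq_Rintegral do rewrite expr0.
by rewrite normal_total expr1n !mulr1.
Qed.

(** In dimension 0 every box has volume 1, the empty product, so no sequence of boxes has total
    volume at most one half, and no set at all is null. *)
Lemma lebesgue_null_dim0 {R : realType} (A : set (0.-tuple R)) :
  lebesgue_null A -> A = set0.
Proof.
move=> /(_ 2^-1)[//|lo [hi [_]]].
rewrite /box_vol; under eq_eseriesr do rewrite big_ord0.
move=> h; exfalso; move: h; apply/negP; rewrite -ltNge.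
apply: (@lt_le_trans _ _ (\sum_(0 <= i < 1) 1%:E)%E).
  by rewrite big_nat1 lte_fin invf_lt1// ltr1n.
by apply: nneseries_lim_ge => *; rewrite lee_fin.
Qed.

Lemma eseries_partial_le {R : realType} (u : nat -> R) : (forall n, 0 <= u n) ->
  (\sum_(n <oo) (u n)%:E < +oo)%E ->
  forall n, \sum_(j < n) u j <= fine (\sum_(n <oo) (u n)%:E)%E.
Proof.
move=> u0 uoo n; rewrite -lee_fin fineK; last first.
  by rewrite ge0_fin_numE// nneseries_ge0// => *; rewrite lee_fin.
rewrite -sumEFin -(big_mkord xpredT (fun j => (u j)%:E)).
by apply: nneseries_lim_ge => *; rewrite lee_fin.
Qed.

Theorem theorem1p1 (R : realType) (d : measure_display) (T : measurableType d)
  (P : probability T R) (k : nat)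
  (g : 'I_k -> nat -> T -> R)
  (lam : 'I_k -> nat -> R)
  (F : 'I_k -> T -> R) :
  jointly_gaussian P (fun ij : 'I_k * nat => g ij.1 ij.2) ->
  (forall i j, std_normal P (g i j)) ->
  (forall i j j', j <> j' -> ('E_P[(fun w => g i j w * g i j' w)%R] = 0)%E) ->
  (forall i, (\sum_(j <oo) ((lam i j) ^+ 2)%:E < +oo)%E) ->
  (forall i, measurable_fun [set: T] (F i)) ->
  (forall i, {ae P, forall w,
      (fun n => \sum_(j < n) lam i j * (g i j w ^+ 2 - 1)) @ \oo --> F i w}) ->
  ~ law_abs_continuous P F ->
  exists (eta : 'I_(k.-1) -> T -> R) (a : 'I_k -> R) (b : 'I_(k.-1) -> R),
    mutually_independent P eta /\
    (forall l, std_normal P (eta l)) /\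
    (exists i, a i != 0) /\
    {ae P, forall w, \sum_(i < k) a i * F i w =
                     \sum_(l < k.-1) b l * (eta l w ^+ 2 - 1)}.
Proof.
case: k g lam F => [|k'] g' lam' F' jg ng og lamoo mF cF nac.
  (* For [k = 0] every law is absolutely continuous, against the hypothesis. *)
  exfalso; apply: nac => A _ /lebesgue_null_dim0 ->.
  by rewrite preimage_set0 measure0.
have g0 i j : \int[P]_w g' i j w = 0 by have [] := std_normal_moments (ng i j).
have g1 i j : ip P (g' i j) (g' i j) = 1 by have [] := std_normal_moments (ng i j).
have gS := gaussian_gspan jg (fun ij => g0 ij.1 ij.2).
have Sg i j := gspan_gen (fun ij : 'I_k'.+1 * nat => g' ij.1 ij.2) (i, j).
have og' i j j' : j <> j' -> ip P (g' i j) (g' i j') = 0.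
  by move=> /(og i); rewrite unlock /ip /Rintegral => ->.
have lamB i := eseries_partial_le (fun j => sqr_ge0 (lam' i j)) (lamoo i).
have [dep|ndep] := pselect (forall h (e : 'I_k'.+1 -> T -> R),
    L2closure P (gspan (fun ij : 'I_k'.+1 * nat => g' ij.1 ij.2)) h ->
    (forall p, L2closure P (gspan (fun ij : 'I_k'.+1 * nat => g' ij.1 ij.2)) (e p)) ->
    \det (\matrix_(p, i) form P g' lam' i h (e p)) = 0).
  exact: (dependent_case gS Sg g1 og' lamB mF cF dep).
exfalso; apply: ndep => h e Hh He; apply: contrapT => /eqP dhe; apply: nac.
exact: (generic_case gS Sg g1 og' lamB mF cF Hh He dhe).
Qed.
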